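(* There exist constants $C>0$, $\epsilon_0>0$, $\delta_0>0$ such that the following holds for all $\epsilon\in(0,\epsilon_0)$ and $\delta\in(0,\delta_0)$. Let $H$ be a harmonic function on $\mathbb{R}^2$ with $\nabla H(x,y)=\nabla H(x,y+2+\delta)$ for all $(x,y)\in\mathbb{R}^2$, and let $u$ be a solution for $H$ (in the sense of the context). Define $$N_v=\Big\{(x,y):\ |x|<1+\tfrac{\epsilon}{2}-\sqrt{1-y^2},\ |y|<\tfrac{\sqrt3}{2}\Big\},$$ $$N_h=\Big\{(x,y):\ \big|y-1-\tfrac{\delta}{2}\big|<1+\tfrac{\delta}{2}-\sqrt{1-(x-1-\tfrac{\epsilon}{2})^2},\ \big|x-1-\tfrac{\epsilon}{2}\big|<\tfrac{\sqrt3}{2}\Big\},$$ and $$S(x,y)=-2\sqrt{\delta}\,\frac{(x-1-\frac{\epsilon}{2})(y-1-\frac{\delta}{2})}{\big((x-1-\frac{\epsilon}{2})^2+\delta\big)^2}.$$ Then $\|S\|_{L^\infty(N_h)}\le 2$, $S(1+\frac{\epsilon}{2},1+\frac{\delta}{2})=0$, and there exist constants $\lambda,\mu$ and functions $R_1,R_2$ such that $$\nabla u(x,y)=\lambda\Big(\frac{1}{\delta+(x-1-\frac{\epsilon}{2})^2}(0,1)+\frac{1}{\sqrt\delta}S(x,y)(1,0)\Big)+R_1(x,y)\quad\text{for all }(x,y)\in N_h,$$ $$\nabla u(x,y)=\mu\,\frac{\sqrt\epsilon}{\epsilon+y^2}(1,0)+R_2(x,y)\quad\text{for all }(x,y)\in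 N_v,$$ where $\lambda=H(0,1)-H(0,-1)$, $|\mu|\le C\|H\|_{L^\infty(\Omega_4)}$, and $\|R_1\|_{L^\infty(N_h)}+\|R_2\|_{L^\infty(N_v)}\le C\|H\|_{L^\infty(\Omega_4)}$.
   Context: Let $\epsilon,\delta>0$. For each integer $n$, $D_{Rn}$ is the open unit disk centered at $(1+\frac{\epsilon}{2},\,n(2+\delta))$ and $D_{Ln}$ is the open unit disk centered at $(-1-\frac{\epsilon}{2},\,n(2+\delta))$; let $\mathcal D=\bigcup_{n\in\mathbb Z}(D_{Ln}\cup D_{Rn})$. Let $\Omega=\mathbb{R}\times(-1-\frac{\delta}{2},1+\frac{\delta}{2})$ and, for $m\ge 3$, $\Omega_m=\{(x,y)\in\Omega: |x|<m\}$. On disk boundaries, $\nu$ denotes the unit normal pointing into the disk. Given a harmonic $H$ on $\mathbb{R}^2$ with $(2+\delta)$-periodic gradient in $y$, a solution for $H$ is a function $u$ harmonic in $\mathbb{R}^2\setminus\overline{\mathcal D}$ such that: $u$ is constant on $\partial D_{L0}$ and constant on $\partial D_{R0}$; $\int_{\partial D_{L0}}\partial_\nu u\,ds=\int_{\partial D_{R0}}\partial_\nu u\,ds=0$; $\int_{\Omega\setminus\overline{D_{L0}\cup D_{R0}}}|\nabla(u-H)|^2\,dx\,dy<\infty$; and $\nabla u(x,y)=\nabla u(x,y+2+\delta)$ for all $(x,y)\in\mathbb{R}^2\setminus\overline{\mathcal D}$. *)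

(* Defs.v *)
From mathcomp Require Import all_boot all_order all_algebra.
From mathcomp Require Import all_classical all_reals all_analysis.
Set Implicit Arguments. Unset Strict Implicit. Unset Printing Implicit Defensive.
Import Order.TTheory GRing.Theory Num.Theory numFieldNormedType.Exports.
Local Open Scope classical_set_scope.
Local Open Scope ring_scope.

Definition dx {R : realType} (f : R * R -> R) (p : R * R) : R :=
  derive1 (fun t => f (t, p.2)) p.1.
Definition dy {R : realType} (f : R * R -> R) (p : R * R) : R :=
  derive1 (fun t => f (p.1, t)) p.2.
Definition grad {R : realType} (f : R * R -> R) (p : R * R) : R * R :=
  (dx f p, dy f p).

Definition partials_exist {R : realType} (f : R * R -> R) (p : R * R) : Prop :=
  derivable (fun t => f (t, p.2)) p.1 1 /\ derivable (fun t => f (p.1, t)) p.2 1.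

Definition C2_on {R : realType} (U : set (R * R)) (f : R * R -> R) : Prop :=
  (forall p, U p -> partials_exist f p /\ partials_exist (dx f) p
                  /\ partials_exist (dy f) p) /\
  {within U, continuous f} /\ {within U, continuous (dx f)} /\
  {within U, continuous (dy f)} /\ {within U, continuous (dx (dx f))} /\
  {within U, continuous (dy (dx f))} /\ {within U, continuous (dx (dy f))} /\
  {within U, continuous (dy (dy f))}.

Definition harmonic_on {R : realType} (U : set (R * R)) (f : R * R -> R) : Prop :=
  C2_on U f /\ forall p, U p -> dx (dx f) p + dy (dy f) p = 0.

Definition disk {R : realType} (c : R * R) : set (R * R) :=
  [set p | (p.1 - c.1) ^+ 2 + (p.2 - c.2) ^+ 2 < 1].
Definition circle {R : realType} (c : R * R) : set (R * R) :=
  [set p | (p.1 - c.1) ^+ 2 + (p.2 - c.2) ^+ 2 = 1].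

Definition cR {R : realType} (eps delta : R) (n : int) : R * R :=
  (1 + eps / 2, n%:~R * (2 + delta)).
Definition cL {R : realType} (eps delta : R) (n : int) : R * R :=
  (- 1 - eps / 2, n%:~R * (2 + delta)).

Definition calD {R : realType} (eps delta : R) : set (R * R) :=
  [set p | exists n : int, disk (cL eps delta n) p \/ disk (cR eps delta n) p].

Definition ext {R : realType} (eps delta : R) : set (R * R) :=
  ~` closure (calD eps delta).

Definition Omega {R : realType} (delta : R) : set (R * R) :=
  [set p | - 1 - delta / 2 < p.2 < 1 + delta / 2].
Definition Omega_m {R : realType} (delta m : R) : set (R * R) :=
  [set p | Omega delta p /\ `|p.1| < m].

(* flux int_{\partial B(c,1)} G . nu ds, with nu the normal pointing into the disk,
   parametrized by arclength t in [0, 2 pi] *)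
Definition flux {R : realType} (G : R * R -> R * R) (c : R * R) : \bar R :=
  (\int[@lebesgue_measure R]_(t in `[0%R, (2 * pi)%R]%classic)
     ((G (c.1 + cos t, c.2 + sin t)).1 * (- cos t)
      + (G (c.1 + cos t, c.2 + sin t)).2 * (- sin t))%:E)%E.

Definition energy {R : realType} (A : set (R * R)) (g : R * R -> R * R) : \bar R :=
  (\int[(@lebesgue_measure R \x @lebesgue_measure R)%E]_(p in A)
     ((g p).1 ^+ 2 + (g p).2 ^+ 2)%:E)%E.

Definition is_solution {R : realType} (eps delta : R) (H u : R * R -> R) : Prop :=
  harmonic_on (ext eps delta) u /\
  {within closure (ext eps delta), continuous u} /\
  (exists c, forall p, circle (cL eps delta 0) p -> u p = c) /\
  (exists c, forall p, circle (cR eps delta 0) p -> u p = c) /\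
  (exists G : R * R -> R * R,
     {within closure (ext eps delta), continuous G} /\
     (forall p, ext eps delta p -> G p = grad u p) /\
     flux G (cL eps delta 0) = 0%E /\ flux G (cR eps delta 0) = 0%E) /\
  (energy (Omega delta `\` closure (disk (cL eps delta 0) `|` disk (cR eps delta 0)))
          (grad (fun p => (u p - H p)%R)) < +oo)%E /\
  (forall p, ext eps delta p -> grad u p = grad u (p.1, p.2 + (2 + delta))).

(* L^infty norms (sup of continuous functions) *)
Definition supnorm {R : realType} (A : set (R * R)) (f : R * R -> R) : \bar R :=
  ereal_sup [set (`|f p|)%:E | p in A].
Definition supnorm2 {R : realType} (A : set (R * R)) (F : R * R -> R * R) : \bar R :=
  ereal_sup [set (Num.sqrt ((F p).1 ^+ 2 + (F p).2 ^+ 2))%:E | p in A].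

Definition Nv {R : realType} (eps : R) : set (R * R) :=
  [set p | `|p.1| < 1 + eps / 2 - Num.sqrt (1 - p.2 ^+ 2) /\
           `|p.2| < Num.sqrt 3 / 2].
Definition Nh {R : realType} (eps delta : R) : set (R * R) :=
  [set p | `|p.2 - 1 - delta / 2| < 1 + delta / 2 - Num.sqrt (1 - (p.1 - 1 - eps / 2) ^+ 2)
        /\ `|p.1 - 1 - eps / 2| < Num.sqrt 3 / 2].
Definition Sfun {R : realType} (eps delta : R) (p : R * R) : R :=
  - 2 * Num.sqrt delta * ((p.1 - 1 - eps / 2) * (p.2 - 1 - delta / 2))
    / ((p.1 - 1 - eps / 2) ^+ 2 + delta) ^+ 2.

(* Main.v *)
(** The finite energy and the periodicity of the gradients force [u - H] to be periodic
    and small compared with [|x|] along vertical lines going to infinity, so the maximum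
    principle on a cylinder bounds it by its values on the circles. Hence [u] differs from
    the mean of its two boundary constants by at most [|c0| + 4 M], where [c0] is half their
    difference and [M] bounds [H].

    Near a gap of width [t], let [gap_model t] be the logarithmic potential of two opposite
    charges for which both circles are level lines. Subtracting from [u] the multiple with
    the same boundary values leaves a function vanishing on the circles. A barrier shows
    that it grows at most linearly in the distance to a circle, and an interior estimate
    then bounds its gradient by a multiple of [|c0| + M], uniformly in [eps] and [delta].
    In the horizontal gap this is the claim: there the boundary values differ by the
    increment of [H] over a period.

    In the vertical neck one also needs [|c0| <= C sqrt eps M]. The part [v] of [u] even in
    [y] is constant on all right disks, so its normal derivative on the right circle is
    of size [|c0| / eps] on an arc of length [sqrt eps] at the neck, and elsewhere bounded
    below, up to the sign of [c0], by [- C (|c0| + M)]. Its integral is zero. *)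

Require Import Defs.
From mathcomp Require Import all_boot all_order all_algebra.
From mathcomp Require Import all_classical all_reals all_analysis.
From mathcomp Require Import measurable_realfun ring lra.
Import Order.TTheory GRing.Theory Num.Theory numFieldNormedType.Exports.
Local Open Scope classical_set_scope.
Local Open Scope ring_scope.
Set Implicit Arguments.
Unset Strict Implicit.

(** * Second derivatives, Laplacian and maximum principle *)

(** Every quantitative estimate is a comparison with an explicit barrier. The barrier next to a
    circle sees one unit disk and a box of fixed size, never the width of the gap; this gives the
    uniformity in [eps] and [delta]. At distance [d] from a circle the function is at most [C d],
    the interior estimate at scale [d] divides by [d], and [d] cancels.

    The even part enters because [u] jumps by a fixed amount from each disk of a column to the next,
    so near the horizontal gaps its normal derivative can be as large as the jump over [delta]. In
    the even part the jumps cancel, and the derivative stays bounded there.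

    The gradient bounds contain [|c0|], which is what the flux has to control. The circle closes
    because the flux yields [|c0| <= 16 grad_const sqrt eps (|c0| + 4 M)]: for [eps] small against
    [grad_const] the term with [|c0|] is absorbed. This dictates [eps0].

    [M] is any positive bound of [H], not its supremum, so that the barriers have positive height;
    the supremum is reached at the end by a limit. *)

Definition has_d2 {R : realType} (g : R -> R) (x b : R) : Prop :=
  (\forall t \near x, derivable g t 1) /\ is_derive x 1 (derive1 g) b.

(** Only the second derivatives along the two coordinate lines through the point are recorded. That
    is all a comparison at a maximum uses, and an explicit barrier satisfies it by one-variable
    calculus. *)
Definition has_lap {R : realType} (f : R * R -> R) (p : R * R) (l : R) : Prop :=
  exists a b, [/\ has_d2 (fun t => f (t, p.2)) p.1 a,
                  has_d2 (fun t => f (p.1, t)) p.2 b & l = a + b].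

Section SecondDerivative.
Context {R : realType}.
Implicit Types (f g : R -> R) (x a b : R).

Lemma derive1_is_derive f x a : is_derive x 1 f a -> f^`()%classic x = a.
Proof. by move=> h; rewrite derive1E derive_val. Qed.

Lemma derivable_is_derive1 f x : derivable f x 1 -> is_derive x 1 f (f^`()%classic x).
Proof. by move=> /derivableP; rewrite -derive1E. Qed.

Lemma has_d2_intro g g1 x b : (\forall t \near x, is_derive (t : R) 1 g (g1 t)) ->
  is_derive x 1 g1 b -> has_d2 g x b.
Proof.
move=> h1 h2; split; first by apply: filterS h1 => t [].
apply: near_eq_is_derive h2; apply: filterS h1 => t h.
by rewrite (derive1_is_derive h).
Qed.

Lemma has_d2D f g x a b : has_d2 f x a -> has_d2 g x b ->
  has_d2 (fun t => f t + g t) x (a + b).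
Proof.
move=> [f1 f2] [g1 g2].
apply: (@has_d2_intro _ (fun t => f^`()%classic t + g^`()%classic t)).
apply: filterS2 f1 g1 => t df dg.
exact: is_deriveD (derivable_is_derive1 df) (derivable_is_derive1 dg).
Qed.

Lemma has_d2Z f (k : R) x a : has_d2 f x a ->
  has_d2 (fun t => k * f t) x (k * a).
Proof.
move=> [f1 f2].
apply: (@has_d2_intro _ (fun t => k * f^`()%classic t)).
apply: filterS f1 => t df; exact: is_deriveZ (derivable_is_derive1 df).
Qed.

Lemma has_d2_cst (k x : R) : has_d2 (fun=> k) x 0.
Proof.
apply: (@has_d2_intro _ (fun=> 0)).
by near=> t; exact: is_derive_cst.
Unshelve. all: by end_near. Qed.

Lemma is_derive_affine (s c x : R) : is_derive x 1 (fun t => s * t + c) s.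
Proof.
apply: is_derive_eq.
by rewrite addr0 /GRing.scale /= mulr1.
Qed.

Lemma is_derive_comp_affine f (s c x e : R) : is_derive (s * x + c) 1 f e ->
  is_derive x 1 (fun t => f (s * t + c)) (s * e).
Proof.
move=> fe; rewrite mulrC.
exact: (@is_derive1_comp _ f (fun t => s * t + c) _ _ _ fe (is_derive_affine _ _ _)).
Qed.

Lemma has_d2_affine f (s c x : R) a : has_d2 f (s * x + c) a ->
  has_d2 (fun t => f (s * t + c)) x (s ^+ 2 * a).
Proof.
move=> [f1 f2].
have ct : (fun t => s * t + c) @ x --> s * x + c.
  by apply: cvgD; [apply: cvgM; [exact: cvg_cst|exact: cvg_id]|exact: cvg_cst].
apply: (@has_d2_intro _ (fun t => s * f^`()%classic (s * t + c))).
  have near_df : \forall t \near x, derivable f (s * t + c) 1 := ct _ f1.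
  apply: filterS near_df => t df; apply: is_derive_comp_affine.
  exact: derivable_is_derive1.
by rewrite expr2 -mulrA; exact: (is_deriveZ s (is_derive_comp_affine f2)).
Qed.

(** If [a] were positive, [f'] would vanish at [x] with positive slope, hence be positive just to
    the right of [x], and the mean value theorem would lift [f] above [f x]. *)
Lemma has_d2_max f x a : (\forall t \near x, f t <= f x) -> has_d2 f x a -> a <= 0.
Proof.
move=> fm [f1 f2]; rewrite leNgt; apply/negP => a0.
have /nbhs_ballP[e1 /= e10 he1] := fm.
have /nbhs_ballP[e2 /= e20 he2] := f1.
have d1 : f^`()%classic x = 0.
  pose e := Num.min e1 e2.
  have e0 : 0 < e by rewrite lt_min e10.
  apply: derive1_is_derive; apply: (@derive1_at_max _ _ (x - e) (x + e)).
  - lra.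
  - move=> t; rewrite in_itv/= => /andP[h1 h2]; apply: he2.
    rewrite /ball/= ltr_norml; have : e <= e2 by rewrite ge_min lexx orbT.
    by move=> ?; apply/andP; split; lra.
  - by rewrite in_itv/=; apply/andP; split; lra.
  - move=> t; rewrite in_itv/= => /andP[h1 h2]; apply: he1.
    rewrite /ball/= ltr_norml; have : e <= e1 by rewrite ge_min lexx.
    by move=> ?; apply/andP; split; lra.
have d2 : h^-1 *: ((f^`()%classic \o shift x) h - f^`()%classic x) @[h --> 0^'] --> a.
  have [dv <-] := f2; move: dv => /cvg_ex[l hl]; rewrite /derive (cvg_lim _ hl)//.
  apply: cvg_trans hl; apply: near_eq_cvg; near=> h.
  by rewrite /= /GRing.scale /= mulr1.
have /nbhs_ballP[e3 /= e30 he3] : \forall h \near 0^',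
  0 < h^-1 *: ((f^`()%classic \o shift x) h - f^`()%classic x).
  exact: (cvgr_gt _ d2).
pose e := Num.min e1 (Num.min e2 e3).
have e0 : 0 < e by rewrite !lt_min e10 e20.
have ee1 : e <= e1 by rewrite ge_min lexx.
have ee2 : e <= e2 by rewrite !ge_min lexx orbT.
have ee3 : e <= e3 by rewrite !ge_min lexx !orbT.
have dff (t : R) : x <= t <= x + e / 2 -> derivable f t 1.
  move=> /andP[h1 h2]; apply: he2; rewrite /ball/= ltr_norml.
  by apply/andP; split; lra.
have [|||c] := @MVT _ f f^`()%classic x (x + e / 2); first lra.
- move=> t /andP[]; rewrite !bnd_simp => h1 h2.
  by apply: derivable_is_derive1; apply: dff; rewrite !ltW.
- by apply: derivable_within_continuous => t; rewrite in_itv/= => /dff.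
rewrite in_itv/= => /andP[c1 c2] eq.
have : f (x + e / 2) <= f x.
  by apply: he1; rewrite /ball/= ltr_norml; apply/andP; split; lra.
have : 0 < f^`()%classic c.
  have ci : 0 < (c - x)^-1 by rewrite invr_gt0; lra.
  have cx : ball (0 : R) e3 (c - x).
    by rewrite /ball/= sub0r normrN ger0_norm; lra.
  have cx0 : c - x != 0 by rewrite subr_eq0 gt_eqF.
  by have := he3 _ cx cx0; rewrite /= subrK d1 subr0 /GRing.scale/= pmulr_rgt0.
move=> dc; have := mulr_gt0 dc (_ : 0 < x + e / 2 - x); lra.
Unshelve. all: by end_near. Qed.
End SecondDerivative.

Section Laplacian.
Context {R : realType}.
Implicit Types (f g : R * R -> R) (p q : R * R) (a b l m : R).

Lemma has_lapD f g p l m : has_lap f p l -> has_lap g p m ->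
  has_lap (fun q => f q + g q) p (l + m).
Proof.
move=> [a [b [fa fb ->]]] [a' [b' [ga gb ->]]].
exists (a + a'), (b + b'); split; [exact: has_d2D|exact: has_d2D|].
by rewrite addrACA.
Qed.

Lemma has_lapZ f p (k : R) l : has_lap f p l ->
  has_lap (fun q => k * f q) p (k * l).
Proof.
move=> [a [b [fa fb ->]]]; exists (k * a), (k * b).
by split; [exact: has_d2Z|exact: has_d2Z|rewrite mulrDr].
Qed.

Lemma has_lapB f g p l m : has_lap f p l -> has_lap g p m ->
  has_lap (fun q => f q - g q) p (l - m).
Proof.
move=> hf /(has_lapZ (-1)); rewrite mulN1r => hg.
have -> : (fun q => f q - g q) = (fun q => f q + -1 * g q).
  by apply/funext => q; rewrite mulN1r.
exact: has_lapD.
Qed.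

Lemma has_lap_cst (k : R) p : has_lap (fun=> k) p 0.
Proof.
by exists 0, 0; split; [exact: has_d2_cst|exact: has_d2_cst|rewrite addr0].
Qed.

(** The condition [s ^+ 2 = t ^+ 2 = 1] covers translations and reflections in lines parallel to the
    axes at once. *)
Lemma has_lap_refl f p (s c t d : R) l : s ^+ 2 = 1 -> t ^+ 2 = 1 ->
  has_lap f (s * p.1 + c, t * p.2 + d) l ->
  has_lap (fun q => f (s * q.1 + c, t * q.2 + d)) p l.
Proof.
move=> s1 t1 [a [b [/= ha hb ->]]]; exists a, b; split => //=.
  by have := has_d2_affine ha; rewrite s1 mul1r.
by have := has_d2_affine hb; rewrite t1 mul1r.
Qed.

Lemma near_slice1 (P : R * R -> Prop) p :
  (\forall q \near p, P q) -> \forall t \near p.1, P (t, p.2).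
Proof.
case: p => x y /nbhs_ballP[e /= e0 he]; apply/nbhs_ballP; exists e => //= t xt.
by apply: he; split => //=; exact: ballxx.
Qed.

Lemma near_slice2 (P : R * R -> Prop) p :
  (\forall q \near p, P q) -> \forall t \near p.2, P (p.1, t).
Proof.
case: p => x y /nbhs_ballP[e /= e0 he]; apply/nbhs_ballP; exists e => //= t xt.
by apply: he; split => //=; exact: ballxx.
Qed.

Lemma harmonic_has_lap (U : set (R * R)) f p : open U -> harmonic_on U f -> U p ->
  has_lap f p 0.
Proof.
move=> oU [[df _] Lf] Up; have nU : \forall q \near p, U q.
  by have := open_nbhs_nbhs (conj oU Up).
exists (dx (dx f) p), (dy (dy f) p); split; last by rewrite Lf.
- split; last first.
    by have [_ [[/derivableP h _] _]] := df _ Up; rewrite -derive1E in h.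
  by apply: filterS (near_slice1 nU) => t /= Ut; have [[h1 h2] _] := df _ Ut; exact: h1.
- split; last first.
    by have [_ [_ [_ /derivableP h]]] := df _ Up; rewrite -derive1E in h.
  by apply: filterS (near_slice2 nU) => t /= Ut; have [[h1 h2] _] := df _ Ut; exact: h2.
Qed.

Lemma has_lap_max f p l : (\forall q \near p, f q <= f p) -> has_lap f p l ->
  l <= 0.
Proof.
move=> fm [a [b [ha hb ->]]]; rewrite -oppr_ge0 opprD addr_ge0// oppr_ge0.
  by apply: has_d2_max ha; have := near_slice1 fm; case: (p).
by apply: has_d2_max hb; have := near_slice2 fm; case: (p).
Qed.

(* Near a point [p] of [K] the values of [f] only need to be values taken on [K]:
   this covers interior points and, for periodic [f], fundamental domains. *)
Lemma max_principle (K : set (R * R)) f :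
  compact K -> {within K, continuous f} ->
  (forall p, K p -> 0 < f p ->
     (\forall q \near p, exists2 q', K q' & f q = f q') /\
     exists2 l, 0 < l & has_lap f p l) ->
  forall p, K p -> f p <= 0.
Proof.
move=> cK cf hK p Kp; have [|p0 /set_mem Kp0 pm] := compact_EVT_max _ cK cf.
  by exists p.
have {pm}pm q : K q -> f q <= f p0 by move=> Kq; apply: pm; rewrite inE.
apply: le_trans (pm _ Kp) _; rewrite leNgt; apply/negP => fp0.
have [nK [l l0 hl]] := hK _ Kp0 fp0.
suff : l <= 0 by rewrite leNgt l0.
by apply: has_lap_max hl; apply: filterS nK => q [q' Kq' ->]; exact: pm.
Qed.

End Laplacian.

(** * Topology of the plane *)

Definition sqd {R : realType} (q c : R * R) : R :=
  (q.1 - c.1) ^+ 2 + (q.2 - c.2) ^+ 2.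

Definition box {R : realType} (p : R * R) (r : R) : set (R * R) :=
  [set q | `|q.1 - p.1| <= r /\ `|q.2 - p.2| <= r].

Definition rect {R : realType} (a b c d : R) : set (R * R) :=
  [set q | a <= q.1 <= b /\ c <= q.2 <= d].

Section Plane.
Context {R : realType}.
Implicit Types (f g : R * R -> R) (p q c : R * R) (a b r : R) (s : seq (R * R)).

Lemma continuous_fst : continuous (fst : R * R -> R).
Proof. by move=> p; exact: cvg_fst. Qed.

Lemma continuous_snd : continuous (snd : R * R -> R).
Proof. by move=> p; exact: cvg_snd. Qed.

Lemma continuous_sqd c : continuous (fun q : R * R => sqd q c).
Proof.
move=> p; by rewrite /sqd; apply: cvgD; under eq_fun do rewrite expr2; rewrite expr2;
  apply: cvgM; apply: cvgB; do ?exact: cvg_cst;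
  [exact: continuous_fst|exact: continuous_fst|exact: continuous_snd|
   exact: continuous_snd].
Qed.

Lemma near_lt f g p : {for p, continuous f} -> {for p, continuous g} ->
  f p < g p -> \forall q \near p, f q < g q.
Proof.
move=> cf cg fg.
have h : {for p, continuous (fun q => g q - f q)} by exact: cvgB.
have fg0 : 0 < g p - f p by rewrite subr_gt0.
have : \forall q \near p, 0 < g q - f q by exact: (cvgr_gt _ h).
by apply: filterS => q /=; rewrite subr_gt0.
Qed.

Lemma near_rect p a b a' b' : a < p.1 < b -> a' < p.2 < b' ->
  \forall q \near p, a < q.1 < b /\ a' < q.2 < b'.
Proof.
move=> /andP[h1 h2] /andP[h3 h4].
have n1 := near_lt (@cvg_cst _ _ _ _ _) (@continuous_fst p) h1.
have n2 := near_lt (@continuous_fst p) (@cvg_cst _ _ _ _ _) h2.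
have n3 := near_lt (@cvg_cst _ _ _ _ _) (@continuous_snd p) h3.
have n4 := near_lt (@continuous_snd p) (@cvg_cst _ _ _ _ _) h4.
near=> q; split; apply/andP; split; near: q.
- exact: n1. - exact: n2. - exact: n3. - exact: n4.
Unshelve. all: by end_near. Qed.

Lemma closed_le_fun f g : continuous f -> continuous g ->
  closed [set q | f q <= g q].
Proof.
move=> cf cg.
rewrite (_ : [set q | _] = (fun q => g q - f q) @^-1` [set x | 0 <= x]).
  apply: preimage_closed; last exact: closed_ge.
  by move=> x _; apply: cvgB; [exact: cg|exact: cf].
by apply/seteqP; split=> q /=; rewrite subr_ge0.
Qed.

Lemma compact_rect a b a' b' : compact (rect a b a' b').
Proof.
rewrite (_ : rect _ _ _ _ = `[a, b] `*` `[a', b']).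
  by apply: compact_setX; exact: segment_compact.
by apply/seteqP; split=> -[x y] /=; rewrite /= !in_itv /=.
Qed.

Lemma withinP (A : set (R * R)) f : {within A, continuous f} ->
  forall q, A q -> f @ within A (nbhs q) --> f q.
Proof. by move=> /subspace_continuousP. Qed.

Lemma withinI (A : set (R * R)) f :
  (forall q, A q -> f @ within A (nbhs q) --> f q) -> {within A, continuous f}.
Proof. by move=> h; apply/subspace_continuousP. Qed.

Lemma within_near (A : set (R * R)) f p : {within A, continuous f} ->
  (\forall q \near p, A q) -> {for p, continuous f}.
Proof.
move=> /withinP cf nA; have := cf _ (nbhs_singleton nA).
by rewrite (within_interior (nbhs_singleton (nbhs_interior nA))).
Qed.

Lemma pointwise_within (A : set (R * R)) f :
  (forall p, A p -> {for p, continuous f}) -> {within A, continuous f}.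
Proof.
by move=> h; apply: withinI => q Aq; apply: cvg_within_filter; exact: h.
Qed.

(** The reflection argument below only controls the symmetric difference [g (x + t) - g (x - t)],
    whose quotient by [t] tends to twice the derivative. *)
Lemma is_derive_odd_bound (g : R -> R) (x d C r : R) : is_derive x 1 g d ->
  0 < r -> (forall t : R, 0 < t <= r -> `|g (x + t) - g (x - t)| <= C * t) ->
  `|d| <= C / 2.
Proof.
move=> gd r0 hg.
have d2 : is_derive (0 : R) 1 (fun t => g (x + t) - g (x - t)) (2 * d).
  have h1 : is_derive ((1 : R) * 0 + x) 1 g d by rewrite mulr0 add0r.
  have h2 : is_derive ((-1 : R) * 0 + x) 1 g d by rewrite mulr0 add0r.
  have k1 := is_derive_comp_affine h1; have k2 := is_derive_comp_affine h2.
  have -> : (fun t => g (x + t) - g (x - t)) =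
      (fun t : R => g (1 * t + x)) - (fun t : R => g (-1 * t + x)).
    by apply/funext => t; rewrite !fctE /= mul1r mulN1r ![_ + x]addrC.
  by apply: is_derive_eq; rewrite mul1r mulN1r opprK mulr_natl mulr2n.
have cv : h^-1 *: (g (x + h) - g (x - h)) @[h --> 0^'] --> 2 * d.
  have [dv <-] := d2; move: dv => /cvg_ex[l hl]; rewrite /derive (cvg_lim _ hl)//.
  apply: cvg_trans hl; apply: near_eq_cvg; near=> h.
  by rewrite /= /GRing.scale /= mulr1 !addr0 subr0 subrr subr0.
have : `|2 * d| <= C.
  apply: (cvgr_to_le (cvg_norm cv)); near=> h.
  have h0 : h != 0 by near: h; exact: nbhs_dnbhs_neq.
  have hr : `|h| <= r.
    near: h; apply: (@cvgr_norm_le _ _ _ _ _ idfun 0); last by rewrite normr0.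
    exact: cvg_within.
  rewrite /GRing.scale/= normrM normfV ler_pdivrMl ?normr_gt0//.
  have hh : 0 < `|h| by rewrite normr_gt0.
  have := hg `|h|; rewrite hh hr => /(_ isT); rewrite [`|h| * C]mulrC.
  have [h1|h1] := leP 0 h; first by rewrite (ger0_norm h1).
  by rewrite (ltr0_norm h1) opprK distrC.
by rewrite normrM ger0_norm => [H|//]; lra.
Unshelve. all: by end_near. Qed.
End Plane.

(** * Barriers *)

Section Barriers.
Context {R : realType}.
Implicit Types (x a k : R) (p q c : R * R).

Lemma is_derive_sqrB a x : is_derive x 1 (fun t => (t - a) ^+ 2) (2 * (x - a)).
Proof.
have h : is_derive x 1 (fun t => t - a) 1.
  by have := is_derive_affine 1 (- a) x; congr is_derive; apply/funext => t; rewrite mul1r.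
have -> : (fun t => (t - a) ^+ 2) = (fun t => t - a) * (fun t => t - a).
  by apply/funext => t; rewrite expr2.
by apply: is_derive_eq; rewrite /GRing.scale/=; ring.
Qed.

Lemma is_derive_linB (m a x : R) : is_derive x 1 (fun t => m * (t - a)) m.
Proof.
by have := is_derive_affine m (- (m * a)) x; congr is_derive;
  apply/funext => t; rewrite mulrBr.
Qed.

Lemma has_d2_sqrB a x : has_d2 (fun t => (t - a) ^+ 2) x 2.
Proof.
apply: (@has_d2_intro _ _ (fun t => 2 * (t - a))); last exact: is_derive_linB.
by near=> t; exact: is_derive_sqrB.
Unshelve. all: by end_near. Qed.

Lemma has_d2_lin a x : has_d2 (fun t => t - a) x 0.
Proof.
apply: (@has_d2_intro _ _ (fun=> 1)).
near=> t.
by have := is_derive_linB 1 a t; congr is_derive; apply/funext => u; rewrite mul1r.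
Unshelve. all: by end_near. Qed.

Lemma near_sqrB_gt0 (a k x : R) : 0 < (x - a) ^+ 2 + k ->
  \forall t \near x, 0 < (t - a) ^+ 2 + k.
Proof.
have c : {for x, continuous (fun t => (t - a) ^+ 2 + k)}.
  apply: cvgD; last exact: cvg_cst.
  rewrite expr2; under eq_fun do rewrite expr2.
  by apply: cvgM; apply: cvgB; [exact: cvg_id|exact: cvg_cst|exact: cvg_id|exact: cvg_cst].
by move=> h; exact: (cvgr_gt _ c).
Qed.

Lemma is_derive_sqrBD (a k x : R) :
  is_derive x 1 (fun t => (t - a) ^+ 2 + k) (2 * (x - a)).
Proof.
have h := is_derive_sqrB a x.
have -> : (fun t => (t - a) ^+ 2 + k) = (fun t => (t - a) ^+ 2) + cst k by [].
by apply: is_derive_eq; rewrite addr0.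
Qed.

Lemma is_derive_invsq (a k x : R) : 0 < (x - a) ^+ 2 + k ->
  is_derive x 1 (fun t => ((t - a) ^+ 2 + k)^-1)
    (- (2 * (x - a)) / ((x - a) ^+ 2 + k) ^+ 2).
Proof.
move=> h; have d := is_derive_sqrBD a k x.
have := @is_deriveV _ (fun t => (t - a) ^+ 2 + k) _ _ _ (lt0r_neq0 h) d.
by rewrite /GRing.scale/= !mulNr mulrC.
Qed.

Lemma has_d2_invsq (a k x : R) : 0 < (x - a) ^+ 2 + k ->
  has_d2 (fun t => ((t - a) ^+ 2 + k)^-1) x
   ((8 * (x - a) ^+ 2 - 2 * ((x - a) ^+ 2 + k)) / ((x - a) ^+ 2 + k) ^+ 3).
Proof.
move=> h.
apply: (@has_d2_intro _ _ (fun t => (- 2 * (t - a)) *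
   (((t - a) ^+ 2 + k)^-1 * ((t - a) ^+ 2 + k)^-1))).
  apply: filterS (near_sqrB_gt0 h) => t /is_derive_invsq.
  by rewrite expr2 invfM mulNr.
have dl := is_derive_linB (-2) a x; have di := is_derive_invsq h.
have -> : (fun t => (- 2 * (t - a)) * (((t - a) ^+ 2 + k)^-1 * ((t - a) ^+ 2 + k)^-1))
  = (fun t => - 2 * (t - a)) * ((fun t => ((t - a) ^+ 2 + k)^-1)
       * (fun t => ((t - a) ^+ 2 + k)^-1)) by [].
apply: is_derive_eq; rewrite /GRing.scale/=.
by rewrite !fctE; field; rewrite gt_eqF.
Qed.

Lemma has_d2_lnsq (a k x : R) : 0 < (x - a) ^+ 2 + k ->
  has_d2 (fun t => ln ((t - a) ^+ 2 + k)) x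
   ((2 * k - 2 * (x - a) ^+ 2) / ((x - a) ^+ 2 + k) ^+ 2).
Proof.
move=> h.
have dln (t : R) : 0 < (t - a) ^+ 2 + k ->
    is_derive t 1 (fun t => ln ((t - a) ^+ 2 + k)) (2 * (t - a) * ((t - a) ^+ 2 + k)^-1).
  move=> t0; have := @is_derive1_comp _ (@ln R) (fun t => (t - a) ^+ 2 + k) _ _ _
    (is_derive1_ln t0) (is_derive_sqrBD a k t).
  by rewrite mulrC.
apply: (@has_d2_intro _ _ (fun t => (2 * (t - a)) * ((t - a) ^+ 2 + k)^-1)).
  by apply: filterS (near_sqrB_gt0 h) => t /dln.
have dl := is_derive_linB 2 a x; have di := is_derive_invsq h.
have -> : (fun t => (2 * (t - a)) * ((t - a) ^+ 2 + k)^-1)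
  = (fun t => 2 * (t - a)) * (fun t => ((t - a) ^+ 2 + k)^-1) by [].
apply: is_derive_eq; rewrite /GRing.scale/=.
by field; rewrite gt_eqF.
Qed.

Lemma has_lap_sqd c p : has_lap (fun q => sqd q c) p 4.
Proof.
exists 2, 2; split; rewrite /sqd/=; last by rewrite -natrD.
- by rewrite -[2]addr0; apply: has_d2D; [exact: has_d2_sqrB|exact: has_d2_cst].
- by rewrite -[2]add0r; apply: has_d2D; [exact: has_d2_cst|exact: has_d2_sqrB].
Qed.

Lemma has_lap_invsqd c p : 0 < sqd p c ->
  has_lap (fun q => (sqd q c)^-1) p (4 / sqd p c ^+ 2).
Proof.
rewrite /sqd => h; have h' := h; rewrite addrC in h'.
eexists _, _; split=> /=; first exact: (has_d2_invsq h).
  have := has_d2_invsq h'; rewrite (_ : (fun t => _) =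
    (fun t => ((p.1 - c.1) ^+ 2 + (t - c.2) ^+ 2)^-1)); first exact.
  by apply/funext => t; rewrite addrC.
by field; rewrite !gt_eqF.
Qed.

Lemma has_lap_lnsqd c p : 0 < sqd p c -> has_lap (fun q => ln (sqd q c)) p 0.
Proof.
rewrite /sqd => h; have h' := h; rewrite addrC in h'.
eexists _, _; split=> /=; first exact: (has_d2_lnsq h).
  have := has_d2_lnsq h'; rewrite (_ : (fun t => _) =
    (fun t => ln ((p.1 - c.1) ^+ 2 + (t - c.2) ^+ 2))); first exact.
  by apply/funext => t; rewrite addrC.
by field; rewrite !gt_eqF.
Qed.

End Barriers.

(** * Interior gradient estimate *)

Section InteriorGradient.
Context {R : realType}.
Implicit Types (v : R * R -> R) (p q c P : R * R).

Lemma continuous_refl v q (s c t d : R) :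
  {for (s * q.1 + c, t * q.2 + d), continuous v} ->
  {for q, continuous (fun q => v (s * q.1 + c, t * q.2 + d))}.
Proof.
move=> cv.
apply: (@continuous_comp _ _ _ (fun q : R * R => (s * q.1 + c, t * q.2 + d)) v) => //.
have h1 : s * x.1 + c @[x --> q] --> s * q.1 + c.
  by apply: cvgD; [apply: cvgM; [exact: cvg_cst|exact: continuous_fst]|exact: cvg_cst].
have h2 : t * x.2 + d @[x --> q] --> t * q.2 + d.
  by apply: cvgD; [apply: cvgM; [exact: cvg_cst|exact: continuous_snd]|exact: cvg_cst].
exact: (cvg_pair h1 h2).
Qed.

(* The difference of [v] and its reflection in the line [q.1 = P.1] vanishes on
   that line, so a barrier bounds it linearly in the distance to the line. *)
Lemma reflected_difference_le v P (r A : R) : 0 < r -> 0 < A ->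
  (forall q, box P r q -> has_lap v q 0) ->
  (forall q, box P r q -> {for q, continuous v}) ->
  (forall q, box P r q -> `|v q| <= A) ->
  forall t, 0 < t <= r -> v (P.1 + t, P.2) - v (P.1 - t, P.2) <= 6 * A / r * t.
Proof.
move=> r0 A0 Lv cv bv t /andP[t0 tr].
pose V q := v q - v (-1 * q.1 + 2 * P.1, 1 * q.2 + 0).
(* With [x = q.1 - P.1], [B = |q - P|^2 + 3 x (r - x)] has Laplacian [4 - 6 = -2], is nonnegative on
   the half box, and is at least [r^2] on its three sides other than [x = 0]. There [2 A / r^2 * B]
   dominates [V <= 2 A], and on [x = 0] [V] vanishes. *)
pose B q := sqd q P + (3 * r * (q.1 - P.1) - 3 * (q.1 - P.1) ^+ 2).
pose F q := V q + - (2 * A / r ^+ 2) * B q.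
have bK q : rect P.1 (P.1 + r) (P.2 - r) (P.2 + r) q ->
    box P r q /\ box P r (-1 * q.1 + 2 * P.1, 1 * q.2 + 0).
  by move=> /= [] /andP[? ?] /andP[? ?]; rewrite /box/= !ler_norml;
    split; split; apply/andP; split; lra.
have cB q : {for q, continuous B}.
  apply: cvgD; first exact: continuous_sqd.
  have h : {for q, continuous (fun q : R * R => q.1 - P.1)}.
    by apply: cvgB; [exact: continuous_fst|exact: cvg_cst].
  apply: cvgB; first by apply: cvgM => //; exact: cvg_cst.
  rewrite expr2; under eq_fun do rewrite expr2.
  by apply: cvgM; [exact: cvg_cst|exact: cvgM].
have LB q : has_lap B q (-2).
  exists (2 + (0 - 3 * 2)), (2 + 0); split; last by ring.
  - apply: has_d2D; first by rewrite -[2]addr0 /sqd/=; apply: has_d2D;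
      [exact: has_d2_sqrB|exact: has_d2_cst].
    have -> : 0 - 3 * 2 = 3 * r * 0 + - 3 * 2 :> R by ring.
    rewrite (_ : (fun t => _) = (fun t => 3 * r * (t - P.1) + - 3 * (t - P.1) ^+ 2)).
      by apply: has_d2D; apply: has_d2Z; [exact: has_d2_lin|exact: has_d2_sqrB].
    by apply/funext => u /=; rewrite mulNr.
  - rewrite /B /sqd /=; apply: has_d2D; last by apply: has_d2_cst.
    by rewrite -[2]add0r; apply: has_d2D; [apply: has_d2_cst|exact: has_d2_sqrB].
have k0 : 0 < 2 * A / r ^+ 2 by rewrite divr_gt0// ?exprn_gt0// mulr_gt0.
have r2 : 2 * A / r ^+ 2 * r ^+ 2 = 2 * A by rewrite divfK// expf_neq0// gt_eqF.
have FK := @max_principle _ (rect P.1 (P.1 + r) (P.2 - r) (P.2 + r)) F.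
have : F (P.1 + t, P.2) <= 0.
  apply: FK.
  - exact: compact_rect.
  - apply: pointwise_within => q /bK[b1 b2].
    apply: cvgD; first by apply: cvgB; [exact: cv|apply: continuous_refl; exact: cv].
    by apply: cvgM; [exact: cvg_cst|exact: cB].
  - move=> q Kq Fq; have [b1 b2] := bK _ Kq; split; last first.
      exists (2 * A / r ^+ 2 * 2); first by rewrite mulr_gt0.
      have -> : 2 * A / r ^+ 2 * 2 = (0 - 0) + - (2 * A / r ^+ 2) * (-2) by ring.
      apply: has_lapD; last exact: has_lapZ.
      apply: has_lapB; first exact: Lv.
      by apply: has_lap_refl; rewrite ?sqrrN ?expr1n//; exact: Lv.
    have bv1 := bv _ b1; have bv2 := bv _ b2.
    move: Kq => /= [] /andP[h1 h2] /andP[h3 h4].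
    have Vle : V q <= 2 * A.
      by rewrite /V; move: bv1 bv2; rewrite !ler_norml => /andP[? ?] /andP[? ?]; lra.
    (* A point where [F] is positive has [B] below [r^2], which keeps it off the outer sides; so it
       is interior. *)
    have B1 : B q < r ^+ 2.
      rewrite -(ltr_pM2l k0) r2; move: Fq; rewrite /F mulNr; lra.
    have q1 : P.1 < q.1.
      rewrite lt_neqAle h1 andbT; apply/negP => /eqP e.
      have : 0 < - (2 * A / r ^+ 2) * B q.
        have V0 : V q = 0.
          rewrite /V -e (_ : -1 * P.1 + 2 * P.1 = P.1); last by ring.
          by rewrite mul1r addr0 e; case: (q) => *; rewrite subrr.
        by move: Fq; rewrite /F V0 add0r.
      rewrite mulNr oppr_gt0 pmulr_rlt0//.
      by rewrite /B /sqd -e subrr expr0n/= !mulr0 subr0 add0r addr0 ltNge sqr_ge0.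
    have q2 : q.1 < P.1 + r.
      rewrite lt_neqAle h2 andbT; apply/negP => /eqP e.
      by move: B1; rewrite /B /sqd e ltNge; have := sqr_ge0 (q.2 - P.2); nra.
    have q3 : P.2 - r < q.2.
      rewrite lt_neqAle h3 andbT; apply/negP => /eqP e.
      by move: B1; rewrite /B /sqd -e ltNge; nra.
    have q4 : q.2 < P.2 + r.
      rewrite lt_neqAle h4 andbT; apply/negP => /eqP e.
      by move: B1; rewrite /B /sqd e ltNge; nra.
    have := @near_rect _ q P.1 (P.1 + r) (P.2 - r) (P.2 + r).
    rewrite q1 q2 q3 q4 => /(_ isT isT); apply: filterS => q' [].
    move=> /andP[? ?] /andP[? ?]; exists q' => //.
    by split; apply/andP; split; exact: ltW.
  - by split; apply/andP; split; rewrite /=; lra.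
rewrite /F /V /B /sqd /=.
rewrite (_ : -1 * (P.1 + t) + 2 * P.1 = P.1 - t); last by ring.
rewrite (_ : 1 * P.2 + 0 = P.2); last by ring.
set a := v _; set b := v _.
rewrite (_ : _ + _ + (3 * r * _ - _) = t ^+ 2 + (3 * r * t - 3 * t ^+ 2)); last by ring.
rewrite mulNr => h.
have : 2 * A / r ^+ 2 * (t ^+ 2 + (3 * r * t - 3 * t ^+ 2)) <= 6 * A / r * t.
  have -> : 6 * A / r * t = 2 * A / r ^+ 2 * (3 * r * t) by field; rewrite gt_eqF.
  by rewrite ler_pM2l//; nra.
by lra.
Qed.

(** The upper bound on the reflected difference is applied to [v] and to [- v]; halving its slope
    [6 A / r] gives the constant. *)
Lemma interior_dx_le v P (r A : R) : 0 < r -> 0 < A ->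
  (forall q, box P r q -> has_lap v q 0) ->
  (forall q, box P r q -> {for q, continuous v}) ->
  (forall q, box P r q -> `|v q| <= A) ->
  `|dx v P| <= 3 * A / r.
Proof.
move=> r0 A0 Lv cv bv.
have bP : box P r P by rewrite /box/= !subrr normr0 ltW.
have -> : 3 * A / r = (6 * A / r) / 2 by field; rewrite gt_eqF.
have [a [b [[/nbhs_singleton/derivableP d _] _ _]]] := Lv _ bP.
rewrite -derive1E in d.
apply: (@is_derive_odd_bound _ (fun t => v (t, P.2)) P.1 _ _ r d r0) => t tr.
 rewrite ler_norml; apply/andP; split; last first.
  exact: (reflected_difference_le r0 A0 Lv cv bv tr).
have := @reflected_difference_le (fun q => -1 * v q) P r A r0 A0 _ _ _ t tr.
rewrite !mulN1r => h.
suff : - v (P.1 + t, P.2) - - v (P.1 - t, P.2) <= 6 * A / r * t by lra.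
apply: h => [q bq|q bq|q bq].
- by rewrite -(mulr0 (-1)); apply: has_lapZ; exact: Lv.
- by apply: cvgM; [exact: cvg_cst|exact: cv].
- by rewrite mulN1r normrN; exact: bv.
Qed.

Lemma has_lap_swap v p l : has_lap v (p.2, p.1) l ->
  has_lap (fun q => v (q.2, q.1)) p l.
Proof. by move=> [a [b [ha hb ->]]]; exists b, a; split=> //; rewrite addrC. Qed.

Lemma interior_dy_le v P (r A : R) : 0 < r -> 0 < A ->
  (forall q, box P r q -> has_lap v q 0) ->
  (forall q, box P r q -> {for q, continuous v}) ->
  (forall q, box P r q -> `|v q| <= A) ->
  `|dy v P| <= 3 * A / r.
Proof.
move=> r0 A0 Lv cv bv.
have bs q : box (P.2, P.1) r q -> box P r (q.2, q.1) by case.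
apply: (@interior_dx_le (fun q => v (q.2, q.1)) (P.2, P.1) r A) => //= q /bs bq.
- exact: has_lap_swap (Lv _ bq).
- apply: (@continuous_comp _ _ _ (fun q : R * R => (q.2, q.1)) v); last exact: cv.
  exact: (cvg_pair (@continuous_snd _ q) (@continuous_fst _ q)).
- exact: bv.
Qed.

End InteriorGradient.

(** * Gradient estimate up to the circles *)

Definition nrm {R : realType} (q c : R * R) : R := Num.sqrt (sqd q c).

Definition outside {R : realType} (s : seq (R * R)) : set (R * R) :=
  [set q | forall c, c \in s -> 1 < sqd q c].

Definition outside_cl {R : realType} (s : seq (R * R)) : set (R * R) :=
  [set q | forall c, c \in s -> 1 <= sqd q c].

(** [s] lists the centres of all circles that the box may meet, so a box straddling a gap is handled
    like a box beside a single circle. *)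
Definition local_dirichlet {R : realType} (s : seq (R * R)) (P : R * R) (rho A : R)
    (v : R * R -> R) : Prop :=
  [/\ forall q, box P rho q -> outside s q -> has_lap v q 0,
      {within box P rho `&` outside_cl s, continuous v},
      forall q, box P rho q -> outside_cl s q -> `|v q| <= A &
      forall q c, box P rho q -> outside_cl s q -> c \in s -> sqd q c = 1 -> v q = 0].

Section LocalDirichlet.
Context {R : realType}.
Implicit Types (v : R * R -> R) (p q c P : R * R) (s : seq (R * R)) (A rho d : R).

Lemma sqd_ge0 p q : 0 <= sqd p q.
Proof. by rewrite addr_ge0// sqr_ge0. Qed.

Lemma nrm_ge0 p q : 0 <= nrm p q. Proof. exact: sqrtr_ge0. Qed.

Lemma sqr_nrm p q : nrm p q ^+ 2 = sqd p q.
Proof. by rewrite sqr_sqrtr// sqd_ge0. Qed.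

Lemma nrmC p q : nrm p q = nrm q p.
Proof. by rewrite /nrm /sqd; congr Num.sqrt; ring. Qed.

Lemma nrm_triangle r p q : nrm p q <= nrm p r + nrm r q.
Proof.
rewrite -ler_sqr ?nnegrE ?nrm_ge0 ?addr_ge0 ?nrm_ge0// sqrrD !sqr_nrm.
have : (p.1 - r.1) * (r.1 - q.1) + (p.2 - r.2) * (r.2 - q.2) <= nrm p r * nrm r q.
  apply: le_trans (ler_norm _) _.
  rewrite -ler_sqr ?nnegrE ?mulr_ge0 ?nrm_ge0// exprMn !sqr_nrm real_normK ?num_real//.
  rewrite -subr_ge0 /sqd.
  (* Lagrange's identity: the defect in the Cauchy-Schwarz inequality is this square. *)
  have := sqr_ge0 ((p.1 - r.1) * (r.2 - q.2) - (p.2 - r.2) * (r.1 - q.1)).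
  by apply: le_trans_eq || congr (_ <= _); ring.
by rewrite /sqd mulr2n; lra.
Qed.

Lemma nrm_ge p q d : 0 <= d -> (d <= nrm p q) = (d ^+ 2 <= sqd p q).
Proof. by move=> d0; rewrite -sqr_nrm ler_sqr ?nnegrE ?nrm_ge0. Qed.

Lemma nrm_gt p q d : 0 <= d -> (d < nrm p q) = (d ^+ 2 < sqd p q).
Proof. by move=> d0; rewrite -sqr_nrm ltr_sqr ?nnegrE ?nrm_ge0. Qed.

Lemma nrm_le p q d : 0 <= d -> (nrm p q <= d) = (sqd p q <= d ^+ 2).
Proof. by move=> d0; rewrite -sqr_nrm ler_sqr ?nnegrE ?nrm_ge0. Qed.

(** The factor [3 / 2] is a rational bound for the square root of 2. *)
Lemma nrm_box P q d : box P d q -> nrm q P <= 3 / 2 * d.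
Proof.
move=> [h1 h2]; have d0 : 0 <= d by exact: le_trans h1.
rewrite nrm_le; last by lra.
have : (q.1 - P.1) ^+ 2 <= d ^+ 2 by rewrite -(real_normK (num_real _)) ler_sqr ?nnegrE.
have : (q.2 - P.2) ^+ 2 <= d ^+ 2 by rewrite -(real_normK (num_real _)) ler_sqr ?nnegrE.
by rewrite /sqd; have := sqr_ge0 d; nra.
Qed.

Lemma box_sub P q (r d : R) : box P d q -> box q r `<=` box P (d + r).
Proof.
move=> [h1 h2] z [h3 h4]; split.
  by rewrite -(subrK q.1 z.1) -addrA addrC (le_trans (ler_normD _ _))// lerD.
by rewrite -(subrK q.2 z.2) -addrA addrC (le_trans (ler_normD _ _))// lerD.
Qed.

Lemma box_le P (r d : R) : r <= d -> box P r `<=` box P d.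
Proof. by move=> h q [h1 h2]; split; exact: le_trans h. Qed.

Lemma near_outside s q : outside s q -> \forall q' \near q, outside s q'.
Proof.
elim: s => [_|c s ih h]; first by near=> z; move=> c.
have h1 : \forall q' \near q, 1 < sqd q' c.
  apply: near_lt; [exact: cvg_cst|exact: continuous_sqd|].
  by apply: h; rewrite mem_head.
have h2 : \forall q' \near q, outside s q'.
  by apply: ih => z zs; apply: h; rewrite in_cons zs orbT.
near=> z => c'; rewrite in_cons => /predU1P[->|]; first by near: z.
by move: c'; near: z.
Unshelve. all: by end_near. Qed.

Lemma outside_sub s : outside s `<=` outside_cl s.
Proof. by move=> q h c cs; apply: ltW; exact: h. Qed.

Lemma closed_outside_cl s : closed (outside_cl s).
Proof.
rewrite (_ : outside_cl s = \bigcap_(c in [set` s]) [set q | 1 <= sqd q c]) //.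
apply: closed_bigI => c _; apply: closed_le_fun; first exact: cst_continuous.
exact: continuous_sqd.
Qed.

Lemma boxE P d : box P d = rect (P.1 - d) (P.1 + d) (P.2 - d) (P.2 + d).
Proof.
apply/seteqP; split=> q; rewrite /box /rect/= !ler_norml.
  by move=> [/andP[? ?] /andP[? ?]]; split; apply/andP; split; lra.
by move=> [/andP[? ?] /andP[? ?]]; split; apply/andP; split; lra.
Qed.

Lemma compact_box_outside s P d : compact (box P d `&` outside_cl s).
Proof.
apply: (@subclosed_compact _ _ (box P d)); [|by rewrite boxE; exact: compact_rect|by move=> ? []].
apply: closedI; last exact: closed_outside_cl.
by rewrite boxE; apply: compact_closed; [exact: norm_hausdorff|exact: compact_rect].
Qed.

Lemma near_box P q d : `|q.1 - P.1| < d -> `|q.2 - P.2| < d ->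
  \forall q' \near q, box P d q'.
Proof.
rewrite !ltr_norml boxE => /andP[h1 h2] /andP[h3 h4].
have := @near_rect _ q (P.1 - d) (P.1 + d) (P.2 - d) (P.2 + d).
have -> : P.1 - d < q.1 < P.1 + d by apply/andP; split; lra.
have -> : P.2 - d < q.2 < P.2 + d by apply/andP; split; lra.
move=> /(_ isT isT); apply: filterS => z [/andP[? ?] /andP[? ?]].
by split; apply/andP; split; exact: ltW.
Qed.

Lemma local_dirichlet_sub s P P' rho rho' A v : box P' rho' `<=` box P rho ->
  local_dirichlet s P rho A v -> local_dirichlet s P' rho' A v.
Proof.
move=> sb [h1 h2 h3 h4]; split=> [q /sb|||]; first exact: h1.
- by apply: continuous_subspaceW h2 => q [/sb].
- by move=> q /sb; exact: h3.
- by move=> q c /sb; exact: h4.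
Qed.

Lemma local_dirichletN s P rho A v :
  local_dirichlet s P rho A v -> local_dirichlet s P rho A (fun q => -1 * v q).
Proof.
move=> [h1 h2 h3 h4]; split.
- by move=> q b o; rewrite -(mulr0 (-1)); apply: has_lapZ; exact: h1.
- apply: withinI => q Kq; apply: cvgM; [exact: cvg_cst|exact: (withinP h2)].
- by move=> q b o; rewrite mulN1r normrN; exact: h3.
- by move=> q c b o cs e; rewrite (h4 q c)// mulr0.
Qed.

(* The barrier is [A/rho^2 |q - P|^2 + kappa (1 - |q - c|^-2)]: the first term
   dominates [v] on the sides of the box, and [|q - c|^-2] is strictly subharmonic. *)
Lemma local_dirichlet_le s P rho A v c : local_dirichlet s P rho A v ->
  0 < A -> 0 < rho -> c \in s -> outside s P ->
  (forall q, box P rho q -> sqd q c <= 4) ->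
  v P <= 17 * A / rho ^+ 2 * (sqd P c - 1).
Proof.
move=> [Lv cv bv v0] A0 r0 cs oP dc.
(* Since [|q - c| <= 2], the Laplacian of [|q - c|^-2] is at least [4 / 16], so a coefficient above
   [16 k] outweighs the [- 4 k] of the quadratic term. *)
pose k := A / rho ^+ 2; pose K := 17 * k.
have k0 : 0 < k by rewrite divr_gt0// exprn_gt0.
have kr : k * rho ^+ 2 = A by rewrite divfK// expf_neq0// gt_eqF.
have K0 : 0 < K by rewrite mulr_gt0.
pose F q := v q + (- k * sqd q P + (K * (sqd q c)^-1 - K)).
have cF : {within box P rho `&` outside_cl s, continuous F}.
  apply: withinI => q Kq; apply: cvgD; first exact: (withinP cv).
  have sc0 : sqd q c != 0 by rewrite gt_eqF// (lt_le_trans ltr01)//; apply: Kq.2.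
  apply: cvg_within_filter; apply: cvgD.
    by apply: cvgM; [exact: cvg_cst|exact: continuous_sqd].
  apply: cvgB; last exact: cvg_cst.
  by apply: cvgM; [exact: cvg_cst|apply: cvgV => //; exact: continuous_sqd].
have inv1 q : 1 <= sqd q c -> (sqd q c)^-1 <= 1.
  by move=> h; rewrite invf_le1// (lt_le_trans ltr01).
have bP : box P rho P by rewrite /box/= !subrr normr0 ltW.
have : F P <= 0.
  apply: (max_principle (@compact_box_outside s P rho) cF) => [q [bq oq] Fq|];
    last by split=> //; exact: outside_sub.
  have := bv _ bq oq; rewrite ler_norml => /andP[bv1 bv2].
  have i1 := inv1 _ (oq _ cs).
  have KI : K * (sqd q c)^-1 <= K by rewrite -[leRHS]mulr1 ler_pM2l.
  have kS : k * sqd q P < A by move: Fq; rewrite /F mulNr; lra.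
  have kS2 : sqd q P < rho ^+ 2 by rewrite -(ltr_pM2l k0) kr.
  have h1 : `|q.1 - P.1| < rho.
    rewrite -ltr_sqr ?nnegrE ?normr_ge0 1?ltW// real_normK ?num_real//.
    by move: kS2; rewrite /sqd; have := sqr_ge0 (q.2 - P.2); lra.
  have h2 : `|q.2 - P.2| < rho.
    rewrite -ltr_sqr ?nnegrE ?normr_ge0 1?ltW// real_normK ?num_real//.
    by move: kS2; rewrite /sqd; have := sqr_ge0 (q.1 - P.1); lra.
  have oq' : outside s q.
    move=> c' c's; rewrite lt_neqAle oq// andbT; apply/negP => /eqP e.
    have vq := v0 q c' bq oq c's (esym e).
    have : 0 <= k * sqd q P by rewrite mulr_ge0 ?sqd_ge0// ltW.
    by move: Fq; rewrite /F vq mulNr; lra.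
  split.
    have n1 := near_box h1 h2; have n2 := near_outside oq'.
    near=> z; exists z => //; split; near: z => //.
    by apply: filterS n2 => z; exact: outside_sub.
  have s0 : 0 < sqd q c by rewrite (lt_le_trans ltr01)// oq.
  exists (0 + (- k * 4 + (K * (4 / sqd q c ^+ 2) - 0))).
    have : 4 / 16 <= 4 / sqd q c ^+ 2.
      rewrite ler_pM2l// lef_pV2 ?posrE ?exprn_gt0//.
      have := dc _ bq; nra.
    rewrite add0r subr0 mulNr => h; have := ler_wpM2l (ltW K0) h.
    have KE : K = 17 * k by []; lra.
  apply: has_lapD; first exact: Lv.
  apply: has_lapD; first exact/has_lapZ/has_lap_sqd.
  apply: has_lapB; last exact: has_lap_cst.
  exact/has_lapZ/has_lap_invsqd.
have oc : 1 < sqd P c by exact: oP.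
rewrite /F {1}/sqd !subrr expr0n/= addr0 mulr0 add0r.
(* At [P] the quadratic term vanishes; what is left of the barrier is linear in the distance to the
   circle. *)
have : 1 - (sqd P c)^-1 <= sqd P c - 1.
  have s0 : 0 < sqd P c by rewrite (lt_trans ltr01).
  rewrite -subr_ge0 (_ : _ - _ = (sqd P c - 1) ^+ 2 / sqd P c); last first.
    by field; rewrite gt_eqF.
  by rewrite divr_ge0 ?sqr_ge0// ltW.
move=> /(ler_wpM2l (ltW K0)); rewrite -[17 * A / _]mulrA -/k -/K; lra.
Unshelve. all: by end_near. Qed.

(** [d] is the smaller of [rho] and the distance from [P] to the nearest circle. The final
    alternative decides whether the interior estimate works with the crude bound [A] or needs the
    barrier. *)
Lemma outside_gap s P rho : 0 < rho -> outside s P ->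
  exists d, [/\ 0 < d, d <= rho, forall c, c \in s -> 1 + d <= nrm P c &
     d = rho \/ exists2 c, c \in s & nrm P c = 1 + d].
Proof.
move=> r0; elim: s => [_|c s ih oP]; first by exists rho; split=> //; left.
have [|d [d0 dr ds hd]] := ih.
  by move=> z zs; apply: oP; rewrite in_cons zs orbT.
have c1 : 1 < nrm P c by rewrite nrm_gt// expr1n oP// mem_head.
have [h|h] := leP (1 + d) (nrm P c).
  exists d; split=> //; first by move=> z; rewrite in_cons => /predU1P[->//|]; exact: ds.
  by case: hd => [->|[z zs e]]; [left|right; exists z; rewrite ?in_cons ?zs ?orbT].
exists (nrm P c - 1); split; [lra|lra| |].
- move=> z; rewrite in_cons => /predU1P[->|/ds]; lra.
- by right; exists c; [rewrite mem_head|rewrite addrC subrK].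
Qed.

Lemma local_dirichlet_grad s P rho A v : local_dirichlet s P rho A v ->
  0 < A -> 0 < rho <= 1 / 4 -> outside s P ->
  `|dx v P| <= 2040 * A / rho ^+ 2 /\ `|dy v P| <= 2040 * A / rho ^+ 2.
Proof.
move=> lv A0 /andP[r0 r1] oP.
have [d [d0 dr ds hd]] := @outside_gap s P (rho / 2) ltac:(lra) oP.
have oq q : box P (d / 2) q -> outside s q.
  move=> /nrm_box nq c cs; have := ds _ cs.
  by rewrite -[1](expr1n _ 2) -nrm_gt//; have := nrm_triangle q P c; rewrite (nrmC P q); lra.
have bsub : box P (d / 2) `<=` box P rho by apply: box_le; lra.
have Lv q : box P (d / 2) q -> has_lap v q 0.
  by move=> bq; case: lv => h _ _ _; apply: h; [exact: bsub|exact: oq].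
have cv q : box P (d / 2) q -> {for q, continuous v}.
  move=> bq; case: lv => _ h _ _; apply: (within_near h).
  have n1 : \forall z \near q, box P rho z.
    by case: bq => b1 b2; apply: near_box; [apply: le_lt_trans b1 _|apply: le_lt_trans b2 _]; lra.
  have n2 := near_outside (oq _ bq).
  by near=> z; split; [near: z|apply: outside_sub; near: z].
(* It suffices to bound [v] on the box of half-width [d / 2] by a multiple of [d]: the interior
   estimate gives [3 B / (d / 2)], and [6 * 340 = 2040]. *)
suff : forall B, 0 < B -> (forall q, box P (d / 2) q -> `|v q| <= B) ->
    B <= 340 * A * d / rho ^+ 2 -> `|dx v P| <= 2040 * A / rho ^+ 2 /\ `|dy v P| <= 2040 * A /
      rho ^+ 2.
  have r2 : 0 < rho ^+ 2 by rewrite exprn_gt0.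
  case: hd => [dE|[c cs nc]].
    apply; first exact: A0.
      by move=> q bq; case: lv => _ _ h _; apply: h; [exact: bsub|exact/outside_sub/oq].
    rewrite ler_pdivlMr// dE; have Ar := mulr_gt0 A0 r0.
    have r4 : 0 <= 1 / 4 - rho by lra.
    by have := mulr_ge0 (ltW Ar) r4; rewrite expr2; lra.
  have B0 : 0 < 340 * A * d / rho ^+ 2.
    by apply: divr_gt0 r2; have := mulr_gt0 A0 d0; lra.
  move=> H; apply: (H _ B0); last exact: lexx.
    move=> q bq.
    have lq : local_dirichlet s q (rho / 2) A v.
      apply: local_dirichlet_sub lv; apply: subset_trans (box_sub bq) _.
      by apply: box_le; lra.
    have nq : nrm q c <= 1 + 2 * d.
      by have := nrm_triangle P q c; have := nrm_box bq; rewrite nc; lra.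
    have cl4 z : box q (rho / 2) z -> sqd z c <= 4.
      move=> /nrm_box bz; rewrite -sqr_nrm.
      have nz : nrm z c <= 2 by have := nrm_triangle q z c; lra.
      by have := nrm_ge0 z c; nra.
    (* [(1 + 2 d)^2 - 1 = 4 d + 4 d^2] with [d <= 1 / 8]. Together with the barrier at radius
       [rho / 2] this gives [17 * 4 * 5 = 340]. *)
    have s5 : sqd q c - 1 <= 5 * d.
      by rewrite -sqr_nrm; have := nrm_ge0 q c; nra.
    have k0 : 0 <= 17 * A / (rho / 2) ^+ 2.
      by rewrite divr_ge0 ?sqr_ge0// mulr_ge0// ltW.
    have eqB : 17 * A / (rho / 2) ^+ 2 * (5 * d) = 340 * A * d / rho ^+ 2.
      by field; rewrite gt_eqF.
    have h1 := local_dirichlet_le lq A0 ltac:(lra) cs (oq _ bq) cl4.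
    have h2 := local_dirichlet_le (local_dirichletN lq) A0 ltac:(lra) cs (oq _ bq) cl4.
    rewrite ler_norml -eqB; apply/andP; split.
      rewrite lerNl -mulN1r (le_trans h2)// ler_wpM2l//.
    by rewrite (le_trans h1)// ler_wpM2l.
move=> B B0 hB Ble.
have : 3 * B / (d / 2) <= 2040 * A / rho ^+ 2.
  rewrite ler_pdivrMr ?divr_gt0//.
  by have -> : 2040 * A / rho ^+ 2 * (d / 2) = 3 * (340 * A * d / rho ^+ 2); [field;
    rewrite gt_eqF|lra].
move=> le; have d2 : 0 < d / 2 by lra.
split; apply: le_trans le.
- exact: (interior_dx_le d2 B0 Lv cv hB).
- exact: (interior_dy_le d2 B0 Lv cv hB).
Unshelve. all: by end_near. Qed.

End LocalDirichlet.

(** * The exterior domain *)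

Definition disk_center {R : realType} (eps delta : R) (c : R * R) : Prop :=
  exists n : int, c = cL eps delta n \/ c = cR eps delta n.

Section Exterior.
Context {R : realType}.
Variables (eps delta : R).
Hypotheses (eps0 : 0 < eps) (delta0 : 0 < delta).
Implicit Types (p q c : R * R) (A : set (R * R)).

Lemma sqr_intr_ge1 (n k : int) : n != k -> 1 <= (n%:~R - k%:~R) ^+ 2 :> R.
Proof.
move=> nk; rewrite -intrB -rmorphXn /= ler1z.
have : n - k != 0 by rewrite subr_eq0.
by move=> h; rewrite -gtz0_ge1 lt_neqAle eq_sym sqrf_eq0 h sqr_ge0.
Qed.

Lemma centers_separated c c' : disk_center eps delta c -> disk_center eps delta c' ->
  c <> c' -> 2 + Num.min eps delta <= nrm c c'.
Proof.
set m := Num.min _ _.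
have m0 : 0 < m by rewrite lt_min eps0.
have me : m <= eps by rewrite ge_min lexx.
have md : m <= delta by rewrite ge_min lexx orbT.
move=> [n hc] [k hc'] ne; rewrite nrm_ge; last by lra.
have sq (a b : int) : a != b ->
    (2 + m) ^+ 2 <= (a%:~R * (2 + delta) - b%:~R * (2 + delta)) ^+ 2.
  move=> ab; rewrite -mulrBl exprMn.
  have h1 : (2 + m) ^+ 2 <= (2 + delta) ^+ 2 by rewrite ler_sqr ?nnegrE; lra.
  by apply: (le_trans h1); rewrite ler_peMl ?sqr_ge0 ?sqr_intr_ge1.
have h1 : (2 + m) ^+ 2 <= (2 + eps) ^+ 2 by rewrite ler_sqr ?nnegrE; lra.
case: hc ne => ->; case: hc' => -> ne; rewrite /sqd /=.
- have nk : n != k by apply/eqP => e; apply: ne; rewrite e.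
  by rewrite subrr expr0n/= add0r sq.
- apply: (le_trans h1); rewrite -[leLHS]addr0 lerD ?sqr_ge0//.
  by rewrite (_ : _ - _ = - (2 + eps)) ?sqrrN//; field.
- apply: (le_trans h1); rewrite -[leLHS]addr0 lerD ?sqr_ge0//.
  by rewrite (_ : _ - _ = 2 + eps)//; field.
- have nk : n != k by apply/eqP => e; apply: ne; rewrite e.
  by rewrite subrr expr0n/= add0r sq.
Qed.

(** A point is placed in a closure by approaching it along a segment: radially for the disks and for
    [ext], vertically for strips. *)
Lemma closure_ray A q d (s0 : R) : 0 < s0 ->
  (forall s, 0 < s < s0 -> A (q.1 + s * d.1, q.2 + s * d.2)) -> closure A q.
Proof.
move=> s00 hA B /nbhs_ballP[e /= e0 eB].
pose D : R := 1 + `|d.1| + `|d.2|.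
have D0 : 0 < D by rewrite /D -addrA ltr_wpDr// addr_ge0.
have eD0 : 0 < e / (2 * D) by rewrite divr_gt0// mulr_gt0.
pose s := Num.min (s0 / 2) (e / (2 * D)).
have sp : 0 < s by rewrite lt_min eD0 divr_gt0.
have s1 : s <= s0 / 2 by rewrite ge_min lexx.
have s2 : s * (2 * D) <= e.
  by rewrite -ler_pdivlMr ?mulr_gt0//; rewrite ge_min lexx orbT.
exists (q.1 + s * d.1, q.2 + s * d.2); split.
  by apply: hA; apply/andP; split=> //; lra.
have n1 : 0 <= s * `|d.1| by rewrite mulr_ge0// ltW.
have n2 : 0 <= s * `|d.2| by rewrite mulr_ge0// ltW.
have s3 : s + s * `|d.1| + s * `|d.2| <= e / 2.
  by rewrite (_ : _ + _ = s * (2 * D) / 2); [lra|rewrite /D; field].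
apply: eB; split; rewrite /ball/= opprD addrA subrr sub0r normrN normrM (gtr0_norm sp); lra.
Qed.

(** With infinitely many disks, a positive distance to each one does not by itself give a common
    margin. The separation of the centres leaves at most one of them within [1 + m / 3], and its own
    distance then serves for all. *)
Lemma exterior_margin q : (forall c, disk_center eps delta c -> 1 < sqd q c) ->
  exists2 e, 0 < e & forall c, disk_center eps delta c -> 1 + e <= nrm q c.
Proof.
move=> hq; pose m := Num.min eps delta; have m0 : 0 < m by rewrite lt_min eps0.
have [[c0 [cc0 h0]]|h] :=
  pselect (exists c0, disk_center eps delta c0 /\ nrm q c0 < 1 + m / 3).
  have n0 : 1 < nrm q c0 by rewrite nrm_gt// expr1n hq.
  exists (nrm q c0 - 1); first by lra.
  move=> c cc; have [->|ne] := pselect (c = c0); first by lra.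
  have := centers_separated cc0 cc (nesym ne); rewrite -/m.
  by have := nrm_triangle q c0 c; rewrite (nrmC c0 q); lra.
exists (m / 3); first by lra.
move=> c cc; rewrite leNgt; apply/negP => lt.
by apply: h; exists c.
Qed.

Lemma disk_sub_calD c q : disk_center eps delta c -> sqd q c < 1 -> calD eps delta q.
Proof. by move=> [n [->|->]] h; exists n; [left|right]. Qed.

(** The closure of an infinite union can exceed the union of the closures; the common margin
    excludes this here. *)
Lemma extP q : ext eps delta q <-> forall c, disk_center eps delta c -> 1 < sqd q c.
Proof.
split=> [eq c cc|hq].
  rewrite ltNge; apply/negP => le1; apply: eq.
  have [e|lt1] := eqVneq (sqd q c) 1; last first.
    by apply: subset_closure; apply: (disk_sub_calD cc); rewrite lt_neqAle lt1.
  apply: (@closure_ray _ _ (c.1 - q.1, c.2 - q.2) 1) => // s /andP[s0 s1].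
  apply: (disk_sub_calD cc) => /=.
  rewrite (_ : sqd _ _ = (1 - s) ^+ 2 * sqd q c); last by rewrite /sqd /=; ring.
  by rewrite e; nra.
have [e e0 he] := exterior_margin hq.
move=> cl; have [|z [zD zb]] := cl (box q (e / 2)).
  by apply: near_box; rewrite subrr normr0; lra.
have [n hz] := zD.
have [c cc dz] : exists2 c, disk_center eps delta c & sqd z c < 1.
  by case: hz => hz; [exists (cL eps delta n)|exists (cR eps delta n)] => //; exists n;
    [left|right].
have : nrm z c < 1.
  by rewrite ltNge nrm_ge// expr1n -ltNge.
have := he _ cc; have := nrm_box zb; have := nrm_triangle z q c.
by rewrite (nrmC q z); lra.
Qed.

Lemma open_ext : open (ext eps delta).
Proof. by apply: closed_openC; exact: closed_closure. Qed.

Lemma near_ext q : ext eps delta q -> \forall z \near q, ext eps delta z.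
Proof. by move=> eq; exact: open_nbhs_nbhs (conj open_ext eq). Qed.

(** A point on a circle moved outward along its radius by less than [m] stays outside all other
    disks, since the centres are at least [2 + m] apart. *)
Lemma closure_extP q :
  closure (ext eps delta) q <-> forall c, disk_center eps delta c -> 1 <= sqd q c.
Proof.
split=> [cl c cc|hq].
  have h : closed [set z | 1 <= sqd z c].
    by apply: closed_le_fun; [exact: cst_continuous|exact: continuous_sqd].
  apply: h; move: q cl; apply: closure_subset => z /extP hz.
  by apply: ltW; exact: hz.
have [h|/existsNP[c0 /not_implyP[cc0 /negP]]] :=
    pselect (forall c, disk_center eps delta c -> 1 < sqd q c).
  by apply: subset_closure; exact/extP.
rewrite -leNgt => le1.
have e : sqd q c0 = 1 by apply/eqP; rewrite eq_le le1 hq.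
pose m := Num.min eps delta; have m0 : 0 < m by rewrite lt_min eps0.
apply: (@closure_ray _ _ (q.1 - c0.1, q.2 - c0.2) m) => // s /andP[s0 s1].
apply/extP => c cc.
have sz : sqd (q.1 + s * (q.1 - c0.1, q.2 - c0.2).1, q.2 + s * (q.1 - c0.1, q.2 - c0.2).2) c0
    = (1 + s) ^+ 2.
  rewrite (_ : sqd _ _ = (1 + s) ^+ 2 * sqd q c0); last by rewrite /sqd /=; ring.
  by rewrite e mulr1.
set z := (_ + _, _ + _) in sz *.
have [->|ne] := pselect (c = c0); first by rewrite sz; nra.
have := centers_separated cc0 cc (nesym ne); rewrite -/m.
have nz : nrm z c0 = 1 + s by rewrite /nrm sz sqrtr_sqr ger0_norm//; lra.
have := nrm_triangle z c0 c; rewrite (nrmC c0 z) nz => t1 t2.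
by rewrite -[1](expr1n _ 2) -nrm_gt//; lra.
Qed.

End Exterior.

(** * Partial derivatives with named values *)

Definition has_grad {R : realType} (f : R * R -> R) (p : R * R) (a b : R) : Prop :=
  is_derive p.1 1 (fun t => f (t, p.2)) a /\ is_derive p.2 1 (fun t => f (p.1, t)) b.

Section Gradient.
Context {R : realType}.
Implicit Types (f g : R * R -> R) (p q : R * R) (a b : R).

Lemma has_grad_dx f p a b : has_grad f p a b -> dx f p = a.
Proof. by move=> [h _]; exact: derive1_is_derive. Qed.

Lemma has_grad_dy f p a b : has_grad f p a b -> dy f p = b.
Proof. by move=> [_ h]; exact: derive1_is_derive. Qed.

Lemma has_grad_partials f p : partials_exist f p -> has_grad f p (dx f p) (dy f p).
Proof.
move=> [h1 h2]; split; [have h := derivableP h1|have h := derivableP h2];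
  by rewrite -derive1E in h; exact: h.
Qed.

Lemma has_gradD f g p a b a' b' : has_grad f p a b -> has_grad g p a' b' ->
  has_grad (fun q => f q + g q) p (a + a') (b + b').
Proof. by move=> [h1 h2] [h3 h4]; split; exact: is_deriveD. Qed.

Lemma has_gradZ f p (k : R) a b : has_grad f p a b ->
  has_grad (fun q => k * f q) p (k * a) (k * b).
Proof. by move=> [h1 h2]; split; exact: is_deriveZ. Qed.

Lemma has_grad_cst p (k : R) : has_grad (fun=> k) p 0 0.
Proof. by split; exact: is_derive_cst. Qed.

Lemma has_gradB f g p a b a' b' : has_grad f p a b -> has_grad g p a' b' ->
  has_grad (fun q => f q - g q) p (a - a') (b - b').
Proof. by move=> [h1 h2] [h3 h4]; split; exact: is_deriveB. Qed.

Lemma has_grad_refl f p (s c t d : R) a b :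
  has_grad f (s * p.1 + c, t * p.2 + d) a b ->
  has_grad (fun q => f (s * q.1 + c, t * q.2 + d)) p (s * a) (t * b).
Proof. by move=> [h1 h2]; split; exact: is_derive_comp_affine. Qed.

Lemma is_derive0_eq (g : R -> R) (a b : R) : a <= b ->
  (forall t, a <= t <= b -> is_derive t 1 g 0) -> g a = g b.
Proof.
rewrite le_eqVlt => /predU1P[->//|ab] dg.
have [|||c _] := @MVT _ g (fun=> 0) a b => //.
- by move=> x; rewrite in_itv/= => /andP[? ?]; apply: dg; rewrite !ltW.
- by apply: derivable_within_continuous => x; rewrite in_itv/= => /dg[].
by rewrite mul0r => /eqP; rewrite subr_eq0 eq_sym => /eqP.
Qed.

End Gradient.

(** * Periodicity and connectedness of the exterior domain *)

Section Shift.
Context {R : realType}.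
Variables (eps delta : R).
Hypotheses (eps0 : 0 < eps) (eps1 : eps < 1) (delta0 : 0 < delta).
Implicit Types (p q c : R * R) (f : R * R -> R).
Local Notation L := (2 + delta).

Lemma ext_shift_int p (k : int) : ext eps delta p ->
  ext eps delta (p.1, p.2 + k%:~R * L).
Proof.
move=> /(extP eps0 delta0) h; apply/(extP eps0 delta0) => c [n hc].
have e : c = (c.1, (c.2 - k%:~R * L) + k%:~R * L) by rewrite subrK; case: (c).
have -> : sqd (p.1, p.2 + k%:~R * L) c = sqd p (c.1, c.2 - k%:~R * L).
  by rewrite /sqd /=; ring.
by apply: h; exists (n - k); case: hc => ->; [left|right];
  rewrite /cL /cR /= rmorphB /= mulrBl.
Qed.

Lemma ext_shift p : ext eps delta p -> ext eps delta (p.1, p.2 + L).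
Proof. by move=> /ext_shift_int => /(_ 1); rewrite mul1r. Qed.

Lemma ext_far p : 3 <= `|p.1| :> R -> ext eps delta p.
Proof.
have e0 := eps0; have e1 := eps1.
move=> h; apply/(extP eps0 delta0) => c [n hc].
have : 1 < (p.1 - c.1) ^+ 2.
  have [h1|h1] := leP 0 p.1.
    have {h1}h : 3 <= p.1 by rewrite ger0_norm in h.
    have : 1 < p.1 - c.1 by case: hc => -> /=; lra.
    by nra.
  have {h1}h : 3 <= - p.1 by rewrite ltr0_norm in h.
  have : 1 < - (p.1 - c.1) by case: hc => -> /=; lra.
  by nra.
by rewrite /sqd; have := sqr_ge0 (p.2 - c.2); lra.
Qed.

Lemma half_int_dist (n k : int) : 1 / 2 <= `|n%:~R + 1 / 2 - k%:~R| :> R.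
Proof.
have [h|h] := lerP k n.
  have : (k%:~R : R) <= n%:~R by rewrite ler_int.
  by move=> ?; rewrite ger0_norm; lra.
have : (n%:~R : R) + 1 <= k%:~R by rewrite -[1]/(1%:~R) -intrD ler_int lezD1.
by move=> ?; rewrite ler0_norm; lra.
Qed.

Lemma ext_half (x : R) (n : int) : ext eps delta (x, (n%:~R + 1 / 2) * L).
Proof.
have d0 := delta0.
apply/(extP eps0 delta0) => c [k hc].
have := half_int_dist n k; set z := _ - _ => hz.
have e : (n%:~R + 1 / 2) * L - c.2 = z * L by case: hc => -> /=; rewrite /z; ring.
rewrite /sqd /= e exprMn.
have : 1 / 4 <= z ^+ 2.
  by rewrite -(real_normK (num_real _)); nra.
have := sqr_ge0 (x - c.1).
by nra.
Qed.

Lemma nearest_int (y : R) : exists n : int, `|y - n%:~R * L| <= L / 2.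
Proof.
have d0 := delta0.
have L0 : 0 < L by rewrite addr_gt0.
exists (Num.floor (y / L + 1 / 2)).
set n := Num.floor _.
have /andP[h1 h2] : n%:~R <= y / L + 1 / 2 < (n + 1)%:~R by exact: floor_itv.
rewrite intrD in h2.
have yE : y = y / L * L by rewrite divfK// gt_eqF.
rewrite {1}yE -mulrBl normrM (gtr0_norm L0) mulrC ler_pM2l// ler_norml.
by apply/andP; split; lra.
Qed.

Lemma other_row (y : R) (n k : int) : n != k -> `|y - n%:~R * L| <= L / 2 ->
  1 < (y - k%:~R * L) ^+ 2.
Proof.
have d0 := delta0.
move=> nk; rewrite ler_norml => /andP[h1 h2].
have [h|h] := ltrP n k.
  have : (n%:~R : R) + 1 <= k%:~R by rewrite -[1]/(1%:~R) -intrD ler_int lezD1.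
  rewrite -subr_ge0 => h3; have := mulr_ge0 h3 (_ : 0 <= L); move: h1 h2.
  set a := n%:~R; set b := k%:~R => h1 h2 /(_ ltac:(lra)) h4.
  have h5 : 1 < b * L - y by lra.
  by nra.
have : (k%:~R : R) + 1 <= n%:~R.
  by rewrite -[1]/(1%:~R) -intrD ler_int lezD1 lt_neqAle eq_sym nk.
rewrite -subr_ge0 => h3; have := mulr_ge0 h3 (_ : 0 <= L); move: h1 h2.
set a := n%:~R; set b := k%:~R => h1 h2 /(_ ltac:(lra)) h4.
have h5 : 1 < y - b * L by lra.
by nra.
Qed.

(** Within its cell, moving vertically away from the row of centres increases the distance to the
    disks of that row, and the other rows are more than 1 away. *)
Lemma ext_vertical p (n : int) (t : R) : ext eps delta p ->
  `|t - n%:~R * L| <= L / 2 -> `|p.2 - n%:~R * L| <= `|t - n%:~R * L| ->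
  ext eps delta (p.1, t).
Proof.
have d0 := delta0.
move=> /(extP eps0 delta0) hp h1 h2; apply/(extP eps0 delta0) => c cc.
have [k hc] := cc; have c2 : c.2 = k%:~R * L by case: hc => ->.
have [nk|nk] := eqVneq n k.
  have := hp _ cc; rewrite /sqd /= c2 -nk => h.
  have : (p.2 - n%:~R * L) ^+ 2 <= (t - n%:~R * L) ^+ 2.
    by rewrite -(real_normK (num_real _)) -[leRHS](real_normK (num_real _)) ler_sqr ?nnegrE.
  by lra.
have := other_row nk h1; rewrite /sqd /= c2.
by have := sqr_ge0 (p.1 - c.1); lra.
Qed.

(* Every point of [ext] is joined to the line [x = 4] inside [ext]: vertically to a
   line halfway between two rows of disks, then horizontally. *)
Lemma ext_const f : (forall p, ext eps delta p -> has_grad f p 0 0) ->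
  forall p, ext eps delta p -> f p = f (4, 0).
Proof.
have d0 := delta0.
move=> df p ep.
have hor (x y z : R) : x <= y -> (forall t, x <= t <= y -> ext eps delta (t, z)) ->
    f (x, z) = f (y, z).
  move=> xy h; apply: (@is_derive0_eq _ (fun t => f (t, z))) => // t /h.
  by move=> /df[].
have ver (x y z : R) : x <= y -> (forall t, x <= t <= y -> ext eps delta (z, t)) ->
    f (z, x) = f (z, y).
  move=> xy h; apply: (@is_derive0_eq _ (fun t => f (z, t))) => // t /h.
  by move=> /df[].
have line4 y : f (4, y) = f (4, 0).
  have e4 t : ext eps delta (4, t) by apply: ext_far; rewrite /= ger0_norm; lra.
  by have [h|h] := leP y 0; [|symmetry]; apply: ver => //; exact: ltW.
have half n : f (p.1, (n%:~R + 1 / 2) * L) = f (4, 0).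
  rewrite -(line4 ((n%:~R + 1 / 2) * L)).
  by have [h|h] := leP p.1 4; [|symmetry]; apply: hor => //;
    [move=> t _; exact: ext_half|exact: ltW|move=> t _; exact: ext_half].
have [n hn] := nearest_int p.2.
have h0 : p = (p.1, p.2) by case: (p).
have hL : 0 < L by rewrite addr_gt0.
have [h|h] := leP (n%:~R * L) p.2.
  rewrite -(half n) {1}h0; apply: ver.
    by move: hn; rewrite ler_norml => /andP[? ?]; lra.
  move=> t /andP[t1 t2]; apply: (@ext_vertical _ n) => //.
    by rewrite ger0_norm; lra.
  by rewrite !ger0_norm; lra.
rewrite -(half (n - 1)) {1}h0; symmetry; rewrite rmorphB /=; apply: ver.
  by move: hn; rewrite ler_norml => /andP[? ?]; lra.
move=> t /andP[t1 t2]; apply: (@ext_vertical _ n) => //.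
  by rewrite ler0_norm; lra.
by rewrite !ler0_norm; lra.
Qed.

End Shift.

(** * Finite energy on half-cylinders *)

Section PlaneMeasure.
Context {R : realType}.
Local Notation mu := (@lebesgue_measure R).

(** The product sigma-algebra is generated by rectangles, so an open set is written as a countable
    union of boxes with rational corners. *)
Lemma open_measurable_plane (U : set (measurableTypeR R * measurableTypeR R)) :
  open (U : set (R * R)) -> measurable U.
Proof.
move=> oU.
pose Q := (rat * rat * rat * rat)%type.
pose bx (q : Q) : set (R * R) :=
  `]ratr q.1.1.1, ratr q.1.1.2[ `*` `]ratr q.1.2, ratr q.2[.
have -> : U = \bigcup_(q in [set q : Q | bx q `<=` U]) bx q.
  apply/seteqP; split=> [[x y] Uz|z [q qU /qU]//].
  have /nbhs_ballP[e /= e0 he] := open_nbhs_nbhs (conj oU Uz).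
  have [a] := @rat_in_itvoo _ (x - e) x ltac:(by rewrite ltrBlDr ltrDl).
  have [b] := @rat_in_itvoo _ x (x + e) ltac:(by rewrite ltrDl).
  have [c] := @rat_in_itvoo _ (y - e) y ltac:(by rewrite ltrBlDr ltrDl).
  have [d] := @rat_in_itvoo _ y (y + e) ltac:(by rewrite ltrDl).
  rewrite !in_itv/= => /andP[d1 d2] /andP[c1 c2] /andP[b1 b2] /andP[a1 a2].
  exists (a, b, c, d); last by split; rewrite /= in_itv/= ?a2 ?b1 ?c2 ?d1.
  move=> [x' y'] [] /=; rewrite !in_itv/= => /andP[h1 h2] /andP[h3 h4].
  by apply: he; split; rewrite /ball/= ltr_norml; apply/andP; split; lra.
have -> : \bigcup_(q in [set q : Q | bx q `<=` U]) bx q =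
    \bigcup_q (if `[< bx q `<=` U >] then bx q else set0).
  apply/seteqP; split=> z [q].
    by move=> /= qU qz; exists q => //; rewrite (introT (asboolP _) qU).
  by case: asboolP => //= qU _ qz; exists q.
apply: countable_bigcupT_measurable => [|q]; first exact: countableP.
case: ifP => _; last exact: measurable0.
exact: (measurableX (measurable_itv _) (measurable_itv _)).
Qed.

Lemma continuous_measurable_plane (U : set (measurableTypeR R * measurableTypeR R))
    (f : R * R -> R) :
  open (U : set (R * R)) -> (forall p, U p -> {for p, continuous f}) ->
  measurable_fun U (f : _ -> measurableTypeR R).
Proof.
move=> oU cf; apply: (measurability _ (measurable_realfun.RGenOpens.measurableE R)).
move=> _ [_ [a [b ->] <-]]; apply: open_measurable_plane.
rewrite openE => p [Up fp]; rewrite /interior.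
have n1 : \forall q \near p, U q by exact: (open_nbhs_nbhs (conj oU Up)).
have n2 : \forall q \near p, `]a, b[%classic (f q).
  by apply: (cf _ Up); apply: open_nbhs_nbhs; split=> //; exact: interval_open.
by apply: filterS2 n1 n2 => q.
Qed.

Section Lines.
Variables (f : R * R -> R) (D I : set R).
Hypotheses (oD : open D) (oI : open I) (f0 : forall p, 0 <= f p).
Hypothesis cf : forall p, D p.1 -> I p.2 -> {for p, continuous f}.
Hypothesis ff : (\int[(mu \x mu)%E]_(p in D `*` I) (f p)%:E < +oo)%E.

Let h : R * R -> \bar R := ((fun p => (f p)%:E) \_ (D `*` I)).

Let oDI : open (D `*` I).
Proof.
rewrite openE => -[x y] [/= Dx Iy]; exists (D, I) => //=.
by split; apply: open_nbhs_nbhs.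
Qed.

Let mh : measurable_fun (setT : set (measurableTypeR R * measurableTypeR R)) h.
Proof.
apply/(measurable_restrictT _ _).1.
  exact: open_measurable_plane.
apply/measurable_EFinP; apply: continuous_measurable_plane => //.
by move=> p [] /cf.
Qed.

Let h0 p : (0 <= h p)%E.
Proof. by rewrite /h /patch; case: ifP => // _; rewrite lee_fin. Qed.

Let hx x : D x -> (\int[mu]_y h (x, y) = \int[mu]_(y in I) (f (x, y))%:E)%E.
Proof.
move=> Dx; rewrite [RHS]integral_mkcond; apply: eq_integral => y _.
rewrite /h /patch; congr (if _ then _ else _).
by apply/idP/idP => /set_mem H; apply/mem_set; [case: H|split].
Qed.

Let hy y : I y -> (\int[mu]_x h (x, y) = \int[mu]_(x in D) (f (x, y))%:E)%E.
Proof.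
move=> Dx; rewrite [RHS]integral_mkcond; apply: eq_integral => x _.
rewrite /h /patch; congr (if _ then _ else _).
by apply/idP/idP => /set_mem H; apply/mem_set; [case: H|split].
Qed.

(** By Fubini: if every line over [D'] carried at least [e], the total energy would be at least [e]
    times the infinite measure of [D']. *)
Lemma exists_vertical_line (D' : set R) (e : R) : measurable D' -> D' `<=` D ->
  mu D' = +oo%E -> 0 < e ->
  exists2 x, D' x & (\int[mu]_(y in I) (f (x, y))%:E < e%:E)%E.
Proof.
move=> mD' D'D muD' e0; apply: contrapT => /forall2NP hn.
have : (\int[mu]_(x in D') (cst e%:E) x <= \int[(mu \x mu)%E]_p h p)%E.
  rewrite (@fubini_tonelli1 _ _ _ _ _ mu mu h mh h0).
  have mF := @measurable_fun_fubini_tonelli_F _ _ _ _ _ mu h mh h0.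
  apply: (@le_trans _ _ (\int[mu]_(x in D') fubini_F mu h x)%E).
    apply: ge0_le_integral => //.
    - by move=> x _; rewrite lee_fin ltW.
    - exact: measurable_funTS.
    - move=> x D'x; rewrite /fubini_F hx; last exact: D'D.
      by have [//|/negP] := hn x; rewrite -leNgt.
  apply: ge0_subset_integral => //.
  by move=> x _; apply: integral_ge0.
rewrite integral_cst// [X in (_ * X)%E](_ : _ = +oo%E); last exact: muD'.
rewrite gt0_muley ?lte_fin// leye_eq => /eqP e1.
by move: ff; rewrite integral_mkcond -/h e1 ltxx.
Qed.

Lemma exists_horizontal_line : (0 < mu I)%E ->
  exists2 y, I y & (\int[mu]_(x in D) (f (x, y))%:E < +oo)%E.
Proof.
move=> muI; apply: contrapT => /forall2NP hn.
have mI : measurable I by exact: open_measurable.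
have : (\int[mu]_(y in I) (cst +oo%E) y <= \int[(mu \x mu)%E]_p h p)%E.
  rewrite (@fubini_tonelli1 _ _ _ _ _ mu mu h mh h0).
  rewrite (@fubini_tonelli _ _ _ _ _ mu mu h mh h0).
  have mG := @measurable_fun_fubini_tonelli_G _ _ _ _ _ mu h mh h0.
  apply: (@le_trans _ _ (\int[mu]_(y in I) fubini_G mu h y)%E).
    apply: ge0_le_integral => //.
    - by move=> x _; exact: leey.
    - exact: measurable_funTS.
    - move=> y Iy; rewrite /fubini_G hy//.
      by have [//|/negP] := hn y; rewrite -leNgt.
  apply: ge0_subset_integral => //.
  by move=> x _; apply: integral_ge0.
rewrite integral_cst// gt0_mulye// leye_eq => /eqP e1.
by move: ff; rewrite integral_mkcond -/h e1 ltxx.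
Qed.

End Lines.

(* [g' <= eta + g'^2 / eta] pointwise. *)
Lemma increment_le_energy (g g' : R -> R) (a b K eta : R) : a < b -> 0 < eta ->
  (forall t, a <= t <= b -> is_derive t 1 g (g' t)) ->
  (forall t, a <= t <= b -> {for t, continuous g'}) ->
  (\int[mu]_(t in `[a, b]) (g' t ^+ 2)%:E <= K%:E)%E ->
  g b - g a <= eta * (b - a) + K / eta.
Proof.
move=> ab eta0 dg cg' hK.
have wcg' : {within `[a, b], continuous g'}.
  apply/subspace_continuousP => t; rewrite /= in_itv/= => tab.
  by apply: cvg_within_filter; exact: cg'.
have wc2 : {within `[a, b], continuous (fun t => g' t ^+ 2)}.
  rewrite (_ : (fun t => g' t ^+ 2) = (fun t => g' t * g' t)); last by apply/funext => t;
    rewrite expr2.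
  by move=> t; apply: cvgM; exact: wcg'.
have cg t : a <= t <= b -> {for t, continuous g}.
  move=> /dg [/derivable1_diffP d _]; exact: differentiable_continuous.
have ftc : (\int[mu]_(t in `[a, b]) (g' t)%:E = (g b)%:E - (g a)%:E)%E.
  apply: continuous_FTC2 => //.
    split.
    - by move=> t; rewrite in_itv/= => /andP[h1 h2]; case: (dg t); rewrite ?ltW.
    - by apply: cvg_at_right_filter; apply: cg; rewrite lexx ltW.
    - by apply: cvg_at_left_filter; apply: cg; rewrite lexx ltW.
  move=> t; rewrite in_itv/= => /andP[h1 h2].
  by apply: derive1_is_derive; apply: dg; rewrite !ltW.
have cpt : compact (`[a, b] : set R) by exact: segment_compact.
have i1 := continuous_compact_integrable cpt wcg'.
have i2 := continuous_compact_integrable cpt wc2.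
have wc3 : {within `[a, b], continuous (fun t : R => eta + eta^-1 * g' t ^+ 2)}.
  by move=> t; apply: cvgD; [exact: cvg_cst|apply: cvgM; [exact: cvg_cst|exact: wc2]].
have i3 := continuous_compact_integrable cpt wc3.
have mab : measurable (`[a, b]%classic : set (measurableTypeR R)).
  exact: measurable_itv.
have := le_integral mab i1 i3.
have -> : (\int[mu]_(x in `[a, b]) (EFin \o g') x = (g b)%:E - (g a)%:E)%E by exact: ftc.
have -> : (\int[mu]_(x in `[a, b]) (EFin \o (fun t : R => (eta + eta^-1 * g' t ^+ 2)%R)) x =
    (eta * (b - a))%:E + eta^-1%:E * \int[mu]_(t in `[a, b]) (g' t ^+ 2)%:E)%E.
  have -> : EFin \o (fun t : R => eta + eta^-1 * g' t ^+ 2) =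
     (fun t => (cst eta%:E t + eta^-1%:E * (g' t ^+ 2)%:E)%E) by [].
  rewrite integralD//=.
  - rewrite integral_cst//; congr (_ + _)%E; last by rewrite integralZl.
    rewrite [X in (_ * X)%E](_ : _ = (b - a)%:E)//.
    by have := lebesgue_measure_itv `[a, b]; rewrite /= lte_fin ab.
  - apply: continuous_compact_integrable => //.
    by move=> t; exact: cvg_cst.
  - exact: integrableZl.
move=> H; have {}H : ((g b - g a)%:E <= (eta * (b - a) + K / eta)%:E)%E.
  apply: (le_trans (H _)) => [t _|].
    rewrite lee_fin; set z : R := g' t.
    have ei : eta * eta^-1 = 1 by rewrite divff// gt_eqF.
    by rewrite -(ler_pM2l eta0) mulrDr mulrA ei mul1r; nra.
  rewrite EFinD leeD2l// mulrC EFinM lee_wpmul2l// lee_fin invr_ge0 ltW//.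
by rewrite lee_fin in H.
Qed.

End PlaneMeasure.

(** * Oscillation and growth along lines of small or finite energy *)

Section HalfCylinder.
Context {R : realType}.
Local Notation mu := (@lebesgue_measure R).

Lemma line_increment_le (J : set R) (phi g g' : R -> R) (K eta : R) :
  open J -> 0 < eta ->
  (forall t, J t -> is_derive t 1 g (g' t)) ->
  (forall t, J t -> {for t, continuous g'}) ->
  (forall t, J t -> {for t, continuous phi}) ->
  (forall t, g' t ^+ 2 <= phi t) ->
  (\int[mu]_(t in J) (phi t)%:E <= K%:E)%E ->
  forall a b, a <= b -> (forall t, a <= t <= b -> J t) ->
  `|g b - g a| <= eta * (b - a) + K / eta.
Proof.
move=> oJ eta0 dg cg' cphi gphi hK a b ab abJ.
have K0 : 0 <= K.
  rewrite -lee_fin; apply: le_trans hK; apply: integral_ge0 => t _.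
  by rewrite lee_fin; apply: le_trans (gphi t); exact: sqr_ge0.
move: ab; rewrite le_eqVlt => /predU1P[<-|ab].
  by rewrite !subrr normr0 mulr0 add0r divr_ge0// ltW.
have mJ : measurable (J : set (measurableTypeR R)) by exact: open_measurable.
have mab : measurable (`[a, b]%classic : set (measurableTypeR R)).
  exact: measurable_itv.
have sJ : `[a, b] `<=` J by move=> t /=; rewrite in_itv/=; exact: abJ.
have mphi : measurable_fun (J : set (measurableTypeR R)) phi.
  by apply: open_continuous_measurable_fun => // t /[!inE]; exact: cphi.
have sq (h : R -> R) : (fun t => h t ^+ 2) = (fun t => h t * h t).
  by apply/funext => t; rewrite expr2.
have mg : measurable_fun (J : set (measurableTypeR R)) (fun t => g' t ^+ 2).
  apply: open_continuous_measurable_fun => // t /[!inE] Jt; rewrite sq.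
  by apply: cvgM; exact: cg'.
have {}hK : (\int[mu]_(t in `[a, b]) (g' t ^+ 2)%:E <= K%:E)%E.
  apply: le_trans hK; apply: (@le_trans _ _ (\int[mu]_(t in `[a, b]) (phi t)%:E)%E).
    apply: ge0_le_integral => //.
    - by move=> t _; rewrite lee_fin sqr_ge0.
    - by apply/measurable_EFinP; apply: measurable_funS mg.
    - by apply/measurable_EFinP; apply: measurable_funS mphi.
    - by move=> t _; rewrite lee_fin.
  apply: ge0_subset_integral => //; first exact/measurable_EFinP.
  by move=> t _; rewrite lee_fin; apply: le_trans (gphi t); exact: sqr_ge0.
have h1 := increment_le_energy ab eta0 (fun t tab => dg t (abJ t tab))
  (fun t tab => cg' t (abJ t tab)) hK.
have hK' : (\int[mu]_(t in `[a, b]) ((- g' t) ^+ 2)%:E <= K%:E)%E.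
  by under eq_integral do rewrite sqrrN.
have h2 := @increment_le_energy _ (fun t => - g t) (fun t => - g' t) _ _ _ _ ab eta0
  (fun t tab => is_deriveN (dg t (abJ t tab)))
  (fun t tab => cvgN (cg' t (abJ t tab))) hK'.
have {}h2 : - g b - - g a <= eta * (b - a) + K / eta by apply: h2.
by rewrite ler_norml; apply/andP; split; lra.
Qed.

Variables (w wx wy : R * R -> R) (D : set R) (l : R).
Hypotheses (oD : open D) (l0 : 0 < l).
Local Notation I := (`]- l, l[%classic : set R).
Hypothesis dw : forall p, D p.1 -> I p.2 -> has_grad w p (wx p) (wy p).
Hypothesis cx : forall p, D p.1 -> I p.2 -> {for p, continuous wx}.
Hypothesis cy : forall p, D p.1 -> I p.2 -> {for p, continuous wy}.
Hypothesis fin :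
  (\int[(mu \x mu)%E]_(p in D `*` I) (wx p ^+ 2 + wy p ^+ 2)%:E < +oo)%E.

Let f p := wx p ^+ 2 + wy p ^+ 2.
Let f0 p : 0 <= f p. Proof. by rewrite addr_ge0// sqr_ge0. Qed.

Let cf p : D p.1 -> I p.2 -> {for p, continuous f}.
Proof.
move=> Dp Ip; have -> : f = fun p => wx p * wx p + wy p * wy p.
  by apply/funext => q; rewrite /f !expr2.
by apply: cvgD; apply: cvgM; [exact: cx|exact: cx|exact: cy|exact: cy].
Qed.

Let oI : open I. Proof. exact: interval_open. Qed.

Lemma continuous_slice1 (h : R * R -> R) x y : {for (x, y), continuous h} ->
  {for x, continuous (fun t => h (t, y))}.
Proof.
move=> ch; apply: (@continuous_comp _ _ _ (fun t => (t, y)) h) => //.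
have h1 : t @[t --> x] --> x by exact: cvg_id.
have h2 : y @[t --> x] --> y by exact: cvg_cst.
exact: (cvg_pair h1 h2).
Qed.

Lemma continuous_slice2 (h : R * R -> R) x y : {for (x, y), continuous h} ->
  {for y, continuous (fun t => h (x, t))}.
Proof.
move=> ch; apply: (@continuous_comp _ _ _ (fun t => (x, t)) h) => //.
have h1 : t @[t --> y] --> y by exact: cvg_id.
have h2 : x @[t --> y] --> x by exact: cvg_cst.
exact: (cvg_pair h2 h1).
Qed.

Lemma vertical_oscillation (D' : set R) (e : R) :
  measurable (D' : set (measurableTypeR R)) -> D' `<=` D ->
  mu D' = +oo%E -> 0 < e ->
  exists2 x, D' x & forall y y', I y -> I y' -> `|w (x, y) - w (x, y')| <= e.
Proof.
move=> mD' sD muD' e0; have l00 := l0.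
(* An increment over a length of at most [2 l] costs [eta * 2 l = e / 2] for the length and
   [(eta * e / 2) / eta = e / 2] for the energy of the chosen line. *)
pose eta := e / (4 * l).
have eta0 : 0 < eta by rewrite divr_gt0// mulr_gt0.
have [x D'x hx] := @exists_vertical_line _ f D I oD oI f0 cf fin D' (eta * (e / 2))
  mD' sD muD' ltac:(by rewrite mulr_gt0// divr_gt0).
exists x => //; have Dx := sD _ D'x.
have H a b : a <= b -> I a -> I b -> `|w (x, b) - w (x, a)| <= e.
  rewrite /= !in_itv/= => ab /andP[a1 a2] /andP[b1 b2].
  have := @line_increment_le I (fun y => f (x, y)) (fun y => w (x, y))
    (fun y => wy (x, y)) (eta * (e / 2)) eta oI eta0.
  move=> /(_ _ _ _ _ (ltW hx) a b ab) h; apply: (le_trans (h _ _ _ _ _)).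
  - by move=> t It; case: (@dw (x, t)).
  - by move=> t It; apply: continuous_slice2; exact: cy.
  - by move=> t It; apply: continuous_slice2; exact: cf.
  - by move=> t; rewrite /f lerDr sqr_ge0.
  - by move=> t /andP[t1 t2]; rewrite /= in_itv/=; apply/andP; split; lra.
  rewrite [eta * (e / 2)]mulrC mulfK ?gt_eqF//.
  have : eta * (b - a) <= eta * (2 * l) by rewrite ler_pM2l//; lra.
  have -> : eta * (2 * l) = e / 2 by rewrite /eta; field; rewrite gt_eqF.
  by lra.
move=> y y' Iy Iy'; have [yy|yy] := leP y y'; first by rewrite distrC; exact: H.
by apply: H => //; exact: ltW.
Qed.

(** [K] is the energy on one horizontal line and does not depend on [eta]. As [eta] is arbitrary,
    [w] grows along that line more slowly than any linear function. *)
Lemma horizontal_growth : exists y K, [/\ I y, 0 <= K &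
  forall eta a b, 0 < eta -> a <= b -> (forall t, a <= t <= b -> D t) ->
  `|w (b, y) - w (a, y)| <= eta * (b - a) + K / eta].
Proof.
have l00 := l0.
have muI : (0 < mu I)%E.
  have := lebesgue_measure_itv `]- l, l[; rewrite /= lte_fin => ->.
  by rewrite ifT; [rewrite -EFinB lte_fin|]; lra.
have [y Iy hy] := @exists_horizontal_line _ f D I oD oI f0 cf fin muI.
have f1 : (0 <= \int[mu]_(x in D) (f (x, y))%:E)%E.
  by apply: integral_ge0 => x _; rewrite lee_fin.
have [K hK] : exists K, (\int[mu]_(x in D) (f (x, y))%:E)%E = K%:E.
  by move: hy f1; case: (integral _ _ _) => // r _ _; exists r.
exists y, K; split => //; first by rewrite -lee_fin -hK.
move=> eta a b eta0 ab sD.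
have := @line_increment_le D (fun x => f (x, y)) (fun x => w (x, y))
    (fun x => wx (x, y)) K eta oD eta0.
move=> h; apply: h => //.
- by move=> t Dt; case: (@dw (t, y)).
- by move=> t Dt; apply: continuous_slice1; exact: cx.
- by move=> t Dt; apply: continuous_slice1; exact: cf.
- by move=> t; rewrite /f lerDl sqr_ge0.
- by rewrite hK.
Qed.

End HalfCylinder.

(** * Maximum principle on the periodic exterior domain *)

Section LogBarrier.
Context {R : realType}.
Variables (k a : R).

Definition coshB (t : R) : R := expR (k * (t - a)) + expR (- k * (t - a)).
Definition log_barrier_arg (p : R * R) : R := coshB p.1 - 2 * cos (k * p.2).
(** With [z = x + i y] this is [ln |2 sinh (k (z - a) / 2)|^2]: harmonic off its poles
    [a + 2 pi i n / k], periodic in [y], and growing linearly in [|x|]. *)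
Definition log_barrier (p : R * R) : R := ln (log_barrier_arg p).

Lemma has_d2_ln (g g1 : R -> R) (x g2 : R) : 0 < g x ->
  (forall t : R, is_derive t 1 g (g1 t)) -> is_derive x 1 g1 g2 ->
  has_d2 (fun t => ln (g t)) x ((g2 * g x - g1 x ^+ 2) / g x ^+ 2).
Proof.
move=> gx dg dg1.
have cg : {for x, continuous g}.
  by case: (dg x) => /derivable1_diffP d _; exact: differentiable_continuous.
have ng : \forall t \near x, 0 < g t by exact: (cvgr_gt _ cg).
apply: (@has_d2_intro _ _ (fun t => (g t)^-1 * g1 t)).
  apply: filterS ng => t gt.
  exact: (@is_derive1_comp _ (@ln R) g _ _ _ (is_derive1_ln gt) (dg t)).
have dv : is_derive x 1 (fun t => (g t)^-1) (- (g x) ^- 2 *: g1 x).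
  exact: (@is_deriveV _ g _ _ _ (lt0r_neq0 gx) (dg x)).
have -> : (fun t => (g t)^-1 * g1 t) = (fun t => (g t)^-1) * g1 by [].
by apply: is_derive_eq; rewrite /GRing.scale/=; field; rewrite gt_eqF.
Qed.

Lemma is_derive_expRB (c t : R) :
  is_derive t 1 (fun t => expR (c * (t - a))) (c * expR (c * (t - a))).
Proof.
have := @is_derive1_comp _ expR (fun t => c * (t - a)) _ _ _
  (is_derive_expR _) (is_derive_linB c a t).
by rewrite mulrC.
Qed.

Lemma is_derive_coshB (t : R) : is_derive t 1 coshB
  (k * expR (k * (t - a)) - k * expR (- k * (t - a))).
Proof.
have h1 := is_derive_expRB k t; have h2 := is_derive_expRB (- k) t.
have -> : coshB = (fun t => expR (k * (t - a))) + (fun t => expR (- k * (t - a))) by [].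
by apply: is_derive_eq; rewrite mulNr.
Qed.

Lemma is_derive_cosk (t : R) : is_derive t 1 (fun t => cos (k * t)) (- k * sin (k * t)).
Proof.
have h := is_derive_linB k 0 t.
have := @is_derive1_comp _ cos (fun t => k * (t - 0)) _ _ _ (is_derive_cos _) h.
rewrite subr0 => h'; have -> : (fun t => cos (k * t)) = cos \o (fun t => k * (t - 0)).
  by apply/funext => u /=; rewrite subr0.
by apply: (is_derive_eq h'); ring.
Qed.

Lemma is_derive_sink (t : R) : is_derive t 1 (fun t => sin (k * t)) (k * cos (k * t)).
Proof.
have h := is_derive_linB k 0 t.
have := @is_derive1_comp _ sin (fun t => k * (t - 0)) _ _ _ (is_derive_sin _) h.
rewrite subr0 => h'; have -> : (fun t => sin (k * t)) = sin \o (fun t => k * (t - 0)).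
  by apply/funext => u /=; rewrite subr0.
by apply: (is_derive_eq h'); rewrite mulrC.
Qed.

Lemma has_lap_log_barrier p : 0 < log_barrier_arg p -> has_lap log_barrier p 0.
Proof.
move=> fp; rewrite /log_barrier_arg in fp.
set e1 := expR (k * (p.1 - a)); set e2 := expR (- k * (p.1 - a)).
have e12 : e1 * e2 = 1 by rewrite /e1 /e2 mulNr expRxMexpNx_1.
set c := cos (k * p.2); set s := sin (k * p.2).
have cs : c ^+ 2 + s ^+ 2 = 1 by exact: cos2Dsin2.
pose f := e1 + e2 - 2 * c.
have f0 : 0 < f by [].
exists (((k ^+ 2 * (e1 + e2)) * f - (k * e1 - k * e2) ^+ 2) / f ^+ 2),
       ((2 * k ^+ 2 * c * f - (2 * k * s) ^+ 2) / f ^+ 2); split.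
- apply: (@has_d2_ln (fun t => coshB t - 2 * cos (k * p.2))
    (fun t => k * expR (k * (t - a)) - k * expR (- k * (t - a)))) => //.
    move=> t; have h := is_derive_coshB t.
    have -> : (fun t => coshB t - 2 * cos (k * p.2)) = coshB - cst (2 * cos (k * p.2)) by [].
    by apply: is_derive_eq; rewrite subr0.
  have h1 := is_derive_expRB k p.1; have h2 := is_derive_expRB (- k) p.1.
  have -> : (fun t => k * expR (k * (t - a)) - k * expR (- k * (t - a))) =
    k *: (fun t => expR (k * (t - a))) - k *: (fun t => expR (- k * (t - a))) by [].
  by apply: is_derive_eq; rewrite /GRing.scale/= -/e1 -/e2; ring.
- apply: (@has_d2_ln (fun t => coshB p.1 - 2 * cos (k * t))
    (fun t => 2 * k * sin (k * t))) => //.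
    move=> t; have h := is_derive_cosk t.
    have -> : (fun t => coshB p.1 - 2 * cos (k * t)) =
      cst (coshB p.1) - 2 *: (fun t => cos (k * t)) by [].
    by apply: is_derive_eq; rewrite sub0r /GRing.scale/=; ring.
  have h := is_derive_sink p.2.
  have -> : (fun t => 2 * k * sin (k * t)) = (2 * k) *: (fun t => sin (k * t)) by [].
  by apply: is_derive_eq; rewrite /GRing.scale/= -/c; ring.
- rewrite -mulrDl; apply/esym/eqP; rewrite mulf_eq0; apply/orP; left; apply/eqP.
  rewrite /f; transitivity (k ^+ 2 * (4 * (e1 * e2) - 4 * (c ^+ 2 + s ^+ 2))); first by ring.
  by rewrite e12 cs subrr mulr0.
Qed.

Lemma continuous_log_barrier p : 0 < log_barrier_arg p -> {for p, continuous log_barrier}.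
Proof.
move=> fp; apply: (@continuous_comp _ _ _ log_barrier_arg (@ln R)); last first.
  exact: continuous_ln.
have c1 : {for p, continuous (fun q : R * R => coshB q.1)}.
  apply: (@continuous_comp _ _ _ (fst : R * R -> R) coshB); first exact: continuous_fst.
  by case: (is_derive_coshB p.1) => /derivable1_diffP d _; exact: differentiable_continuous.
have c2 : {for p, continuous (fun q : R * R => cos (k * q.2))}.
  apply: (@continuous_comp _ _ _ (snd : R * R -> R) (fun t => cos (k * t)));
    first exact: continuous_snd.
  by case: (is_derive_cosk p.2) => /derivable1_diffP d _; exact: differentiable_continuous.
by apply: cvgB => //; apply: cvgM => //; exact: cvg_cst.
Qed.

Lemma coshB_ge (t : R) : 2 <= coshB t.
Proof.
rewrite /coshB mulNr; set e1 := expR _; set e2 := expR _.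
have e12 : e1 * e2 = 1 by exact: expRxMexpNx_1.
have e10 : 0 < e1 by exact: expR_gt0.
have e20 : 0 < e2 by exact: expR_gt0.
by have := sqr_ge0 (e1 - e2); nra.
Qed.

Lemma coshB_gt (t : R) : 0 < k -> t != a -> 2 < coshB t.
Proof.
move=> k0 ta; rewrite lt_neqAle coshB_ge andbT; apply/negP => /eqP e.
have e12 : expR (k * (t - a)) * expR (- (k * (t - a))) = 1 by exact: expRxMexpNx_1.
rewrite /coshB mulNr in e.
have e1 : expR (k * (t - a)) = 1.
  by apply/eqP; rewrite -subr_eq0 -sqrf_eq0; apply/eqP; nra.
have : k * (t - a) = 0 by rewrite -[LHS]expRK e1 ln1.
by move=> /eqP; rewrite mulf_eq0 subr_eq0 (negbTE ta) orbF gt_eqF.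
Qed.

(** Half of the true slope pays for the cosine: [exp t - 2 >= exp (t / 2)] as soon as
    [exp (t / 2) >= 2]. *)
Lemma log_barrier_growth p : 0 < k -> 2 <= k * `|p.1 - a| ->
  k * `|p.1 - a| / 2 <= log_barrier p.
Proof.
move=> k0 h; set t := k * _ in h *.
have hc : expR t <= coshB p.1.
  rewrite /coshB /t mulNr; have [h1|h1] := leP 0 (p.1 - a).
    by rewrite ger0_norm// lerDl expR_ge0.
  by rewrite ltr0_norm// mulrN lerDr expR_ge0.
have ht : 2 <= expR (t / 2) by apply: le_trans (expR_ge1Dx _); lra.
have h3 : expR (t / 2) <= log_barrier_arg p.
  have e : expR t = expR (t / 2) * expR (t / 2) by rewrite -expRD; congr expR; field.
  rewrite /log_barrier_arg; have := cos_le1 (k * p.2); nra.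
rewrite -[leLHS](@expRK R) ler_ln ?posrE ?expR_gt0//.
exact: lt_le_trans (expR_gt0 _) h3.
Qed.

End LogBarrier.

Section Cylinder.
Context {R : realType}.
Variables (eps delta : R).
Hypotheses (eps0 : 0 < eps) (eps1 : eps < 1) (delta0 : 0 < delta).
Local Notation L := (2 + delta).
Local Notation E := (ext eps delta).
Implicit Types (p q c : R * R) (w : R * R -> R).

Lemma center_shift c (k : int) : disk_center eps delta c ->
  disk_center eps delta (c.1, c.2 + k%:~R * L).
Proof.
by move=> [n [->|->]]; exists (n + k); [left|right];
  rewrite /cL /cR /= -mulrDl rmorphD.
Qed.

Lemma closure_ext_shift p (k : int) : closure E p ->
  closure E (p.1, p.2 + k%:~R * L).
Proof.
move=> /(closure_extP eps0 delta0) h; apply/(closure_extP eps0 delta0) => c cc.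
have := h _ (center_shift (- k) cc); rewrite /sqd /= mulrNz mulNr.
by congr (_ <= _ + _ ^+ 2); ring.
Qed.

Lemma periodic_int w (P : R) :
  (forall p, closure E p -> w (p.1, p.2 + L) = w p + P) ->
  forall (k : int) p, closure E p -> w (p.1, p.2 + k%:~R * L) = w p + k%:~R * P.
Proof.
move=> per.
have H (n : nat) p : closure E p -> w (p.1, p.2 + n%:R * L) = w p + n%:R * P.
  move=> Ep; elim: n => [|n ih].
    by rewrite !mul0r !addr0; case: (p).
  have := per _ (closure_ext_shift (k := n) Ep); rewrite /= -pmulrn ih.
  have -> : p.2 + n.+1%:R * L = p.2 + n%:R * L + L by rewrite -(natr1 n); ring.
  by move=> ->; rewrite -(natr1 n); ring.
move=> [n|n] p Ep; first by rewrite -!pmulrn H.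
rewrite NegzE !mulrNz -!pmulrn !mulNr.
have Ep' := closure_ext_shift (k := - (n.+1)%:Z) Ep; rewrite mulrNz -pmulrn mulNr in Ep'.
have := H n.+1 _ Ep'; rewrite /= subrK => e.
have -> : w p = w (p.1, p.2) by case: (p).
by rewrite e addrK.
Qed.

(** With this frequency and the shift [a] below, the barrier has the period of the disks and its
    poles are the centres of the right disks, which lie outside the domain. *)
Let k : R := (pi *+ 2) / L.
Let a : R := 1 + eps / 2.
Local Notation B := (log_barrier k a).

Lemma L_gt0 : 0 < L. Proof. by rewrite addr_gt0. Qed.

Lemma k_gt0 : 0 < k. Proof. by rewrite divr_gt0 ?L_gt0// pmulrn_lgt0// pi_gt0. Qed.

Lemma kL : k * L = pi *+ 2.
Proof. by rewrite divfK// gt_eqF// L_gt0. Qed.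

Lemma log_barrier_shift p : B (p.1, p.2 + L) = B p.
Proof. by rewrite /log_barrier /log_barrier_arg /= mulrDr kL cosD2pi. Qed.

(** Off the line [x = a] the hyperbolic cosine exceeds 1. On it, a point outside the disk has
    [|y| >= 1], and within the cell [k |y|] lies in [(0, pi]], where the cosine is below 1. *)
Lemma log_barrier_arg_gt0 p : closure E p -> `|p.2| <= L / 2 ->
  0 < log_barrier_arg k a p.
Proof.
move=> /(closure_extP eps0 delta0) Ep p2; rewrite /log_barrier_arg subr_gt0.
have [p1|p1] := eqVneq p.1 a; last first.
  have := coshB_gt k_gt0 p1; have := cos_le1 (k * p.2); lra.
suff : cos (k * p.2) < 1 by have := coshB_ge k a p.1; lra.
have y1 : 1 <= `|p.2|.
  have := Ep (cR eps delta 0) (ex_intro _ 0 (or_intror erefl)).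
  rewrite /sqd /= p1 /a subrr expr0n/= add0r mul0r subr0 -real_normK ?num_real//.
  by rewrite -[leLHS](expr1n _ 2) ler_sqr ?nnegrE.
have -> : cos (k * p.2) = cos (k * `|p.2|).
  by have [h|h] := leP 0 p.2; [rewrite ger0_norm|rewrite ltr0_norm// mulrN cosN].
have kp := k_gt0.
rewrite -(@cos0 R) ltr_cos ?in_itv/= ?lexx ?pi_ge0//; first by rewrite mulr_gt0//; lra.
rewrite mulr_ge0 ?normr_ge0 ?(ltW kp)//=.
have <- : k * (L / 2) = pi by rewrite mulrA kL mulr2n; field.
by rewrite ler_pM2l.
Qed.

Lemma fundamental_domain p : closure E p ->
  exists n : int, closure E (p.1, p.2 + n%:~R * L) /\ `|p.2 + n%:~R * L| <= L / 2.
Proof.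
move=> Ep; have [n hn] := nearest_int delta0 p.2.
exists (- n); split; first exact: closure_ext_shift.
by rewrite mulrNz mulNr.
Qed.

Lemma closure_ext_far p : 3 <= `|p.1| :> R -> closure E p.
Proof. by move=> h; apply: subset_closure; exact: ext_far. Qed.

(** Smallness is asked only on some vertical lines arbitrarily far out on each side, because Fubini
    provides only selected lines. Two of them suffice to cut the cylinder to a compact piece. *)
Definition sublinear_lines w : Prop :=
  forall s : R, `|s| = 1 -> forall eta X0 : R, 0 < eta ->
  exists2 X, X0 < X & forall y, `|w (s * X, y)| <= eta * X.

(** A Phragmen-Lindelof argument: on the selected lines a small multiple of the logarithmic barrier
    exceeds [w - m], and that multiple then tends to zero. The upper and lower edges of a cell are
    identified by periodicity, so only the circles and the two lines count as boundary. *)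
Lemma cylinder_max_principle w (m : R) :
  (forall p, E p -> has_lap w p 0) ->
  {within closure E, continuous w} ->
  (forall p, closure E p -> w (p.1, p.2 + L) = w p) ->
  (forall p c, closure E p -> disk_center eps delta c -> sqd p c = 1 -> w p <= m) ->
  sublinear_lines w ->
  forall p, closure E p -> w p <= m.
Proof.
move=> Lw cw per wm slow p0 Ep0.
have e0 := eps0; have e1 := eps1; have d0 := delta0; have kp := k_gt0; have Lp := L_gt0.
have per' (n : int) q : closure E q -> w (q.1, q.2 + n%:~R * L) = w q.
  by move=> Eq; rewrite (@periodic_int w 0) ?mulr0 ?addr0// => z Ez; rewrite addr0 per.
have [n [Ep p2]] := fundamental_domain Ep0.
rewrite -(per' n)//; move: Ep p2; set p := (_, _) => Ep p2.
pose Xb := 3 + 2 / k + a.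
have k2 : 0 < 2 / k by rewrite divr_gt0.
have a0 : 0 < a by rewrite /a; lra.
have Xb3 : 3 < Xb by rewrite /Xb; lra.
have Bfar q : Xb <= `|q.1| -> 0 <= B q /\ k * (`|q.1| - a) / 2 <= B q.
  move=> hq; have aq : `|q.1| - a <= `|q.1 - a|.
    by have := lerB_dist q.1 a; rewrite (gtr0_norm a0).
  have h2 : 2 / k <= `|q.1 - a| by move: hq; rewrite /Xb; lra.
  have h3 : 2 <= k * `|q.1 - a| by rewrite mulrC -ler_pdivrMr.
  have := log_barrier_growth kp h3; split; first lra.
  have : k * (`|q.1| - a) <= k * `|q.1 - a| by rewrite ler_pM2l.
  by lra.
have cB q : closure E q -> `|q.2| <= L / 2 -> {for q, continuous B}.
  by move=> Eq q2; apply: continuous_log_barrier; exact: log_barrier_arg_gt0.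
(* Near the disks the barrier may be negative; [b] lifts it to be nonnegative on the whole cell. *)
have [b [b0 Bb]] : exists b, 0 <= b /\ forall q, closure E q -> `|q.2| <= L / 2 -> 0 <= B q + b.
  pose K := rect (- Xb) Xb (- (L / 2)) (L / 2) `&` closure E.
  have cK : compact K.
    apply: (@subclosed_compact _ _ (rect (- Xb) Xb (- (L / 2)) (L / 2)));
      [|exact: compact_rect|by move=> ? []].
    apply: closedI; last exact: closed_closure.
    by apply: compact_closed; [exact: norm_hausdorff|exact: compact_rect].
  have [||c /set_mem Kc hc] := @compact_EVT_min _ _ B K _ cK.
  - exists (3, 0); split; first by rewrite /rect/=; split; apply/andP; split; lra.
    by apply: closure_ext_far; rewrite /= ger0_norm.
  - apply: pointwise_within => q [[q1 q2] Eq]; apply: cB => //.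
    by rewrite ler_norml.
  exists `|B c|; split=> // q Eq q2.
  have [h|h] := leP Xb `|q.1|; first by have := (Bfar _ h).1; have := normr_ge0 (B c); lra.
  have Kq : K q.
    split=> //; move: q2 h; rewrite ler_norml ltr_norml => /andP[? ?] /andP[? ?].
    by split; apply/andP; split; lra.
  have := hc q (mem_set Kq); have := ler_norm (- B c); rewrite normrN; lra.
apply/ler_addgt0Pr => e e00.
pose C := B p + b + 1.
have C1 : 1 <= C by have := Bb _ Ep p2; rewrite /C; lra.
(* Chosen so that the lifted barrier costs at most [e / 2] at the point [p] under consideration. *)
pose eta := e / (2 * C).
have eta0 : 0 < eta by rewrite divr_gt0// mulr_gt0//; lra.
have side s : `|s| = 1 -> exists2 X, Xb + `|p.1| < X &
    forall y, `|y| <= L / 2 -> w (s * X, y) - m <= eta * (B (s * X, y) + b).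
  (* For [X >= 2 a] the barrier term is at least [eta k (X - a) / 2 >= 2 eta' X]; one half pays for
     [w], the other for [|m|]. *)
  move=> s1; pose eta' := eta * k / 8.
  have eta'0 : 0 < eta' by rewrite divr_gt0// mulr_gt0.
  have [X hX wX] := slow s s1 eta' (Xb + `|p.1| + 2 * a + `|m| / eta') eta'0.
  have m0 : 0 <= `|m| / eta' by rewrite divr_ge0// ltW.
  have p10 := normr_ge0 p.1.
  exists X; first by lra.
  move=> y y2.
  have X0 : 0 < X by lra.
  have sX : `|(s * X, y).1| = X by rewrite /= normrM s1 mul1r gtr0_norm.
  have [_ hB] := Bfar (s * X, y) ltac:(rewrite sX; lra).
  rewrite sX in hB.
  have mX : `|m| <= eta' * X by rewrite mulrC -ler_pdivrMr//; lra.
  have hw := le_trans (ler_norm _) (wX y).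
  have hm : - m <= `|m| by rewrite -normrN ler_norm.
  have : eta * (k * (X - a) / 2) <= eta * (B (s * X, y) + b) by rewrite ler_pM2l//; lra.
  have : eta * k * (X / 2) <= eta * k * (X - a).
    by rewrite ler_pM2l; [lra|rewrite mulr_gt0].
  by rewrite /eta' in hw mX *; lra.
have [X1 hX1 w1] := side 1 (normr1 _).
have [X2 hX2 w2] : exists2 X, Xb + `|p.1| < X &
    forall y, `|y| <= L / 2 -> w (- X, y) - m <= eta * (B (- X, y) + b).
  by have [|X hX wX] := side (-1) _; [rewrite normrN1|exists X => // y; have := wX y;
    rewrite mulN1r].
have p10 := normr_ge0 p.1.
have [hp1 hp2] : - X2 < p.1 /\ p.1 < X1.
  by have := ler_norm p.1; have := ler_norm (- p.1); rewrite normrN; split; lra.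
pose X := X1 + X2.
have Xp : 0 < X by rewrite /X; lra.
have X0 : 0 < X ^+ 2 by rewrite exprn_gt0.
pose z := e / (2 * X ^+ 2).
have z0 : 0 < z by rewrite divr_gt0// mulr_gt0.
(* The term in [z] makes [F] strictly subharmonic. Subtracting [z X^2] keeps its contribution
   nonpositive on [K], at a cost of at most [e / 2] at [p]. *)
pose F q := w q + (- eta * B q + (z * (q.1 - 0) ^+ 2 + (- m - eta * b - z * X ^+ 2))).
pose K := rect (- X2) X1 (- (L / 2)) (L / 2) `&` closure E.
have cK : compact K.
  apply: (@subclosed_compact _ _ (rect (- X2) X1 (- (L / 2)) (L / 2)));
    [|exact: compact_rect|by move=> ? []].
  apply: closedI; last exact: closed_closure.
  by apply: compact_closed; [exact: norm_hausdorff|exact: compact_rect].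
have sqX (x : R) : - X2 <= x <= X1 -> z * (x - 0) ^+ 2 <= z * X ^+ 2.
  by move=> /andP[h1 h2]; rewrite ler_pM2l// /X subr0; nra.
have Fper q (j : int) : F (q.1, q.2 + j%:~R * L) = F q + (w (q.1, q.2 + j%:~R * L) - w q)
   + (- eta * (B (q.1, q.2 + j%:~R * L) - B q)).
  by rewrite /F /=; ring.
have Bm1 q : B (q.1, q.2 - L) = B q.
  by have := log_barrier_shift (q.1, q.2 - L); rewrite /= subrK => <-; case: (q).
have FK : F p <= 0.
  apply: (@max_principle _ K F cK).
  - apply: withinI => q [[/= /andP[q1 q1'] q2] Eq]; apply: cvgD.
      by have := withinP cw Eq; apply: cvg_trans; apply: cvg_app; apply: within_subset => u [].
    apply: cvg_within_filter; apply: cvgD.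
      by apply: cvgM; [exact: cvg_cst|apply: cB; rewrite ?ler_norml].
    apply: cvgD; last exact: cvg_cst.
    have cc : {for q, continuous (fun q : R * R => q.1 - 0)}.
      by apply: cvgB; [exact: continuous_fst|exact: cvg_cst].
    rewrite (_ : (fun x : R * R => z * (x.1 - 0) ^+ 2) =
       (fun x : R * R => z * ((x.1 - 0) * (x.1 - 0)))); last by apply/funext => x; rewrite expr2.
    by rewrite expr2; apply: cvgM; [exact: cvg_cst|apply: cvgM].
  - move=> q [[/= q1 q2] Eq] Fq.
    have q2' : `|q.2| <= L / 2 by rewrite ler_norml.
    have Bq := Bb _ Eq q2'.
    have eB : 0 <= eta * (B q + b) by rewrite mulr_ge0// ltW.
    have sq := sqX _ q1.
    have hw : m < w q + (0 - eta * (B q + b)) by move: Fq; rewrite /F mulNr; lra.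
    have oE : E q.
      apply/(extP eps0 delta0) => c cc; rewrite lt_neqAle.
      rewrite (iffLR (closure_extP eps0 delta0 q) Eq c cc) andbT; apply/negP => /eqP e2.
      by have := wm _ _ Eq cc (esym e2); lra.
    have r1 : - X2 < q.1.
      case/andP: q1 => h1 _; rewrite lt_neqAle h1 andbT; apply/negP => /eqP e2.
      by have := w2 _ q2'; rewrite e2 (_ : (q.1, q.2) = q); [lra|case: (q)].
    have r2 : q.1 < X1.
      case/andP: q1 => _ h1; rewrite lt_neqAle h1 andbT; apply/negP => /eqP e2.
      by have := w1 _ q2'; rewrite mul1r -e2 (_ : (q.1, q.2) = q); [lra|case: (q)].
    split.
      have n1 := near_ext oE.
      have n2 : \forall u \near q, - X2 < u.1 < X1 /\ - L < u.2 < L.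
        apply: near_rect; first by rewrite r1.
        by case/andP: q2 => h1 h2; apply/andP; split; lra.
      near=> u.
      have Eu : closure E u by apply: subset_closure; near: u; exact: n1.
      have [/andP[u1 u1'] /andP[u2 u2']] : - X2 < u.1 < X1 /\ - L < u.2 < L.
        by near: u; exact: n2.
      (* A neighbour that leaves the cell through the top or the bottom is brought back by one
         period, with the same value of [F]. *)
      have [h|h] := leP `|u.2| (L / 2).
        exists u => //; split=> //; rewrite /rect/= (ltW u1) (ltW u1').
        by split=> //; rewrite -ler_norml.
      have [h0|h0] := leP 0 u.2.
        rewrite (ger0_norm h0) in h.
        exists (u.1, u.2 + (-1)%:~R * L).
          split; last exact: closure_ext_shift.
          rewrite /rect/= (ltW u1) (ltW u1') mulN1r; split; first by [].
          by apply/andP; split; lra.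
        by rewrite Fper per'// mulN1r Bm1 !subrr mulr0 !addr0 //.
      rewrite (ltr0_norm h0) in h.
      exists (u.1, u.2 + 1%:~R * L).
        split; last exact: closure_ext_shift.
        rewrite /rect/= (ltW u1) (ltW u1') mul1r; split; first by [].
        by apply/andP; split; lra.
      by rewrite Fper per'// mul1r log_barrier_shift !subrr mulr0 !addr0.
    exists (0 + (- eta * 0 + (z * 2 + 0))); first by rewrite add0r mulr0 add0r addr0 mulr_gt0.
    apply: has_lapD; first exact: Lw.
    apply: has_lapD.
      by apply: has_lapZ; apply: has_lap_log_barrier; exact: log_barrier_arg_gt0.
    apply: has_lapD; last exact: has_lap_cst.
    apply: has_lapZ; exists 2, 0; split; last by rewrite addr0.
    + by move=> /=; exact: has_d2_sqrB.
    + by move=> /=; apply: has_d2_cst.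
  - split=> //; split; last by rewrite -ler_norml.
    by rewrite (ltW hp1) (ltW hp2).
have zX : z * X ^+ 2 = e / 2.
  by rewrite /z; field; rewrite gt_eqF.
have eC : eta * (B p + b) <= e / 2.
  have C0 : 0 < C by lra.
  have -> : e / 2 = eta * C by rewrite /eta; field; rewrite gt_eqF.
  by rewrite ler_pM2l// /C; lra.
have : 0 <= z * (p.1 - 0) ^+ 2 by rewrite mulr_ge0 ?sqr_ge0// ltW.
by move: FK; rewrite /F mulNr; lra.
Unshelve. all: by end_near. Qed.

End Cylinder.

(** * Passing to limits from within a set *)

Section ClosureLimits.
Context {R : realType}.
Implicit Types (A : set (R * R)) (f : R * R -> R) (p q : R * R).

Lemma closure_le A f p (b : R) : closure A p -> f @ within A (nbhs p) --> f p ->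
  (\forall q \near p, A q -> f q <= b) -> f p <= b.
Proof.
move=> cA cf hb; rewrite leNgt; apply/negP => bf.
have n1 : \forall q \near p, A q -> b < f q by exact: (cvgr_gt _ cf).
have [q [Aq [h1 h2]]] := cA _ (filterI hb n1).
by have := lt_le_trans (h2 Aq) (h1 Aq); rewrite ltxx.
Qed.

Lemma within_comp A f (h : R * R -> R * R) p : {for p, continuous h} ->
  (forall q, A q -> A (h q)) -> f @ within A (nbhs (h p)) --> f (h p) ->
  (fun q => f (h q)) @ within A (nbhs p) --> f (h p).
Proof.
move=> ch Ah cf U /cf; rewrite /nbhs/= /within/= => nU.
by have := ch _ nU; rewrite /= /nbhs/=; apply: filterS => q /= hq /Ah; exact: hq.
Qed.

Lemma within_subset_cvg A B f p (y : R) : A `<=` B -> f @ within B (nbhs p) --> y ->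
  f @ within A (nbhs p) --> y.
Proof. by move=> AB; apply: cvg_trans; apply: cvg_app; exact: within_subset. Qed.

Lemma continuous_scale2 (s t : R) p : {for p, continuous (fun q : R * R => (s * q.1, t * q.2))}.
Proof.
have h1 : s * x.1 @[x --> p] --> s * p.1.
  by apply: cvgM; [exact: cvg_cst|exact: continuous_fst].
have h2 : t * x.2 @[x --> p] --> t * p.2.
  by apply: cvgM; [exact: cvg_cst|exact: continuous_snd].
exact: (cvg_pair h1 h2).
Qed.

Lemma continuous_vshift (d : R) p : {for p, continuous (fun q : R * R => (q.1, q.2 + d))}.
Proof.
have h1 : x.1 @[x --> p] --> p.1 by exact: continuous_fst.
have h2 : x.2 + d @[x --> p] --> p.2 + d.
  by apply: cvgD; [exact: continuous_snd|exact: cvg_cst].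
exact: (cvg_pair h1 h2).
Qed.

Lemma closure_strip (l : R) p : 0 < l -> `|p.2| <= l ->
  closure [set q : R * R | q.1 = p.1 /\ `|q.2| < l] p.
Proof.
move=> l0 pl; apply: (@closure_ray _ _ p (0, - p.2) 1) => // s /andP[s0 s1] /=.
split; first by rewrite mulr0 addr0.
have -> : p.2 + s * - p.2 = (1 - s) * p.2 by ring.
rewrite normrM ger0_norm; last by lra.
apply: (@le_lt_trans _ _ ((1 - s) * l)); first by rewrite ler_wpM2l//; lra.
by nra.
Qed.

End ClosureLimits.

(** * Periodicity and sublinear growth from finite energy *)

Section FiniteEnergy.
Context {R : realType}.
Variables (eps delta : R).
Hypotheses (eps0 : 0 < eps) (eps1 : eps < 1) (delta0 : 0 < delta).
Local Notation L := (2 + delta).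
Local Notation l := (1 + delta / 2).
Local Notation E := (ext eps delta).
Local Notation mu := (@lebesgue_measure R).
Implicit Types (p q c : R * R).

(** The signs [s = 1] and [s = -1] treat the right and the left end, both beyond all disks, in one
    argument. *)
Definition side (s : R) : set R := [set x | 3 < s * x].
Definition strip : set R := `]- l, l[%classic.

Variables (w wx wy : R * R -> R).
Hypothesis dw : forall p, E p -> has_grad w p (wx p) (wy p).
Hypothesis cwx : forall p, E p -> {for p, continuous wx}.
Hypothesis cwy : forall p, E p -> {for p, continuous wy}.
Hypothesis cw : {within closure E, continuous w}.
Hypothesis perx : forall p, E p -> wx (p.1, p.2 + L) = wx p.
Hypothesis pery : forall p, E p -> wy (p.1, p.2 + L) = wy p.
Hypothesis fin : forall s : R, `|s| = 1 ->
  (\int[(mu \x mu)%E]_(p in side s `*` strip) (wx p ^+ 2 + wy p ^+ 2)%:E < +oo)%E.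

Lemma l_gt0 : 0 < l. Proof. by have d0 := delta0; lra. Qed.

Lemma open_side s : open (side s).
Proof.
rewrite (_ : side s = (fun x => s * x) @^-1` [set y | 3 < y]) //.
apply: open_comp; last exact: open_gt.
by move=> x _; apply: cvgM; [exact: cvg_cst|exact: cvg_id].
Qed.

Lemma side_norm s x : `|s| = 1 -> side s x -> 3 <= `|x| :> R.
Proof.
move=> s1 h; have : 3 < `|s * x| by apply: lt_le_trans (ler_norm _).
by rewrite normrM s1 mul1r => /ltW.
Qed.

Lemma side_ext s p : `|s| = 1 -> side s p.1 -> E p.
Proof. by move=> s1 h; apply: ext_far => //; exact: side_norm h. Qed.

Lemma strip_le y : strip y -> `|y| <= l.
Proof. by rewrite /strip/= in_itv/= ler_norml => /andP[h1 h2]; rewrite !ltW. Qed.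

Lemma normr1_cases (s : R) : `|s| = 1 -> s = 1 \/ s = -1.
Proof.
move=> h; have [s0|s0] := leP 0 s; first by left; rewrite -h ger0_norm.
by right; rewrite -h ltr0_norm// opprK.
Qed.

Lemma measure_half_line (s X : R) : `|s| = 1 ->
  measurable ([set x | X < s * x] : set (measurableTypeR R)) /\ mu [set x | X < s * x] = +oo%E.
Proof.
move=> /normr1_cases[->|->].
  have -> : [set x | X < 1 * x] = `]X, +oo[%classic.
    by apply/seteqP; split=> x /=; rewrite in_itv/= mul1r andbT.
  by split; [exact: measurable_itv|have := lebesgue_measure_itv `]X, +oo[; rewrite /= ltry].
have -> : [set x | X < -1 * x] = `]-oo, (- X)[%classic.
  by apply/seteqP; split=> x /=; rewrite in_itv/= mulN1r ltrNr.
split; first exact: measurable_itv.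
by have := lebesgue_measure_itv `]-oo, (- X)[; rewrite /= ltNyr.
Qed.

Let ext_line (s X : R) y : `|s| = 1 -> 3 < X -> E (s * X, y).
Proof.
move=> s1 X3; apply: (@side_ext s) => //=; rewrite /side/= mulrA.
by have [->|->] := normr1_cases s1; rewrite ?mulrNN mulr1 mul1r.
Qed.

Let continuous_w p : E p -> {for p, continuous w}.
Proof.
move=> Ep; apply: (within_near cw); have := near_ext Ep; apply: filterS.
exact: subset_closure.
Qed.

(** The Fubini argument speaks of the open strip. Closing it matters because the heights [l] and
    [- l] differ by exactly one period. *)
Lemma line_oscillation (s : R) (X0 e : R) : `|s| = 1 -> 0 < e ->
  exists2 X, X0 < X /\ 3 < X & forall y y', `|y| <= l -> `|y'| <= l ->
    `|w (s * X, y) - w (s * X, y')| <= e.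
Proof.
move=> s1 e0.
have [mD muD] := @measure_half_line s (Num.max X0 3) s1.
have sD : [set x | Num.max X0 3 < s * x] `<=` side s.
  by move=> x /=; rewrite gt_max => /andP[].
have [x Dx osc] := @vertical_oscillation _ w wx wy (side s) l (@open_side s) l_gt0
  (fun p h _ => dw (side_ext s1 h)) (fun p h _ => cwx (side_ext s1 h))
  (fun p h _ => cwy (side_ext s1 h)) (fin s1) _ e mD sD muD e0.
have xE : x = s * (s * x).
  by rewrite mulrA; have [->|->] := normr1_cases s1; rewrite ?mulrNN mulr1 mul1r.
exists (s * x); first by move: Dx => /=; rewrite gt_max => /andP[].
rewrite -xE.
have Ex y : E (x, y) by apply: (@side_ext s) => //=; exact: sD.
have half y y' : `|y| <= l -> strip y' -> `|w (x, y) - w (x, y')| <= e.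
  move=> yl y'l.
  apply: (@closure_le _ [set q | q.1 = x /\ `|q.2| < l]
    (fun q => `|w q - w (x, y')|) (x, y) e).
  - exact: (@closure_strip _ l (x, y) l_gt0 yl).
  - apply: cvg_within_filter; apply: cvg_norm; apply: cvgB; last exact: cvg_cst.
    exact: continuous_w.
  - near=> q => -[q1 q2]; rewrite (_ : q = (x, q.2)); last by rewrite -q1; case: (q).
    by apply: osc => //; rewrite /= in_itv/= -ltr_norml.
move=> y y' yl y'l; rewrite distrC.
apply: (@closure_le _ [set q | q.1 = x /\ `|q.2| < l]
  (fun q => `|w q - w (x, y)|) (x, y') e).
- exact: (@closure_strip _ l (x, y') l_gt0 y'l).
- apply: cvg_within_filter; apply: cvg_norm; apply: cvgB; last exact: cvg_cst.
  exact: continuous_w.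
- near=> q => -[q1 q2]; rewrite (_ : q = (x, q.2)); last by rewrite -q1; case: (q).
  by rewrite distrC; apply: half => //; rewrite /strip /= in_itv/= -ltr_norml.
Unshelve. all: by end_near. Qed.

(** The increment of [w] over a period has zero gradient, so it is a constant [j] on the connected
    set [ext]. Far lines on which [w] oscillates arbitrarily little force [j = 0], and continuity
    carries this to the circles. *)
Lemma periodic_closure p : closure E p -> w (p.1, p.2 + L) = w p.
Proof.
pose G q := w (q.1, q.2 + L) - w q; pose j := G (4, 0).
have d0 := delta0.
have GE q : E q -> G q = j.
  apply: ext_const => // {}q Eq.
  have -> : 0 = 1 * wx (q.1, q.2 + L) - wx q :> R by rewrite perx// mul1r subrr.
  have e2 : 0 = 1 * wy (q.1, q.2 + L) - wy q :> R by rewrite pery// mul1r subrr.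
  rewrite [X in has_grad _ _ _ X](_ : _ = 1 * wy (q.1, q.2 + L) - wy q); last first.
    by rewrite pery// perx// !mul1r !subrr.
  apply: has_gradB; last exact: dw.
  have := @has_grad_refl _ w q 1 0 1 L (wx (q.1, q.2 + L)) (wy (q.1, q.2 + L)).
  rewrite (_ : (fun q0 : R * R => w (1 * q0.1 + 0, 1 * q0.2 + L)) =
    (fun q0 : R * R => w (q0.1, q0.2 + L))); last first.
    by apply/funext => z; rewrite !mul1r addr0.
  apply; rewrite !mul1r addr0; apply: dw; exact: ext_shift.
have j0 : j = 0.
  apply/eqP; rewrite -normr_le0; apply/ler_addgt0Pr => e e0; rewrite add0r.
  have [X [_ X3] osc] := line_oscillation 3 (normr1 R) e0.
  have := osc l (- l); rewrite normrN (ger0_norm (ltW l_gt0)) => /(_ (lexx _) (lexx _)).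
  have -> : w (1 * X, l) = w (1 * X, - l) + j.
    rewrite -(GE (1 * X, - l)); last exact: ext_line (normr1 _) X3.
    by rewrite /G /= addrCA subrr addr0; congr (w (_, _)); field.
  by rewrite addrAC subrr add0r.
move=> Ep.
have cG : G @ within E (nbhs p) --> G p.
  apply: cvgB.
    apply: (@within_comp _ E w (fun q => (q.1, q.2 + L)) p).
    - exact: continuous_vshift.
    - by move=> q; exact: ext_shift.
    - apply: within_subset_cvg (subset_closure (A := E)) _.
      apply: (withinP cw); have := closure_ext_shift eps0 delta0 (k := 1) Ep.
      by rewrite mul1r.
  by apply: within_subset_cvg (subset_closure (A := E)) _; exact: (withinP cw).
have h1 : G p <= 0.
  by apply: (closure_le Ep cG); near=> q => /GE ->; rewrite j0.
have h2 : - G p <= 0.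
  by apply: (@closure_le _ E (fun q => - G q) p 0 Ep (cvgN cG)); near=> q => /GE ->;
    rewrite j0 oppr0.
by apply/eqP; rewrite -subr_eq0 eq_le h1 -oppr_le0 h2.
Unshelve. all: by end_near. Qed.

(** Growth is controlled along one horizontal line only; a far vertical line with oscillation at
    most 1 carries the bound to all heights. *)
Lemma sublinear_w : sublinear_lines w.
Proof.
move=> s s1 eta X0 eta0.
have [y0 [K [Iy0 K0 grow]]] := @horizontal_growth _ w wx wy (side s) l (@open_side s) l_gt0
  (fun p h _ => dw (side_ext s1 h)) (fun p h _ => cwx (side_ext s1 h))
  (fun p h _ => cwy (side_ext s1 h)) (fin s1).
(* The three terms are the oscillation, the starting value at [s * 4], and [K / (eta / 2)]. Beyond
   [2 A / eta] they use half of the allowance [eta * X]. *)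
pose A := 1 + `|w (s * 4, y0)| + 2 * K / eta.
have A1 : 0 <= A by rewrite /A; apply: addr_ge0; [apply: addr_ge0|rewrite divr_ge0 ?mulr_ge0// ltW].
have [X [X1 X3] osc] := line_oscillation (Num.max (Num.max X0 4) (2 * A / eta)) s1 ltr01.
move: X1; rewrite !gt_max => /andP[/andP[hX0 X4] hXA].
exists X => // y.
have [n hn] := nearest_int delta0 y.
have -> : w (s * X, y) = w (s * X, y - n%:~R * L).
  have Ex := subset_closure (ext_line (y := y - n%:~R * L) s1 X3).
  have := @periodic_int _ _ _ eps0 delta0 w 0 _ n _ Ex.
  rewrite /= subrK mulr0 addr0; apply => z Ez.
  by rewrite addr0; exact: periodic_closure.
move: hn; rewrite (_ : L / 2 = l); last by field.
set z := y - _ => hn.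
have o1 := osc _ _ hn (strip_le Iy0).
have g1 : `|w (s * X, y0) - w (s * 4, y0)| <= eta / 2 * (X - 4) + K / (eta / 2).
  have eta2 : 0 < eta / 2 by rewrite divr_gt0.
  have [s1'|s1'] := normr1_cases s1; rewrite s1' ?mul1r ?mulN1r.
    apply: grow => //; first exact: ltW.
    by move=> t /andP[h1 h2]; rewrite /side/= s1' mul1r; lra.
  rewrite distrC (_ : X - 4 = - 4 - - X); last by ring.
  apply: grow => //; first by rewrite lerN2 ltW.
  by move=> t /andP[h1 h2]; rewrite /side/= s1' mulN1r; lra.
have Ke : K / (eta / 2) = 2 * K / eta by field; rewrite gt_eqF.
have hA : 2 * A <= X * eta by rewrite -ler_pdivrMr// ltW.
have t1 : `|w (s * X, z)| <= `|w (s * X, z) - w (s * X, y0)| +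
    (`|w (s * X, y0) - w (s * 4, y0)| + `|w (s * 4, y0)|).
  rewrite -{1}(subrK (w (s * X, y0)) (w (s * X, z))); apply: (le_trans (ler_normD _ _)).
  rewrite lerD2l -{1}(subrK (w (s * 4, y0)) (w (s * X, y0))); exact: ler_normD.
rewrite Ke in g1.
by rewrite /A in hA; nra.
Qed.

End FiniteEnergy.

(** * The solution and its size *)

Section HarmonicBackground.
Context {R : realType}.
Variables (delta : R) (H : R * R -> R).
Hypothesis delta0 : 0 < delta.
Hypothesis harmH : harmonic_on setT H.
Hypothesis perH : forall p, grad H p = grad H (p.1, p.2 + (2 + delta)).
Local Notation L := (2 + delta).
Local Notation l := (1 + delta / 2).
Implicit Types p q : R * R.

Lemma H_has_lap p : has_lap H p 0.
Proof. by apply: (@harmonic_has_lap _ setT) => //; exact: openT. Qed.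

Lemma H_has_grad p : has_grad H p (dx H p) (dy H p).
Proof. by case: harmH => -[h _] _; have [//|h1 _] := h p; exact: has_grad_partials. Qed.

Lemma within_setT (f : R * R -> R) p : {within setT, continuous f} -> {for p, continuous f}.
Proof. by move=> h; apply: (within_near h); near=> q. Unshelve. all: by end_near. Qed.

Lemma H_continuous p : {for p, continuous H}.
Proof. by case: harmH => -[_ [h _]] _; exact: within_setT. Qed.

Lemma H_continuous_dx p : {for p, continuous (dx H)}.
Proof. by case: harmH => -[_ [_ [h _]]] _; exact: within_setT. Qed.

Lemma H_continuous_dy p : {for p, continuous (dy H)}.
Proof. by case: harmH => -[_ [_ [_ [h _]]]] _; exact: within_setT. Qed.

Definition jump : R := H (0, l) - H (0, - l).

Lemma H_shift p : H (p.1, p.2 + L) = H p + jump.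
Proof.
pose G q := H (q.1, q.2 + L) - H q.
have dG q : has_grad G q 0 0.
  have [e1 e2] : dx H q = dx H (q.1, q.2 + L) /\ dy H q = dy H (q.1, q.2 + L).
    by have := perH q; rewrite /grad => -[-> ->].
  have h1 := H_has_grad q.
  have h2 : has_grad (fun z => H (z.1, z.2 + L)) q (dx H q) (dy H q).
    rewrite e1 e2.
    have := @has_grad_refl _ H q 1 0 1 L (dx H (q.1, q.2 + L)) (dy H (q.1, q.2 + L)).
    rewrite (_ : (fun z : R * R => H (1 * z.1 + 0, 1 * z.2 + L)) =
      (fun z : R * R => H (z.1, z.2 + L))); last first.
      by apply/funext => z; rewrite !mul1r addr0.
    by rewrite !mul1r addr0; apply; exact: H_has_grad.
  by have := has_gradB h2 h1; rewrite !subrr.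
have Gx (x x' y : R) : G (x, y) = G (x', y).
  have hor (a b : R) : a <= b -> G (a, y) = G (b, y).
    by move=> ab; apply: (@is_derive0_eq _ (fun t => G (t, y))) => // t _; case: (dG (t, y)).
  by have [h|h] := leP x x'; [exact: hor|rewrite (hor x' x)// ltW].
have Gy (x y y' : R) : G (x, y) = G (x, y').
  have ver (a b : R) : a <= b -> G (x, a) = G (x, b).
    by move=> ab; apply: (@is_derive0_eq _ (fun t => G (x, t))) => // t _; case: (dG (x, t)).
  by have [h|h] := leP y y'; [exact: ver|rewrite (ver y' y)// ltW].
have -> : H (p.1, p.2 + L) = H p + G p by rewrite /G; ring.
congr (_ + _); transitivity (G (0, - l)).
  by rewrite -(Gx p.1 0) -(Gy p.1 p.2 (- l)); case: (p).
by rewrite /G /jump /=; congr (H (_, _) - _); field.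
Qed.

Variable M : R.
Hypothesis M0 : 0 < M.
Hypothesis HM : forall p, Omega_m delta 4 p -> `|H p| <= M.

Lemma H_le_strip p : `|p.1| < 4 -> `|p.2| <= l -> `|H p| <= M.
Proof.
have d0 := delta0.
move=> p1 p2; apply: (@closure_le _ [set q | q.1 = p.1 /\ `|q.2| < l] (fun q => `|H q|)).
- by apply: closure_strip => //; lra.
- by apply: cvg_within_filter; apply: cvg_norm; exact: H_continuous.
- near=> q => -[q1]; rewrite ltr_norml => /andP[q2 q3].
  apply: HM; split; last by rewrite q1.
  by rewrite /Omega/=; apply/andP; split; lra.
Unshelve. all: by end_near. Qed.

Lemma jump_le : `|jump| <= 2 * M.
Proof.
have d0 := delta0.
have l0 : 0 <= l by lra.
have h1 := @H_le_strip (0, l); have h2 := @H_le_strip (0, - l).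
rewrite /= normrN (ger0_norm l0) normr0 in h1 h2.
have {}h1 := h1 ltac:(lra) (lexx _); have {}h2 := h2 ltac:(lra) (lexx _).
by apply: (le_trans (ler_normB _ _)); lra.
Qed.

(** Each shift by a period changes [H] by at most [|jump| <= 2 M], and one shift reaches the
    strip. *)
Lemma H_le p : `|p.1| < 4 -> `|p.2| <= 3 * l -> `|H p| <= 3 * M.
Proof.
have d0 := delta0; have m0 := M0; have hj := jump_le.
move=> p1 p2.
have [h|h] := leP `|p.2| l; first by have := H_le_strip p1 h; lra.
have [h0|h0] := leP 0 p.2.
  rewrite (ger0_norm h0) in h p2.
  have -> : p = (p.1, (p.2 - L) + L) by rewrite subrK; case: (p).
  have := H_shift (p.1, p.2 - L); rewrite /= => ->.
  apply: (le_trans (ler_normD _ _)).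
  have := @H_le_strip (p.1, p.2 - L) p1; rewrite /= ler_norml.
  have -> : - l <= p.2 - L <= l by apply/andP; split; lra.
  by move=> /(_ isT); lra.
rewrite (ltr0_norm h0) in h p2.
have -> : H p = H (p.1, p.2 + L) - jump by rewrite H_shift addrK.
apply: (le_trans (ler_normB _ _)).
have := @H_le_strip (p.1, p.2 + L) p1; rewrite /= ler_norml.
have -> : - l <= p.2 + L <= l by apply/andP; split; lra.
by move=> /(_ isT); lra.
Qed.

(** The interior estimate in a box of half-width 1, where [|H| <= 3 M]; such a box leaves the strip,
    hence the larger range of [H_le]. *)
Lemma H_dy_le y : `|y| <= l -> `|dy H (0, y)| <= 9 * M.
Proof.
have d0 := delta0; have m0 := M0.
move=> hy; have -> : 9 * M = 3 * (3 * M) / 1 by field.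
apply: interior_dy_le => //; first lra.
- by move=> q _; exact: H_has_lap.
- by move=> q _; exact: H_continuous.
move=> q [/= q1 q2]; apply: H_le; first by rewrite subr0 in q1; lra.
by have := ler_normD (q.2 - y) y; rewrite subrK; lra.
Qed.

(** The coefficient of the theorem is measured between the heights [-1] and [1], the period runs
    from [- l] to [l]. The two missing segments have length [delta / 2] each; the factor [delta]
    later compensates a division by [delta + x^2]. *)
Lemma jump_near : delta <= 1 ->
  `|jump - (H (0, 1) - H (0, -1))| <= 9 * M * delta.
Proof.
have d0 := delta0; have m0 := M0 => d1.
have step (a b : R) : a < b -> - l <= a -> b <= l ->
    `|H (0, b) - H (0, a)| <= 9 * M * (b - a).
  move=> ab la bl.
  have dH t : is_derive (t : R) 1 (fun t => H (0, t)) (dy H (0, t)).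
    by case: (H_has_grad (0, t)).
  have [|c] := @MVT _ (fun t => H (0, t)) (fun t => dy H (0, t)) a b ab.
  - by apply: derivable_within_continuous => t _; case: (dH t).
  rewrite in_itv/= => /andP[c1 c2] ->.
  rewrite normrM (gtr0_norm (_ : 0 < b - a)) ?subr_gt0//.
  rewrite ler_wpM2r ?subr_ge0 ?(ltW ab)//; apply: H_dy_le.
  by rewrite ler_norml; apply/andP; split; lra.
have h1 := step 1 l ltac:(lra) ltac:(lra) (lexx _).
have h2 := step (- l) (-1) ltac:(lra) (lexx _) ltac:(lra).
have -> : jump - (H (0, 1) - H (0, -1)) = (H (0, l) - H (0, 1)) + (H (0, -1) - H (0, - l)).
  by rewrite /jump; ring.
by apply: (le_trans (ler_normD _ _)); lra.
Qed.

End HarmonicBackground.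

Section Solution.
Context {R : realType}.
Variables (eps delta : R) (H u : R * R -> R).
Hypotheses (eps0 : 0 < eps) (eps1 : eps < 1) (delta0 : 0 < delta).
Hypothesis harmH : harmonic_on setT H.
Hypothesis perH : forall p, grad H p = grad H (p.1, p.2 + (2 + delta)).
Hypothesis sol : is_solution eps delta H u.
Local Notation L := (2 + delta).
Local Notation l := (1 + delta / 2).
Local Notation E := (ext eps delta).
Local Notation mu := (@lebesgue_measure R).
Implicit Types p q : R * R.

Lemma u_has_lap p : E p -> has_lap u p 0.
Proof. by case: sol => h _; apply: harmonic_has_lap h; exact: open_ext. Qed.

Lemma u_has_grad p : E p -> has_grad u p (dx u p) (dy u p).
Proof. by case: sol => -[[h _] _] _ /h[h1 _]; exact: has_grad_partials. Qed.

Lemma u_within : {within closure E, continuous u}.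
Proof. by case: sol => _ []. Qed.

Lemma ext_continuous (f : R * R -> R) p : {within E, continuous f} -> E p ->
  {for p, continuous f}.
Proof. by move=> h Ep; apply: (within_near h); exact: near_ext. Qed.

Lemma u_continuous_dx p : E p -> {for p, continuous (dx u)}.
Proof. by case: sol => -[[_ [_ [h _]]] _] _; exact: ext_continuous. Qed.

Lemma u_continuous_dy p : E p -> {for p, continuous (dy u)}.
Proof. by case: sol => -[[_ [_ [_ [h _]]]] _] _; exact: ext_continuous. Qed.

Definition correction p : R := u p - H p.

Lemma correction_has_grad p : E p -> has_grad correction p (dx u p - dx H p) (dy u p - dy H p).
Proof. by move=> Ep; apply: has_gradB; [exact: u_has_grad|exact: H_has_grad]. Qed.

Lemma correction_within : {within closure E, continuous correction}.
Proof.
apply: withinI => p Ep; apply: cvgB; first exact: (withinP u_within).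
by apply: cvg_within_filter; exact: H_continuous.
Qed.

Lemma closure_disk (c p : R * R) : sqd p c <= 1 -> closure (disk c) p.
Proof.
rewrite le_eqVlt => /predU1P[e|lt1]; last by apply: subset_closure.
apply: (@closure_ray _ _ _ (c.1 - p.1, c.2 - p.2) 1) => // s /andP[s0 s1].
rewrite /disk /= (_ : _ + _ = (1 - s) ^+ 2 * sqd p c); last by rewrite /sqd /=; ring.
by rewrite e; nra.
Qed.

Lemma cell_ext p : Omega delta p ->
  ~ closure (disk (cL eps delta 0) `|` disk (cR eps delta 0)) p -> E p.
Proof.
move=> /andP[y1 y2] nD; apply/(extP eps0 delta0) => c [n hc].
have d0 := delta0.
have [n0|n0] := eqVneq n 0.
  rewrite ltNge; apply/negP => le1; apply: nD.
  have := closure_disk le1; apply: closure_subset => q; rewrite n0 in hc.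
  by case: hc => ->; [left|right].
have : 1 < (p.2 - c.2) ^+ 2.
  have -> : c.2 = n%:~R * L by case: hc => ->.
  apply: (@other_row _ delta _ p.2 0 n) => //; first by rewrite eq_sym.
  by rewrite mul0r subr0 ler_norml; apply/andP; split; lra.
by rewrite /sqd; have := sqr_ge0 (p.1 - c.1); lra.
Qed.

Let wcx p : E p -> {for p, continuous (fun p => dx u p - dx H p)}.
Proof. move=> Ep; have c1 := u_continuous_dx Ep; have c2 := H_continuous_dx harmH (p := p).
exact: cvgB. Qed.

Let wcy p : E p -> {for p, continuous (fun p => dy u p - dy H p)}.
Proof. move=> Ep; have c1 := u_continuous_dy Ep; have c2 := H_continuous_dy harmH (p := p).
exact: cvgB. Qed.

Lemma correction_energy (s : R) : `|s| = 1 ->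
  (\int[(mu \x mu)%E]_(p in side s `*` strip delta)
     ((dx u p - dx H p) ^+ 2 + (dy u p - dy H p) ^+ 2)%:E < +oo)%E.
Proof.
move=> s1; case: sol => _ [_ [_ [_ [_ [en _]]]]].
set D := closure _ in en.
pose A : set (R * R) := Omega delta `\` D.
have oO : open (Omega delta).
  rewrite openE => p /andP[h1 h2]; rewrite /interior.
  have n1 : \forall q \near p, - 1 - delta / 2 < q.2.
    by apply: near_lt h1; [exact: cvg_cst|exact: continuous_snd].
  have n2 : \forall q \near p, q.2 < 1 + delta / 2.
    by apply: near_lt h2; [exact: continuous_snd|exact: cvg_cst].
  by apply: filterS2 n1 n2 => q /= a b; apply/andP.
have oA : open A.
  by rewrite /A setDE; apply: openI => //; apply: closed_openC; exact: closed_closure.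
have AE p : A p -> E p by move=> [Op nD]; exact: cell_ext.
have subA : side s `*` strip delta `<=` A.
  move=> p [/= ps]; rewrite /strip/= in_itv/= => pl; split.
    by rewrite /Omega/=; move: pl => /andP[h1 h2]; apply/andP; split; lra.
  have Ep := side_ext eps0 eps1 delta0 s1 ps => clD; apply: Ep.
  move: clD; apply: closure_subset => q; case=> h; exists 0; [by left|by right].
pose g p := (dx u p - dx H p) ^+ 2 + (dy u p - dy H p) ^+ 2.
have cg p : A p -> {for p, continuous g}.
  move=> /AE Ep; have -> : g = fun p => (dx u p - dx H p) * (dx u p - dx H p) +
      (dy u p - dy H p) * (dy u p - dy H p).
    by apply/funext => q; rewrite /g !expr2.
  have c1 := wcx Ep; have c2 := wcy Ep.
  exact: (cvgD (cvgM c1 c1) (cvgM c2 c2)).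
have eqE : energy A (grad (fun p => u p - H p)) = (\int[(mu \x mu)%E]_(p in A) (g p)%:E)%E.
  apply: eq_integral => p /set_mem /AE Ep.
  have wg := correction_has_grad Ep.
  by rewrite /grad /= (has_grad_dx wg) (has_grad_dy wg).
rewrite -/A eqE in en; apply: le_lt_trans en.
apply: ge0_subset_integral.
- apply: (measurableX _ _); last exact: measurable_itv.
  exact: (@measure_half_line _ s 3 s1).1.
- exact: open_measurable_plane.
- by apply/measurable_EFinP; apply: continuous_measurable_plane.
- by move=> p _; rewrite lee_fin addr_ge0// sqr_ge0.
- exact: subA.
Qed.

Let gradshift p : E p -> dx u (p.1, p.2 + L) - dx H (p.1, p.2 + L) = dx u p - dx H p /\
  dy u (p.1, p.2 + L) - dy H (p.1, p.2 + L) = dy u p - dy H p.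
Proof.
move=> Ep; case: sol => _ [_ [_ [_ [_ [_ per]]]]].
by have := per _ Ep; have := perH p; rewrite /grad => -[-> ->] [-> ->].
Qed.

Lemma correction_periodic p : closure E p -> correction (p.1, p.2 + L) = correction p.
Proof.
have p1 q (Eq : E q) := (gradshift Eq).1; have p2 q (Eq : E q) := (gradshift Eq).2.
exact: (periodic_closure eps0 eps1 delta0 correction_has_grad wcx wcy correction_within p1 p2
  correction_energy).
Qed.

Lemma correction_sublinear : sublinear_lines correction.
Proof.
have p1 q (Eq : E q) := (gradshift Eq).1; have p2 q (Eq : E q) := (gradshift Eq).2.
exact: (sublinear_w eps0 eps1 delta0 correction_has_grad wcx wcy correction_within p1 p2
  correction_energy).
Qed.

(** So the constants on the disks of a column form an arithmetic progression, and the difference of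
    boundary values across a horizontal gap is known from [H] alone. *)
Lemma u_shift p : closure E p -> u (p.1, p.2 + L) = u p + jump delta H.
Proof.
move=> Ep; have := correction_periodic Ep; rewrite /correction (H_shift harmH perH) => e.
by rewrite -[LHS](subrK (H p + jump delta H)) e; ring.
Qed.

Lemma u_shift_int (n : int) p : closure E p ->
  u (p.1, p.2 + n%:~R * L) = u p + n%:~R * jump delta H.
Proof. exact: (periodic_int eps0 delta0 u_shift). Qed.

Variables kL kR : R.
Hypothesis uL : forall p, circle (cL eps delta 0) p -> u p = kL.
Hypothesis uR : forall p, circle (cR eps delta 0) p -> u p = kR.

Lemma circle_closure_ext c p : disk_center eps delta c -> sqd p c = 1 -> closure E p.
Proof.
move=> cc e; apply/(closure_extP eps0 delta0) => c' cc'.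
have [->|ne] := pselect (c' = c); first by rewrite e.
have m0 : 0 < Num.min eps delta by rewrite lt_min eps0.
have := centers_separated eps0 delta0 cc cc' (nesym ne).
have nq : nrm p c = 1 by rewrite /nrm e sqrtr1.
have := nrm_triangle p c c'; rewrite (nrmC c p) nq => h1 h2.
by rewrite -[1](expr1n _ 2) -nrm_ge//; lra.
Qed.

Lemma circle_translate (n : int) c p : disk_center eps delta c -> c.2 = 0 ->
  sqd p (c.1, n%:~R * L) = 1 -> exists q,
  [/\ sqd q c = 1, closure E q & p = (q.1, q.2 + n%:~R * L)].
Proof.
move=> cc c2 e; pose q := (p.1, p.2 - n%:~R * L).
have qc : sqd q c = 1 by rewrite -e /sqd /q c2 /=; congr (_ + _ ^+ 2); ring.
exists q; split => //; last by rewrite /q /= subrK; case: (p).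
exact: circle_closure_ext qc.
Qed.

Lemma disk_centerL (n : int) : disk_center eps delta (cL eps delta n).
Proof. by exists n; left. Qed.

Lemma disk_centerR (n : int) : disk_center eps delta (cR eps delta n).
Proof. by exists n; right. Qed.

Lemma u_circleL (n : int) p : sqd p (cL eps delta n) = 1 ->
  u p = kL + n%:~R * jump delta H.
Proof.
move=> e.
have [|q [q1 Eq ->]] := @circle_translate n _ p (disk_centerL 0) _ e.
  by rewrite /= mul0r.
by rewrite u_shift_int// uL.
Qed.

Lemma u_circleR (n : int) p : sqd p (cR eps delta n) = 1 ->
  u p = kR + n%:~R * jump delta H.
Proof.
move=> e.
have [|q [q1 Eq ->]] := @circle_translate n _ p (disk_centerR 0) _ e.
  by rewrite /= mul0r.
by rewrite u_shift_int// uR.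
Qed.

Variable M : R.
Hypothesis M0 : 0 < M.
Hypothesis HM : forall p, Omega_m delta 4 p -> `|H p| <= M.

(** On disk [n] the jumps of [u] and [H] cancel, so [correction] there is a boundary constant minus
    a value of [H] taken on the disk of row 0. *)
Lemma correction_circle_le (n : int) p :
  (sqd p (cL eps delta n) = 1 -> `|correction p - kL| <= M) /\
  (sqd p (cR eps delta n) = 1 -> `|correction p - kR| <= M).
Proof.
have e0 := eps0; have e1 := eps1; have d0 := delta0.
have HJ q : closure E q -> H (q.1, q.2 + n%:~R * L) = H q + n%:~R * jump delta H.
  by apply: (periodic_int eps0 delta0) => z _; exact: H_shift.
have Hc q c : sqd q c = 1 -> `|c.1| <= 2 -> c.2 = 0 -> `|H q| <= M.
  move=> e c1 c2.
  have [h1 h2] : `|q.1 - c.1| <= 1 /\ `|q.2| <= 1.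
    rewrite /sqd c2 subr0 in e.
    have s1 := sqr_ge0 (q.1 - c.1); have s2 := sqr_ge0 q.2.
    by split; rewrite -ler_sqr ?nnegrE// real_normK ?num_real// expr1n; lra.
  apply: (H_le_strip delta0 harmH HM); last by lra.
  by have := ler_normD (q.1 - c.1) c.1; rewrite subrK; lra.
split=> e.
  have [|q [q1 Eq pE]] := @circle_translate n _ p (disk_centerL 0) _ e.
    by rewrite /= mul0r.
  rewrite /correction (u_circleL e) pE HJ// (_ : _ - _ - kL = - H q); last by ring.
  rewrite normrN; apply: Hc q1 _ _; last by rewrite /= mul0r.
  by rewrite /= ler0_norm; lra.
have [|q [q1 Eq pE]] := @circle_translate n _ p (disk_centerR 0) _ e.
  by rewrite /= mul0r.
rewrite /correction (u_circleR e) pE HJ// (_ : _ - _ - kR = - H q); last by ring.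
rewrite normrN; apply: Hc q1 _ _; last by rewrite /= mul0r.
by rewrite /= ger0_norm; lra.
Qed.

Local Notation m0 := ((kL + kR) / 2).
Local Notation c0 := ((kR - kL) / 2).

Lemma correction_le p : closure E p -> `|correction p - m0| <= `|c0| + M.
Proof.
have wc q c : disk_center eps delta c -> sqd q c = 1 -> `|correction q - m0| <= `|c0| + M.
  move=> [n [->|->]] e; have [hL hR] := correction_circle_le n q.
    have -> : correction q - m0 = (correction q - kL) - c0 by field.
    by apply: (le_trans (ler_normB _ _)); have := hL e; lra.
  have -> : correction q - m0 = (correction q - kR) + c0 by field.
  by apply: (le_trans (ler_normD _ _)); have := hR e; lra.
have Lw q : E q -> has_lap correction q 0.
  move=> Eq; have := has_lapB (u_has_lap Eq) (H_has_lap harmH q).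
  by rewrite subrr.
move=> Ep; rewrite ler_norml; apply/andP; split; last first.
  rewrite lerBlDr; apply: (cylinder_max_principle eps0 eps1 delta0 Lw correction_within
    correction_periodic) => //.
    move=> q c Eq cc e; have := wc q c cc e; rewrite ler_norml => /andP[_]; lra.
  exact: correction_sublinear.
rewrite lerNl.
have : -1 * correction p <= `|c0| + M - m0.
  apply: (@cylinder_max_principle _ eps delta eps0 eps1 delta0 (fun q => -1 * correction q)).
  - by move=> q Eq; rewrite -(mulr0 (-1)); apply: has_lapZ; exact: Lw.
  - apply: withinI => q Eq; apply: cvgM; first exact: cvg_cst.
    exact: (withinP correction_within).
  - by move=> q Eq; rewrite correction_periodic.
  - move=> q c Eq cc e; have := wc q c cc e; rewrite ler_norml => /andP[+ _]; lra.
  - move=> s s1 eta X0 eta0; have [X hX wX] := correction_sublinear s1 X0 eta0.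
    by exists X => // y; rewrite mulN1r normrN.
  - exact: Ep.
by lra.
Qed.

Lemma u_le p : closure E p -> `|p.1| < 4 -> `|p.2| <= 3 * l ->
  `|u p - m0| <= `|c0| + 4 * M.
Proof.
move=> Ep p1 p2; have := correction_le Ep.
have := H_le delta0 harmH perH M0 HM p1 p2.
have -> : u p - m0 = (correction p - m0) + H p by rewrite /correction; ring.
move=> h1 h2; apply: (le_trans (ler_normD _ _)); lra.
Qed.

End Solution.

(** * The potential of a narrow gap *)

Section GapModel.
Context {R : realType}.
Implicit Types (p q c : R * R).

Lemma is_derive_ge0_le (g g' : R -> R) (a b : R) : a <= b ->
  (forall t : R, is_derive t 1 g (g' t)) -> (forall t, a <= t <= b -> 0 <= g' t) ->
  g a <= g b.
Proof.
rewrite le_eqVlt => /predU1P[->//|ab] dg g0.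
have [|c] := @MVT _ g g' a b ab.
  by apply: derivable_within_continuous => x _; case: (dg x).
rewrite in_itv/= => /andP[c1 c2] e.
by rewrite -subr_ge0 e mulr_ge0 ?g0 ?subr_ge0 ?(ltW ab) ?(ltW c1) ?(ltW c2).
Qed.

Lemma is_derive_expRN (t : R) : is_derive t 1 (fun t => expR (- t)) (- expR (- t)).
Proof.
have := @is_derive_expRB _ 0 (-1) t; rewrite subr0 !mulN1r.
by congr is_derive; apply/funext => u; rewrite subr0 mulN1r.
Qed.

Lemma sinh_ge (s : R) : 0 <= s -> 2 * s <= expR s - expR (- s).
Proof.
move=> s0; rewrite -subr_ge0.
have -> : 0 = expR 0 - expR (- 0) - 2 * 0 :> R by rewrite oppr0 subrr mulr0 subr0.
apply: (@is_derive_ge0_le (fun t => expR t - expR (- t) - 2 * t)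
  (fun t => expR t + expR (- t) - 2)) => // t.
- have h1 := is_derive_expR t; have h2 := is_derive_expRN t.
  have h3 := is_derive_linB 2 0 t.
  have -> : (fun t : R => expR t - expR (- t) - 2 * t) =
     expR - (fun t : R => expR (- t)) - (fun t => 2 * (t - 0)).
    by apply/funext => u; rewrite !fctE subr0.
  by apply: is_derive_eq; rewrite opprK.
- move=> _; have := @coshB_ge _ 1 0 t; rewrite /coshB subr0 mul1r mulN1r; lra.
Qed.

Lemma sinh_le (s : R) : 0 <= s -> expR s - expR (- s) <= s * (expR s + expR (- s)).
Proof.
move=> s0; rewrite -subr_ge0.
have -> : 0 = 0 * (expR 0 + expR (- 0)) - (expR 0 - expR (- 0)) :> R.
  by rewrite oppr0 subrr mul0r subr0.
apply: (@is_derive_ge0_le (fun t => t * (expR t + expR (- t)) - (expR t - expR (- t)))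
  (fun t => t * (expR t - expR (- t)))) => // t.
- have h1 := is_derive_expR t; have h2 := is_derive_expRN t.
  have -> : (fun t : R => t * (expR t + expR (- t)) - (expR t - expR (- t))) =
     id * (expR + (fun t : R => expR (- t))) - (expR - (fun t : R => expR (- t))).
    by apply/funext => u; rewrite !fctE.
  by apply: is_derive_eq; rewrite !fctE /GRing.scale/=; ring.
- move=> /andP[t0 _]; apply: mulr_ge0 => //; have := sinh_ge t0; lra.
Qed.

Definition pole (t : R) : R := Num.sqrt (t + t ^+ 2 / 4).
(** The value of the potential on the right circle, [ln ((X + a) / (X - a))], written with
    [(X + a) (X - a) = 1]. It is twice the inverse hyperbolic cosine of [X]. *)
Definition gap_height (t : R) : R := 2 * ln (1 + t / 2 + pole t).
(* For [a = pole t] the unit circles about [(X, 0)] and [(- X, 0)], [X = 1 + t / 2],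
   are level lines of this potential, as [a ^+ 2 = X ^+ 2 - 1]. *)
Definition gap_model (t : R) (q : R * R) : R :=
  ln (sqd q (- pole t, 0)) - ln (sqd q (pole t, 0)).

Variable t : R.
Hypothesis t0 : 0 < t.
Local Notation X := (1 + t / 2).
Local Notation a := (pole t).
Local Notation Lam := (gap_height t).

Lemma sqr_pole : a ^+ 2 = t + t ^+ 2 / 4.
Proof. by rewrite sqr_sqrtr// addr_ge0 ?divr_ge0 ?sqr_ge0// ltW. Qed.

Lemma pole_gt0 : 0 < a.
Proof. by rewrite sqrtr_gt0 ltr_wpDr// divr_ge0// sqr_ge0. Qed.

Lemma pole_lt : a < X.
Proof.
have h0 := t0; have h1 := pole_gt0; have h2 := sqr_pole.
by rewrite -ltr_sqr ?nnegrE; [nra|lra|lra].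
Qed.

Lemma pole_mul : (X + a) * (X - a) = 1.
Proof. by have h := sqr_pole; transitivity (X ^+ 2 - a ^+ 2); [ring|rewrite h; field]. Qed.

Lemma sqd_circles q :
  sqd q (X, 0) - 1 = q.1 ^+ 2 + q.2 ^+ 2 + a ^+ 2 - 2 * X * q.1 /\
  sqd q (- X, 0) - 1 = q.1 ^+ 2 + q.2 ^+ 2 + a ^+ 2 + 2 * X * q.1.
Proof. by rewrite sqr_pole /sqd /=; split; field. Qed.

Lemma half_height_gt0 : 0 < ln (X + a).
Proof.
have h0 := t0; have h1 := pole_gt0.
by rewrite ln_gt0//; lra.
Qed.

Lemma gap_height_gt0 : 0 < Lam.
Proof. by rewrite mulr_gt0// half_height_gt0. Qed.

Lemma ln_conj_pole : ln (X - a) = - ln (X + a).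
Proof.
have h0 := t0; have h1 := pole_gt0; have h2 := pole_lt.
have p1 : 0 < X + a by lra.
have p2 : 0 < X - a by lra.
have -> : X - a = (X + a)^-1.
  by apply: (mulfI (lt0r_neq0 p1)); rewrite pole_mul divff// gt_eqF.
by rewrite lnV ?posrE.
Qed.

(** For [s = ln (X + a)] one has [sinh s = a] and [cosh s = X], so this is
    [s <= sinh s <= s cosh s]. *)
Lemma gap_height_bounds : Lam <= 2 * a <= X * Lam.
Proof.
have h0 := t0; have h1 := pole_gt0; have h2 := pole_lt.
have p1 : 0 < X + a by lra.
have p2 : 0 < X - a by lra.
pose s := ln (X + a); have s0 : 0 <= s by exact: ltW half_height_gt0.
have e1 : expR s = X + a by rewrite lnK ?posrE.
have e2 : expR (- s) = X - a by rewrite -ln_conj_pole lnK ?posrE.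
have := sinh_ge s0; have := sinh_le s0; rewrite e1 e2 /gap_height -/s => g1 g2.
by apply/andP; split; lra.
Qed.

(** The pole lies inside its circle, because [X - a = 1 / (X + a) < 1]. *)
Lemma sqd_pole_gt0 q (r : R) : r = 1 \/ r = -1 -> 1 <= sqd q (r * X, 0) ->
  0 < sqd q (r * a, 0).
Proof.
move=> hr hq; rewrite lt_neqAle sqd_ge0 andbT; apply/negP => /eqP e.
have h0 := t0; have h1 := pole_gt0; have h2 := pole_lt.
have [e1 e2] : q.1 = r * a /\ q.2 = 0.
  have s1 := sqr_ge0 (q.1 - r * a); have s2 := sqr_ge0 q.2.
  rewrite /sqd /= subr0 in e.
  have z1 : (q.1 - r * a) ^+ 2 = 0 by lra.
  have z2 : q.2 ^+ 2 = 0 by lra.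
  split; last by apply/eqP; rewrite -sqrf_eq0; exact/eqP.
  by apply/eqP; rewrite -subr_eq0 -sqrf_eq0; exact/eqP.
have : (X - a) ^+ 2 < 1.
  have g1 := pole_mul; have g2 : 1 < X + a by lra.
  have g3 : 0 < X - a by lra.
  have g4 : X - a < 1 by nra.
  by nra.
rewrite /sqd /= e1 e2 in hq.
by case: hr => hr; rewrite hr in hq; nra.
Qed.

Lemma has_grad_lnsqd c q : 0 < sqd q c ->
  has_grad (fun q => ln (sqd q c)) q (2 * (q.1 - c.1) / sqd q c) (2 * (q.2 - c.2) / sqd q c).
Proof.
move=> s0; split; rewrite /sqd /=.
  have := @is_derive1_comp _ (@ln R) (fun u => (u - c.1) ^+ 2 + (q.2 - c.2) ^+ 2) q.1 _ _
    (is_derive1_ln s0) (is_derive_sqrBD c.1 ((q.2 - c.2) ^+ 2) q.1).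
  by rewrite mulrC.
have s0' : 0 < (q.2 - c.2) ^+ 2 + (q.1 - c.1) ^+ 2 by rewrite addrC.
have h := @is_derive1_comp _ (@ln R) (fun u => (u - c.2) ^+ 2 + (q.1 - c.1) ^+ 2) q.2 _ _
    (is_derive1_ln s0') (is_derive_sqrBD c.2 ((q.1 - c.1) ^+ 2) q.2).
have -> : (fun u => ln ((q.1 - c.1) ^+ 2 + (u - c.2) ^+ 2)) =
    @ln R \o (fun u => (u - c.2) ^+ 2 + (q.1 - c.1) ^+ 2).
  by apply/funext => u /=; rewrite addrC.
by apply: (is_derive_eq h); rewrite mulrC [X in _ / X = _]addrC.
Qed.

Section Outside.
Variable q : R * R.
Hypotheses (hR : 1 <= sqd q (X, 0)) (hL : 1 <= sqd q (- X, 0)).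

Lemma sqd_poles_gt0 : 0 < sqd q (a, 0) /\ 0 < sqd q (- a, 0).
Proof.
split.
  by have := @sqd_pole_gt0 q 1 (or_introl erefl); rewrite !mul1r; apply.
by have := @sqd_pole_gt0 q (-1) (or_intror erefl); rewrite !mulN1r; apply.
Qed.

Lemma gap_model_has_lap : has_lap (gap_model t) q 0.
Proof.
have [h1 h2] := sqd_poles_gt0.
have -> : 0 = 0 - 0 :> R by rewrite subr0.
by apply: has_lapB; exact: has_lap_lnsqd.
Qed.

Lemma gap_model_continuous : {for q, continuous (gap_model t)}.
Proof.
have [h1 h2] := sqd_poles_gt0.
have c1 : {for q, continuous (fun q => ln (sqd q (a, 0)))}.
  by apply: (@continuous_comp _ _ _ (fun q => sqd q (a, 0)) (@ln R));
    [exact: continuous_sqd|exact: continuous_ln].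
have c2 : {for q, continuous (fun q => ln (sqd q (- a, 0)))}.
  by apply: (@continuous_comp _ _ _ (fun q => sqd q (- a, 0)) (@ln R));
    [exact: continuous_sqd|exact: continuous_ln].
exact: (cvgB c2 c1).
Qed.

Local Notation F := (a ^+ 2 + q.2 ^+ 2 - q.1 ^+ 2).
Local Notation D := (F ^+ 2 + 4 * q.1 ^+ 2 * q.2 ^+ 2).

Lemma denominator_gt0 : 0 < D.
Proof.
have [h1 h2] := sqd_poles_gt0.
have -> : D = sqd q (- a, 0) * sqd q (a, 0) by rewrite /sqd /=; ring.
exact: mulr_gt0.
Qed.

(** The potential is the real part of [2 log ((a + z) / (a - z))], whose derivative is
    [4 a / (a^2 - z^2)]. [F] and [- 2 x y] are the real and imaginary parts of [a^2 - z^2], and [D]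
    is its squared modulus. *)
Lemma gap_model_has_grad :
  has_grad (gap_model t) q (4 * a * (F / D)) (- 4 * a * (2 * q.1 * q.2 / D)).
Proof.
have [h1 h2] := sqd_poles_gt0.
have DE : D = sqd q (- a, 0) * sqd q (a, 0) by rewrite /sqd /=; ring.
have frac (n m S1 S2 : R) : 0 < S1 -> 0 < S2 -> n / S1 - m / S2 = (n * S2 - m * S1) / (S1 * S2).
  by move=> s1 s2; field; rewrite !gt_eqF.
have -> : 4 * a * (F / D) = 2 * (q.1 - (- a)) / sqd q (- a, 0) - 2 * (q.1 - a) / sqd q (a, 0).
  by rewrite frac// DE mulrA; congr (_ / _); rewrite /sqd /=; ring.
have -> : - 4 * a * (2 * q.1 * q.2 / D) =
    2 * (q.2 - 0) / sqd q (- a, 0) - 2 * (q.2 - 0) / sqd q (a, 0).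
  by rewrite frac// DE mulrA; congr (_ / _); rewrite /sqd /=; ring.
by apply: has_gradB; exact: has_grad_lnsqd.
Qed.

(* [S = |q|^2 + a^2]: being outside the right disk means [2 X q.1 <= S], which is
   equivalent to [sqd q (-a,0) <= (X + a)^2 sqd q (a,0)]. *)
Lemma gap_model_bound : - Lam <= gap_model t q <= Lam.
Proof.
have [h1 h2] := sqd_poles_gt0.
have g0 := t0; have g1 := pole_gt0; have g2 := pole_lt; have g3 := pole_mul.
have sp := sqr_pole.
have p1 : 0 < X + a by lra.
have p2 : 0 < X - a by lra.
have LE : Lam = ln (X + a) - ln (X - a) by rewrite ln_conj_pole /gap_height; ring.
have r1 : (X - a) * sqd q (- a, 0) <= (X + a) * sqd q (a, 0).
  rewrite -subr_ge0; have -> : (X + a) * sqd q (a, 0) - (X - a) * sqd q (- a, 0) =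
    2 * a * (sqd q (X, 0) - 1) by rewrite (sqd_circles q).1 /sqd /=; ring.
  by apply: mulr_ge0; [lra|rewrite subr_ge0].
have r2 : (X - a) * sqd q (a, 0) <= (X + a) * sqd q (- a, 0).
  rewrite -subr_ge0; have -> : (X + a) * sqd q (- a, 0) - (X - a) * sqd q (a, 0) =
    2 * a * (sqd q (- X, 0) - 1) by rewrite (sqd_circles q).2 /sqd /=; ring.
  by apply: mulr_ge0; [lra|rewrite subr_ge0].
have ln1 : ln (X - a) + ln (sqd q (- a, 0)) <= ln (X + a) + ln (sqd q (a, 0)).
  by rewrite -!lnM ?posrE// ler_ln ?posrE// mulr_gt0.
have ln2 : ln (X - a) + ln (sqd q (a, 0)) <= ln (X + a) + ln (sqd q (- a, 0)).
  by rewrite -!lnM ?posrE// ler_ln ?posrE// mulr_gt0.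
by rewrite /gap_model LE; apply/andP; split; lra.
Qed.

End Outside.

Lemma gap_model_right q : sqd q (X, 0) = 1 -> 1 <= sqd q (- X, 0) -> gap_model t q = Lam.
Proof.
move=> e hL.
have [h1 h2] := @sqd_poles_gt0 q (eq_ind_r (fun x => 1 <= x) (lexx 1) e) hL.
have g0 := t0; have g1 := pole_gt0; have g2 := pole_lt.
have sp := sqr_pole.
have p1 : 0 < X + a by lra.
have p2 : 0 < X - a by lra.
have LE : Lam = ln (X + a) - ln (X - a) by rewrite ln_conj_pole /gap_height; ring.
have r1 : (X - a) * sqd q (- a, 0) = (X + a) * sqd q (a, 0).
  apply/eqP; rewrite -subr_eq0; have -> : (X - a) * sqd q (- a, 0) - (X + a) * sqd q (a, 0) =
    - (2 * a * (sqd q (X, 0) - 1)) by rewrite (sqd_circles q).1 /sqd /=; ring.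
  by rewrite e subrr mulr0 oppr0.
have : ln (X - a) + ln (sqd q (- a, 0)) = ln (X + a) + ln (sqd q (a, 0)).
  by rewrite -!lnM ?posrE// r1.
by rewrite /gap_model LE; lra.
Qed.

Lemma gap_model_left q : sqd q (- X, 0) = 1 -> 1 <= sqd q (X, 0) -> gap_model t q = - Lam.
Proof.
move=> e hR.
have := @gap_model_right (- q.1, q.2).
have -> : sqd (- q.1, q.2) (X, 0) = sqd q (- X, 0) by rewrite /sqd /=; ring.
have -> : sqd (- q.1, q.2) (- X, 0) = sqd q (X, 0) by rewrite /sqd /=; ring.
move=> /(_ e hR) <-; rewrite /gap_model opprB; congr (ln _ - ln _); rewrite /sqd /=; ring.
Qed.

(* On the right circle [F = 2 x (X - x)] and [D = 4 x^2]. *)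
Lemma gap_model_normal q : sqd q (X, 0) = 1 -> 0 < q.1 ->
  let F := a ^+ 2 + q.2 ^+ 2 - q.1 ^+ 2 in
  let D := F ^+ 2 + 4 * q.1 ^+ 2 * q.2 ^+ 2 in
  4 * a * (F / D) * (X - q.1) + - 4 * a * (2 * q.1 * q.2 / D) * (- q.2) = 2 * a / q.1.
Proof.
move=> e q0 F D; have sp := sqr_pole; rewrite /sqd /= subr0 in e.
have eF : F = 2 * q.1 * (X - q.1).
  have q2 : q.2 ^+ 2 = 1 - (q.1 - X) ^+ 2 by lra.
  by rewrite /F q2 sp; field.
have eD : D = 4 * q.1 ^+ 2.
  rewrite /D eF (_ : _ + _ = 4 * q.1 ^+ 2 * ((q.1 - X) ^+ 2 + q.2 ^+ 2)); last by ring.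
  by rewrite e mulr1.
rewrite eD eF.
transitivity (2 * a / q.1 * ((q.1 - X) ^+ 2 + q.2 ^+ 2)); last by rewrite e mulr1.
by field; rewrite gt_eqF.
Qed.

End GapModel.

(** * Expansion of the model gradient inside a gap *)

Section GapEstimates.
Context {R : realType}.

(** The cut-off [sqrt 3 / 2] keeps [s = sqrt (1 - y^2)] above [1 / 2], so
    [1 - s = y^2 / (1 + s) <= 2 / 3 y^2]. *)
Lemma gap_width (t x y : R) : 0 < t ->
  `|x| < 1 + t / 2 - Num.sqrt (1 - y ^+ 2) -> `|y| < Num.sqrt 3 / 2 ->
  [/\ y ^+ 2 < 3 / 4, `|x| <= 2 / 3 * (t + y ^+ 2),
      1 < sqd (x, y) (1 + t / 2, 0) & 1 < sqd (x, y) (- (1 + t / 2), 0)].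
Proof.
move=> t0 hx hy.
have s3 : Num.sqrt 3 ^+ 2 = 3 :> R by rewrite sqr_sqrtr.
have s30 : 0 <= Num.sqrt 3 :> R by exact: sqrtr_ge0.
have y34 : y ^+ 2 < 3 / 4.
  have := normr_ge0 y; have <- : `|y| ^+ 2 = y ^+ 2 by rewrite real_normK ?num_real.
  by nra.
move: hx; set s := Num.sqrt (1 - y ^+ 2) => hx.
have s0 : 0 <= s by exact: sqrtr_ge0.
have ss : s ^+ 2 = 1 - y ^+ 2 by rewrite sqr_sqrtr//; lra.
have s12 : 1 / 2 <= s by nra.
have s1 : 1 - s <= 2 / 3 * y ^+ 2 by nra.
move: hx; rewrite ltr_norml => /andP[x1 x2].
split => //.
- by rewrite ler_norml; apply/andP; split; lra.
- by rewrite /sqd /= subr0; nra.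
- by rewrite /sqd /= subr0; nra.
Qed.

Variables (t x y : R).
Hypotheses (t0 : 0 < t) (t1 : t <= 1 / 100) (y1 : y ^+ 2 < 3 / 4)
  (hx : `|x| <= 2 / 3 * (t + y ^+ 2)).
Local Notation h := (t + y ^+ 2).
Local Notation F := (pole t ^+ 2 + y ^+ 2 - x ^+ 2).
Local Notation D := (F ^+ 2 + 4 * x ^+ 2 * y ^+ 2).

Lemma gap_h : 0 < h < 77 / 100 /\ t <= h /\ y ^+ 2 <= h.
Proof.
have g0 := t0; have g1 := t1; have g2 := y1; have := sqr_ge0 y => g3.
by split; [apply/andP; split|split]; lra.
Qed.

Lemma gap_x : x ^+ 2 <= 4 / 9 * h ^+ 2.
Proof.
have := hx; have [/andP[h0 _] _] := gap_h.
by rewrite -[x ^+ 2](real_normK (num_real _)); have := normr_ge0 x; nra.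
Qed.

(** [h - F = x^2 - t^2 / 4], and both squares are of order [h^2] because [|x|] and [t] are of order
    [h]. *)
Lemma gap_F : `|h - F| <= 4 / 9 * h ^+ 2 /\ 13 / 20 * h <= F <= 27 / 20 * h.
Proof.
have g0 := t0; have gx := gap_x; have [/andP[h0 h1] [ht hy]] := gap_h.
have x0 := sqr_ge0 x; rewrite sqr_pole//.
have e : h - (t + t ^+ 2 / 4 + y ^+ 2 - x ^+ 2) = x ^+ 2 - t ^+ 2 / 4 by field.
have t2 : t ^+ 2 <= h ^+ 2 by nra.
have t20 := sqr_ge0 t.
have hh : h ^+ 2 <= 77 / 100 * h by nra.
have b : `|h - (t + t ^+ 2 / 4 + y ^+ 2 - x ^+ 2)| <= 4 / 9 * h ^+ 2.
  by rewrite e ler_norml; apply/andP; split; lra.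
split => //; move: b; rewrite ler_norml => /andP[b1 b2].
by apply/andP; split; lra.
Qed.

Lemma gap_D : 21 / 50 * h ^+ 2 <= D.
Proof.
have [/andP[h0 h1] _] := gap_h; have [_ /andP[f1 f2]] := gap_F.
have := sqr_ge0 x; have := sqr_ge0 y => yy xx.
have : 0 <= 4 * x ^+ 2 * y ^+ 2 by rewrite mulr_ge0// mulr_ge0.
by nra.
Qed.

Lemma gap_cross : 4 * x ^+ 2 * y ^+ 2 <= 16 / 9 * h ^+ 3.
Proof.
have [/andP[h0 h1] [_ hy]] := gap_h; have gx := gap_x.
have := ler_pM (sqr_ge0 x) (sqr_ge0 y) gx hy.
by rewrite exprSr; lra.
Qed.

Lemma gap_D_gt0 : 0 < D.
Proof.
have [/andP[h0 h1] _] := gap_h; apply: lt_le_trans gap_D.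
by rewrite mulr_gt0 ?exprn_gt0.
Qed.

(** Over the common denominator [D h], of order [h^3], the numerator is [F (h - F) - 4 x^2 y^2]: the
    leading terms have cancelled and only order [h^3] is left. *)
Lemma gap_main : `|F / D - h^-1| <= 6.
Proof.
have [/andP[h0 h1] _] := gap_h; have [f0 /andP[f1 f2]] := gap_F.
have d := gap_D; have d0 := gap_D_gt0; have cr := gap_cross.
have cr0 : 0 <= 4 * x ^+ 2 * y ^+ 2 by rewrite -mulrA mulr_ge0// mulr_ge0 ?sqr_ge0.
have -> : F / D - h^-1 = (F * (h - F) - 4 * x ^+ 2 * y ^+ 2) / (D * h).
  by field; rewrite !gt_eqF.
rewrite normf_div ler_pdivrMr ?normr_gt0 ?mulf_neq0 ?gt_eqF//.
rewrite (gtr0_norm (mulr_gt0 d0 h0)).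
have F0 : 0 < F by lra.
have n1 : `|F * (h - F)| <= 3 / 5 * h ^+ 3.
  rewrite normrM (gtr0_norm F0).
  have := ler_pM (ltW F0) (normr_ge0 _) f2 f0.
  have -> : 27 / 20 * h * (4 / 9 * h ^+ 2) = 3 / 5 * h ^+ 3 by field.
  by [].
apply: (le_trans (ler_normB _ _)); rewrite (ger0_norm cr0).
have h3 : 0 < h ^+ 3 by rewrite exprn_gt0.
have : 21 / 50 * h ^+ 3 <= D * h by rewrite exprSr mulrA ler_pM2r.
by lra.
Qed.

Lemma gap_xy : `|x * y| <= 2 / 3 * h * `|y|.
Proof. by rewrite normrM ler_wpM2r. Qed.

Lemma gap_y1 : `|y| <= 1.
Proof.
have := y1; rewrite -[y ^+ 2](real_normK (num_real _)); have := normr_ge0 y; nra.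
Qed.

(** The same cancellation, one order higher: the factor [x y = O(h)] brings the numerator to order
    [h^4], against [D h^2]. *)
Lemma gap_tangential : `|x * y / D - x * y / h ^+ 2| <= 5.
Proof.
have [/andP[h0 h1] _] := gap_h; have [f0 /andP[f1 f2]] := gap_F.
have d := gap_D; have d0 := gap_D_gt0; have cr := gap_cross.
have cr0 : 0 <= 4 * x ^+ 2 * y ^+ 2 by rewrite -mulrA mulr_ge0// mulr_ge0 ?sqr_ge0.
have -> : x * y / D - x * y / h ^+ 2 = (x * y) * ((h - F) * (h + F) - 4 * x ^+ 2 * y ^+ 2) / (D *
  h ^+ 2).
  by field; rewrite !gt_eqF.
have h2 : 0 < h ^+ 2 by rewrite exprn_gt0.
have h3 : 0 < h ^+ 3 by rewrite exprn_gt0.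
rewrite normf_div ler_pdivrMr ?normr_gt0 ?mulf_neq0 ?gt_eqF//.
rewrite (gtr0_norm (mulr_gt0 d0 h2)).
have hF : 0 < h + F by lra.
have n1 : `|(h - F) * (h + F) - 4 * x ^+ 2 * y ^+ 2| <= 3 * h ^+ 3.
  apply: (le_trans (ler_normB _ _)); rewrite (ger0_norm cr0) normrM (gtr0_norm hF).
  have hF2 : h + F <= 47 / 20 * h by lra.
  have := ler_pM (normr_ge0 _) (ltW hF) f0 hF2.
  have -> : 4 / 9 * h ^+ 2 * (47 / 20 * h) = 47 / 45 * h ^+ 3 by field.
  by lra.
have n2 : `|x * y| <= 2 / 3 * h by apply: le_trans gap_xy _; have := gap_y1; nra.
rewrite normrM; apply: (le_trans (ler_pM (normr_ge0 _) (normr_ge0 _) n2 n1)).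
have -> : 2 / 3 * h * (3 * h ^+ 3) = 2 * (h ^+ 2 * h ^+ 2) by field.
by rewrite [leLHS]mulrA [leRHS]mulrA ler_pM2r//; lra.
Qed.

(** For the vertical neck, where the tangential part goes into the remainder: [|y| / h] is at most
    of order [1 / sqrt t], which the smallness of [c0] compensates. *)
Lemma gap_tangential_le : `|x * y / D| <= 2 * `|y| / h.
Proof.
have [/andP[h0 h1] _] := gap_h; have d := gap_D; have d0 := gap_D_gt0.
rewrite normf_div (gtr0_norm d0) ler_pdivrMr// mulrAC ler_pdivlMr//.
apply: (@le_trans _ _ (2 / 3 * h * `|y| * h)); first by rewrite ler_pM2r// gap_xy.
have := normr_ge0 y => yy; have : 0 <= `|y| * (D - 21 / 50 * h ^+ 2) by rewrite mulr_ge0 ?subr_ge0.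
have yh : 0 <= `|y| * h ^+ 2 by rewrite mulr_ge0// sqr_ge0.
by nra.
Qed.

Lemma gap_model_tangential_le : `|x * y / h ^+ 2| <= `|y| / h.
Proof.
have [/andP[h0 h1] _] := gap_h.
have h2 : 0 < h ^+ 2 by rewrite exprn_gt0.
rewrite normf_div (gtr0_norm h2) ler_pdivrMr//.
have -> : `|y| / h * h ^+ 2 = h * `|y| by field; rewrite gt_eqF.
by apply: le_trans gap_xy _; have := normr_ge0 y; nra.
Qed.

End GapEstimates.

(** * Zero flux *)

Section CircleIntegral.
Context {R : realType}.
Local Notation mu := (@lebesgue_measure R).

Lemma sin_le_id (s : R) : 0 <= s -> sin s <= s.
Proof.
move=> s0; rewrite -subr_ge0.
have -> : 0 = 0 - sin 0 :> R by rewrite sin0 subrr.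
apply: (@is_derive_ge0_le _ (fun t => t - sin t) (fun t => 1 - cos t)) => //.
Qed.

Lemma cos_ge_quadratic (s : R) : 1 - s ^+ 2 / 2 <= cos s.
Proof.
wlog s0 : s / 0 <= s.
  move=> h; have [s0|s0] := leP 0 s; first exact: h.
  by rewrite -cosN -(sqrrN s); apply: h; rewrite oppr_ge0 ltW.
rewrite -subr_ge0.
have -> : 0 = cos 0 - (1 - (0 - 0) ^+ 2 / 2) :> R.
  by rewrite cos0 subrr expr0n/= mul0r subr0 subrr.
have -> : cos s - (1 - s ^+ 2 / 2) = cos s - (1 - (s - 0) ^+ 2 / 2) by rewrite subr0.
apply: (@is_derive_ge0_le _ (fun t => cos t - (1 - (t - 0) ^+ 2 / 2)) (fun t => t - sin t)) => // t.
- have h1 := is_derive_cos t; have h2 := is_derive_sqrB 0 t.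
  have -> : (fun t : R => cos t - (1 - (t - 0) ^+ 2 / 2)) =
    cos - (cst 1 - 2^-1 *: (fun t : R => (t - 0) ^+ 2)).
    by apply/funext => u; rewrite !fctE /GRing.scale/= mulrC.
  by apply: is_derive_eq; rewrite /GRing.scale/= subr0; field.
- by move=> /andP[t0 _]; rewrite subr_ge0; exact: sin_le_id.
Qed.

Lemma pi_bounds : 2 <= (pi : R) <= 4.
Proof.
have [/andP[_ h] _] := pihalf_02_cos_pihalf R.
by apply/andP; split; [exact: pi_ge2|lra].
Qed.

Lemma integral_reflect (f : R -> R) (b : R) : 0 <= b ->
  {within `[0, b], continuous f} ->
  (\int[mu]_(t in `[0%R, b]) (f t)%:E = \int[mu]_(t in `[0%R, b]) (f (b - t)%R)%:E)%E.
Proof.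
move=> b0 cf.
have dF (t : R) : is_derive t 1 (fun t => b - t) (-1).
  have := is_derive_affine (-1) b t; congr is_derive.
  by apply/funext => u; rewrite mulN1r addrC.
have DF : (fun t : R => b - t)^`()%classic = cst (-1).
  by apply/funext => t; exact: derive1_is_derive (dF t).
have cF (t : R) : {for t, continuous (fun t => b - t)}.
  by apply: cvgB; [exact: cvg_cst|exact: cvg_id].
have := @integration_by_substitution_decreasing R (fun t => b - t) f 0 b b0.
rewrite subrr subr0 => -> //.
- by apply: eq_integral => t _; rewrite DF !fctE opprK mulr1.
- by move=> x y _ _ xy; rewrite ltrD2l ltrN2.
- by rewrite DF => ? _; exact: cvg_cst.
- by rewrite DF; exact: is_cvg_cst.
- by rewrite DF; exact: is_cvg_cst.
- split.
  + by move=> t _; case: (dF t).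
  + by have := @cvg_at_right_filter _ _ _ _ _ (cF 0); rewrite subr0.
  + by have := @cvg_at_left_filter _ _ _ _ _ (cF b); rewrite subrr.
Qed.

(* The part of [f] symmetric about [pi] also has integral [0]. *)
Lemma peak_bound (f : R -> R) (tau kappa B : R) :
  {within `[0, 2 * pi], continuous f} ->
  (\int[mu]_(t in `[0%R, (2 * pi)%R]) (f t)%:E = 0)%E ->
  0 < tau <= 1 -> 0 <= kappa ->
  (forall t, 0 <= t <= 2 * pi -> - B <= f t + f (2 * pi - t)) ->
  (forall t, `|t - pi| <= tau -> kappa - B <= f t + f (2 * pi - t)) ->
  2 * tau * kappa <= 2 * pi * B.
Proof.
move=> cf f0 /andP[tau0 tau1] k0 hB hk.
have /andP[pi2 pi4] := pi_bounds.
have p0 : 0 <= 2 * (pi : R) by lra.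
pose I0 : set R := `[0, 2 * pi]%classic.
have mI : measurable (I0 : set (measurableTypeR R)) by exact: measurable_itv.
have cpt : compact I0 by exact: segment_compact.
pose fr t := f (2 * pi - t).
have cfr : {within I0, continuous fr}.
  apply/subspace_continuousP => t; rewrite /I0/= in_itv/= => /andP[t1 t2].
  move/subspace_continuousP : cf => /(_ (2 * pi - t)).
  rewrite /= in_itv/= => cf; have {}cf := cf ltac:(by apply/andP; split; lra).
  have cF : {for t, continuous (fun t => 2 * pi - t)}.
    by apply: cvgB; [exact: cvg_cst|exact: cvg_id].
  move=> U /cf nU.
  have n1 : \forall s \near (2 * pi - t), I0 s -> U (f s) by exact: nU.
  have n2 : \forall s \near t, I0 (2 * pi - s) -> U (f (2 * pi - s)) by exact: (cF _ n1).
  apply: filterS n2 => s hs; rewrite /= in_itv/= => /andP[s1 s2]; apply: hs.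
  by rewrite /I0/= in_itv/=; apply/andP; split; lra.
have i1 := continuous_compact_integrable cpt cf.
have i2 := continuous_compact_integrable cpt cfr.
have i3 : mu.-integrable I0 (EFin \o cst B).
  by apply: continuous_compact_integrable => // t; exact: cvg_cst.
(* [phi] is nonnegative with integral [2 pi B] and at least [kappa] on an interval of length [2 tau]
   around [pi]. *)
pose phi t := f t + fr t + B.
have cphi : {within I0, continuous phi}.
  by move=> t; apply: cvgD; [apply: cvgD; [exact: cf|exact: cfr]|exact: cvg_cst].
have mucc (x y : R) : x < y -> mu `[x, y] = (y - x)%:E.
  by move=> xy; have := lebesgue_measure_itv `[x, y]; rewrite /= lte_fin xy.
have muI : mu I0 = (2 * pi)%:E by rewrite /I0 mucc ?subr0//; lra.
have intphi : (\int[mu]_(t in I0) (phi t)%:E = (2 * pi * B)%:E)%E.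
  have -> : (fun t => (phi t)%:E) = (fun t => ((f t)%:E + (fr t)%:E + (cst B t)%:E)%E) by [].
  rewrite integralD//; last exact: integrableD.
  rewrite integralD// -/I0 /I0 f0 -(integral_reflect p0 cf) f0 !add0e.
  transitivity (B%:E * mu I0)%E; first exact: (@integral_cst _ _ _ mu I0 mI B%:E).
  by rewrite muI -EFinM mulrC.
pose J : set R := `[pi - tau, pi + tau]%classic.
have mJ : measurable (J : set (measurableTypeR R)) by exact: measurable_itv.
have JI : J `<=` I0.
  by move=> t; rewrite /J /I0/= !in_itv/= => /andP[h1 h2]; apply/andP; split; lra.
have mphi : measurable_fun (I0 : set (measurableTypeR R)) (fun t => (phi t)%:E).
  apply/measurable_EFinP; exact: subspace_continuous_measurable_fun.
have le1 : (\int[mu]_(t in J) (cst kappa%:E) t <= \int[mu]_(t in I0) (phi t)%:E)%E.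
  apply: (@le_trans _ _ (\int[mu]_(t in J) (phi t)%:E)%E).
    apply: ge0_le_integral => //.
    - exact: measurable_funS mphi.
    - move=> t; rewrite /J/= in_itv/= => /andP[h1 h2]; rewrite lee_fin.
      have := hk t; rewrite ler_norml => h; have := h ltac:(by apply/andP; split; lra).
      by rewrite /phi /fr; lra.
  apply: ge0_subset_integral => //.
  move=> t; rewrite /I0/= in_itv/= => h; rewrite lee_fin.
  by have := hB t h; rewrite /phi /fr; lra.
have muJ : mu J = (2 * tau)%:E.
  by rewrite /J mucc; [congr EFin; ring|lra].
have intJ : (\int[mu]_(t in J) (cst kappa%:E) t = (2 * tau * kappa)%:E)%E.
  transitivity (kappa%:E * mu J)%E; first exact: (@integral_cst _ _ _ mu J mJ).
  by rewrite muJ -EFinM mulrC.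
by rewrite intJ intphi lee_fin in le1.
Qed.

End CircleIntegral.

(** * Gradients near the gaps *)

Section Patches.
Context {R : realType}.
Variables (eps delta : R).
Hypotheses (eps0 : 0 < eps) (eps1 : eps <= 1 / 100) (delta0 : 0 < delta)
  (delta1 : delta <= 1 / 100).
Local Notation L := (2 + delta).
Local Notation l := (1 + delta / 2).
Local Notation E := (ext eps delta).
Local Notation X := (1 + eps / 2).
Implicit Types (p q c P : R * R) (s : seq (R * R)).

(* [2040] comes from [local_dirichlet_grad], applied in boxes of half-width [1 / 16]. *)
Definition grad_const : R := 2040 / (1 / 16) ^+ 2.

Lemma grad_const_gt0 : 0 < grad_const.
Proof. by apply: divr_gt0; [lra|rewrite exprn_gt0//; lra]. Qed.

Lemma cR0E : cR eps delta 0 = (X, 0). Proof. by rewrite /cR mul0r. Qed.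

Lemma cL0E : cL eps delta 0 = (- X, 0).
Proof. by rewrite /cL mul0r opprD. Qed.

(** Transfers the local estimate to [ext]: the disks not listed in [s] stay away from the box, so
    there [ext] is just the outside of the listed disks. *)
Lemma patch_grad s P (v : R * R -> R) (A : R) :
  (forall c, c \in s -> disk_center eps delta c) ->
  (forall q, box P (1 / 16) q -> forall c, disk_center eps delta c -> c \in s \/ 1 < sqd q c) ->
  (forall q, box P (1 / 16) q -> E q -> has_lap v q 0) ->
  (forall q, box P (1 / 16) q -> closure E q -> v @ within (closure E) (nbhs q) --> v q) ->
  (forall q, box P (1 / 16) q -> closure E q -> `|v q| <= A) ->
  (forall q c, box P (1 / 16) q -> closure E q -> c \in s -> sqd q c = 1 -> v q = 0) ->
  0 < A -> E P -> `|dx v P| <= grad_const * A /\ `|dy v P| <= grad_const * A.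
Proof.
move=> sc far Lv cv bv v0 A0 EP.
have toE q : box P (1 / 16) q -> outside s q -> E q.
  move=> bq oq; apply/(extP eps0 delta0) => c cc.
  by have [cs|//] := far q bq c cc; exact: oq.
have toclE q : box P (1 / 16) q -> outside_cl s q -> closure E q.
  move=> bq oq; apply/(closure_extP eps0 delta0) => c cc.
  by have [cs|/ltW//] := far q bq c cc; exact: oq.
have r1 : 0 < (1 / 16 : R) <= 1 / 4 by apply/andP; split; lra.
have eA : grad_const * A = 2040 * A / (1 / 16) ^+ 2 by rewrite /grad_const mulrAC.
rewrite eA; apply: (@local_dirichlet_grad _ s P (1 / 16) A v) => //.
  split.
  - by move=> q bq oq; apply: Lv => //; exact: toE.
  - apply: withinI => q [bq oq].
    by apply: within_subset_cvg (cv q bq (toclE q bq oq)) => z [bz oz]; exact: toclE.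
  - by move=> q bq oq; apply: bv => //; exact: toclE.
  - by move=> q c bq oq cs e; apply: (v0 q c) => //; exact: toclE.
by move=> c cs; exact: (iffLR (extP eps0 delta0 P) EP _ (sc _ cs)).
Qed.

Lemma far_row q (n : int) c : disk_center eps delta c -> c.2 = n%:~R * L ->
  1 < `|q.2 - n%:~R * L| -> 1 < sqd q c.
Proof.
move=> _ c2 h; rewrite /sqd c2.
have : 1 < (q.2 - n%:~R * L) ^+ 2 by rewrite -(real_normK (num_real _)); nra.
by have := sqr_ge0 (q.1 - c.1); lra.
Qed.

Lemma outer_row_far q (n : int) c : disk_center eps delta c -> c.2 = n%:~R * L ->
  n != 0 -> n != 1 -> 1 / 3 < q.2 < 17 / 10 -> 1 < sqd q c.
Proof.
move=> cc c2 n0 n1 /andP[q2 q2']; have d0 := delta0; have d1 := delta1.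
apply: (far_row cc c2); have [nn|nn] := ltP n 0.
  have : (n%:~R : R) <= -1.
    by rewrite (_ : -1 = (-1)%:~R) // ler_int; move: nn; clear; case: n => //.
  by move=> h; rewrite ger0_norm; nra.
have : (2 : R) <= n%:~R.
  by rewrite (_ : 2 = 2%:~R) // ler_int; move: n0 n1 nn; clear; case: n => [[|[|n]]|n].
by move=> h; rewrite ler0_norm; nra.
Qed.

(** * Gradient bounds for [U], which stands for [u] or for its even part *)

Section CellFunction.
Variables (U Ux Uy : R * R -> R) (kL kR K : R).
Local Notation m0 := ((kL + kR) / 2).
Local Notation c0 := ((kR - kL) / 2).
Hypothesis ULap : forall q, E q -> has_lap U q 0.
Hypothesis Ugrad : forall q, E q -> has_grad U q (Ux q) (Uy q).
Hypothesis Ucont : {within closure E, continuous U}.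
Hypothesis Ubound : forall q, closure E q -> `|q.1| < 4 -> `|q.2| <= 3 * l ->
  `|U q - m0| <= K.
Hypothesis UR : forall q, sqd q (cR eps delta 0) = 1 -> U q = kR.
Hypothesis K0 : 0 < K.
Hypothesis c0K : `|c0| <= K.

Section Neck.
Hypothesis UL : forall q, sqd q (cL eps delta 0) = 1 -> U q = kL.
Local Notation Lam := (gap_height eps).
Local Notation a := (pole eps).

Lemma outside_circles q : closure E q -> 1 <= sqd q (X, 0) /\ 1 <= sqd q (- X, 0).
Proof.
move=> /(closure_extP eps0 delta0) h.
by split; [rewrite -cR0E; apply: h; exact: disk_centerR|rewrite -cL0E; apply: h;
  exact: disk_centerL].
Qed.

Lemma neck_grad P : E P -> `|P.1| <= 11 / 20 -> `|P.2| <= 9 / 10 ->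
  let F := a ^+ 2 + P.2 ^+ 2 - P.1 ^+ 2 in
  let D := F ^+ 2 + 4 * P.1 ^+ 2 * P.2 ^+ 2 in
  `|Ux P - c0 / Lam * (4 * a * (F / D))| <= grad_const * (2 * K) /\
  `|Uy P - c0 / Lam * (- 4 * a * (2 * P.1 * P.2 / D))| <= grad_const * (2 * K).
Proof.
move=> EP P1 P2 F D.
have e1 := eps1; have d0 := delta0; have e0 := eps0; have k0 := K0.
pose v q := U q - (m0 + c0 / Lam * gap_model eps q).
have clP := subset_closure EP.
have vg : has_grad v P (Ux P - (0 + c0 / Lam * (4 * a * (F / D))))
    (Uy P - (0 + c0 / Lam * (- 4 * a * (2 * P.1 * P.2 / D)))).
  apply: has_gradB; first exact: Ugrad.
  apply: has_gradD; first exact: has_grad_cst.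
  have [h1 h2] := outside_circles clP.
  by apply: has_gradZ; exact: gap_model_has_grad.
rewrite -[c0 / Lam * _]add0r -[c0 / Lam * (- 4 * a * _)]add0r.
rewrite -(has_grad_dx vg) -(has_grad_dy vg).
(* As [9 / 10 + 1 / 16 < 1], the box stays below height 1 and meets disks of row 0 only. *)
have bq q : box P (1 / 16) q -> `|q.1| < 4 /\ `|q.2| < 1.
  move=> [b1 b2]; have := ler_normD (q.1 - P.1) P.1; have := ler_normD (q.2 - P.2) P.2.
  by rewrite !subrK => h1 h2; split; lra.
have Lp : 0 < Lam by exact: gap_height_gt0.
apply: (@patch_grad [:: cR eps delta 0; cL eps delta 0]) => //.
- move=> c; rewrite !inE => /orP[]/eqP ->; [exact: disk_centerR|exact: disk_centerL].
- move=> q /bq[_ q2] c [n hc].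
  have [n0|n0] := eqVneq n 0.
    by left; rewrite !inE; case: hc => ->; rewrite n0 eqxx ?orbT.
  right; have c2 : c.2 = n%:~R * L by case: hc => ->.
  rewrite /sqd c2; have : 1 < (q.2 - n%:~R * L) ^+ 2.
    apply: (@other_row _ delta _ q.2 0 n) => //; first by rewrite eq_sym.
    by rewrite mul0r subr0; lra.
  by have := sqr_ge0 (q.1 - c.1); lra.
- move=> q _ Eq; have [h1 h2] := outside_circles (subset_closure Eq).
  have -> : 0 = 0 - (0 + c0 / Lam * 0) :> R by rewrite mulr0 addr0 subr0.
  apply: has_lapB; first exact: ULap.
  apply: has_lapD; first exact: has_lap_cst.
  by apply: has_lapZ; exact: gap_model_has_lap.
- move=> q _ Eq; have [h1 h2] := outside_circles Eq.
  have ch : {for q, continuous (fun q => m0 + c0 / Lam * gap_model eps q)}.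
    apply: cvgD; first exact: cvg_cst.
    by apply: cvgM; [exact: cvg_cst|exact: gap_model_continuous].
  by apply: cvgB; [exact: (withinP Ucont)|apply: cvg_within_filter; exact: ch].
- move=> q /bq[q1 q2] Eq; have [h1 h2] := outside_circles Eq.
  have Ub := Ubound Eq q1 ltac:(lra).
  rewrite /v opprD addrA; apply: (le_trans (ler_normB _ _)).
  have : `|c0 / Lam * gap_model eps q| <= `|c0|.
    rewrite mulrAC normrM normfV (gtr0_norm Lp) ler_pdivrMr// normrM ler_wpM2l//.
    by rewrite ler_norml; exact: gap_model_bound.
  by have := c0K; lra.
- move=> q c _ Eq; rewrite !inE => /orP[]/eqP -> e; have [h1 h2] := outside_circles Eq.
    by rewrite /v UR// gap_model_right -?cR0E// divfK ?gt_eqF//; field.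
  by rewrite /v UL// gap_model_left -?cL0E// mulrN divfK ?gt_eqF//; field.
- by lra.
Qed.

End Neck.

Section Right.
Hypothesis URn : forall n q, sqd q (cR eps delta n) = 1 -> U q = kR.

(** When all right disks carry the same constant, [U - kR] vanishes on each of them and no model has
    to be subtracted, even in the horizontal gaps. [P.1 >= 1 / 4] keeps the box away from the left
    disks. *)
Lemma right_grad P : E P -> 1 / 4 <= P.1 <= 3 -> `|P.2| <= 3 / 2 ->
  `|Ux P| <= grad_const * (2 * K) /\ `|Uy P| <= grad_const * (2 * K).
Proof.
move=> EP /andP[P1 P1'] P2.
have e1 := eps1; have d0 := delta0; have e0 := eps0; have k0 := K0.
pose v q := U q - kR.
have vg : has_grad v P (Ux P - 0) (Uy P - 0).
  by apply: has_gradB; [exact: Ugrad|exact: has_grad_cst].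
rewrite -[Ux P]subr0 -[Uy P]subr0 -(has_grad_dx vg) -(has_grad_dy vg).
have bq q : box P (1 / 16) q -> 0 < q.1 < 4 /\ `|q.2| < 8 / 5.
  move=> [b1 b2]; have := ler_normD (q.2 - P.2) P.2; rewrite subrK.
  by move: b1; rewrite ler_norml => /andP[? ?] h; split; [apply/andP; split|]; lra.
apply: (@patch_grad [:: cR eps delta 0; cR eps delta 1; cR eps delta (-1)]) => //.
- by move=> c; rewrite !inE => /or3P[]/eqP ->; exact: disk_centerR.
- move=> q /bq[/andP[q1 q1'] q2] c [n [->|hc]].
    by right; rewrite /sqd /=; have := sqr_ge0 (q.2 - n%:~R * L); nra.
  have [n0|n0] := eqVneq n 0; first by left; rewrite !inE hc n0 eqxx.
  have [n1|n1] := eqVneq n 1; first by left; rewrite !inE hc n1 eqxx orbT.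
  have [n2|n2] := eqVneq n (-1); first by left; rewrite !inE hc n2 eqxx !orbT.
  right; apply: (@far_row q n c); [by exists n; right|by rewrite hc|].
  have : 2 <= `|n%:~R : R|.
    rewrite -intr_norm (_ : 2 = 2%:~R) // ler_int.
    by move: n0 n1 n2; clear; case: n => [[|[|n]]|[|n]].
  move=> nn; have := lerB_dist (n%:~R * L) q.2; rewrite distrC normrM.
  have -> : `|L| = L by rewrite ger0_norm; lra.
  by nra.
- move=> q _ Eq; have -> : 0 = 0 - 0 :> R by rewrite subr0.
  by apply: has_lapB; [exact: ULap|exact: has_lap_cst].
- move=> q _ Eq; apply: cvgB; first exact: (withinP Ucont).
  exact: cvg_cst.
- move=> q /bq[/andP[q1 q1'] q2] Eq.
  have Ub := Ubound Eq ltac:(rewrite gtr0_norm//) ltac:(lra).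
  have -> : v q = (U q - m0) - c0 by rewrite /v; field.
  by apply: (le_trans (ler_normB _ _)); have := c0K; lra.
- move=> q c _ Eq; rewrite !inE => /or3P[]/eqP -> /URn e; by rewrite /v e subrr.
- by lra.
Qed.

End Right.

Section VerticalGap.
Variable J : R.
Hypothesis JK : `|J| <= K.
Hypothesis UR1 : forall q, sqd q (cR eps delta 1) = 1 -> U q = kR + J.
Local Notation Lam := (gap_height delta).
Local Notation a := (pole delta).
Local Notation Y := (1 + delta / 2).

(** The model with the coordinates exchanged and the origin moved to the middle of the gap between
    the right disks of rows 0 and 1. *)
Let turned : R * R -> R := fun q => gap_model delta (1 * q.2 + - Y, 1 * q.1 + - X).

Lemma vertical_gap_grad P : E P -> 1 / 8 <= P.1 <= 3 -> 2 / 5 <= P.2 <= 8 / 5 ->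
  let x := P.1 - X in let y := P.2 - Y in
  let F := a ^+ 2 + x ^+ 2 - y ^+ 2 in
  let D := F ^+ 2 + 4 * y ^+ 2 * x ^+ 2 in
  `|Uy P - J / (2 * Lam) * (4 * a * (F / D))| <= grad_const * (3 * K) /\
  `|Ux P - J / (2 * Lam) * (- 4 * a * (2 * y * x / D))| <= grad_const * (3 * K).
Proof.
move=> EP /andP[P1 P1'] /andP[P2 P2'] x y F D.
have e1 := eps1; have d0 := delta0; have e0 := eps0; have k0 := K0.
have d1 := delta1.
(* On the two circles [turned] is [- Lam] and [Lam], so the subtracted function takes the values
   [kR] and [kR + J]. *)
pose v q := U q - (kR + J / 2 + J / (2 * Lam) * turned q).
have Lp : 0 < Lam by exact: gap_height_gt0.
have circ q : closure E q -> 1 <= sqd (1 * q.2 + - Y, 1 * q.1 + - X) (Y, 0) /\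
    1 <= sqd (1 * q.2 + - Y, 1 * q.1 + - X) (- Y, 0).
  move=> /(closure_extP eps0 delta0) h.
  have := h _ (disk_centerR eps delta 1); have := h _ (disk_centerR eps delta 0).
  rewrite /sqd /= !mul1r mul0r => h0 h1; split.
    by apply: le_trans h1 _; rewrite le_eqVlt; apply/orP; left; apply/eqP; field.
  by apply: le_trans h0 _; rewrite le_eqVlt; apply/orP; left; apply/eqP; field.
have clP := subset_closure EP.
have vg : has_grad v P (Ux P - (0 + J / (2 * Lam) * (1 * (- 4 * a * (2 * y * x / D)))))
    (Uy P - (0 + J / (2 * Lam) * (1 * (4 * a * (F / D))))).
  apply: has_gradB; first exact: Ugrad.
  apply: has_gradD; first exact: has_grad_cst.
  apply: has_gradZ.
  have [h1 h2] := circ _ clP.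
  have := gap_model_has_grad delta0 h1 h2.
  rewrite /= !mul1r -/x -/y -/F -/D => -[g1 g2].
  have := @has_grad_refl _ (fun q => gap_model delta (q.2, q.1)) P 1 (- X) 1 (- Y)
    (- 4 * a * (2 * y * x / D)) (4 * a * (F / D)).
  by rewrite !mul1r; apply; split.
rewrite !mul1r !add0r in vg.
rewrite -(has_grad_dx vg) -(has_grad_dy vg).
suff [s1 s2] : `|dx v P| <= grad_const * (3 * K) /\ `|dy v P| <= grad_const * (3 * K) by [].
have bq q : box P (1 / 16) q -> 0 < q.1 < 4 /\ 1 / 3 < q.2 < 17 / 10.
  move=> [b1 b2]; move: b1 b2; rewrite !ler_norml => /andP[? ?] /andP[? ?].
  by split; apply/andP; split; lra.
apply: (@patch_grad [:: cR eps delta 0; cR eps delta 1]) => //.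
- by move=> c; rewrite !inE => /orP[]/eqP ->; exact: disk_centerR.
- move=> q /bq[/andP[q1 q1'] /andP[q2 q2']] c [n [->|hc]].
    by right; rewrite /sqd /=; have := sqr_ge0 (q.2 - n%:~R * L); nra.
  have [n0|n0] := eqVneq n 0; first by left; rewrite !inE hc n0 eqxx.
  have [n1|n1] := eqVneq n 1; first by left; rewrite !inE hc n1 eqxx orbT.
  right; apply: (@outer_row_far q n c) => //; first by exists n; right.
    by rewrite hc.
  by apply/andP; split.
- move=> q _ Eq; have [h1 h2] := circ _ (subset_closure Eq).
  have -> : 0 = 0 - (0 + J / (2 * Lam) * 0) :> R by rewrite mulr0 addr0 subr0.
  apply: has_lapB; first exact: ULap.
  apply: has_lapD; first exact: has_lap_cst.
  apply: has_lapZ.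
  apply: (@has_lap_refl _ (fun q => gap_model delta (q.2, q.1)) q 1 (- X) 1 (- Y));
    rewrite ?expr1n//.
  by apply: has_lap_swap; exact: gap_model_has_lap.
- move=> q _ Eq; have [h1 h2] := circ _ Eq.
  have ch : {for q, continuous (fun q => kR + J / 2 + J / (2 * Lam) * turned q)}.
    apply: cvgD; first exact: cvg_cst.
    apply: cvgM; first exact: cvg_cst.
    apply: (@continuous_comp _ _ _ (fun q : R * R => (1 * q.2 + - Y, 1 * q.1 + - X))
      (gap_model delta)); last exact: gap_model_continuous.
    have h3 : 1 * z.2 + - Y @[z --> q] --> 1 * q.2 + - Y.
      by apply: cvgD; [apply: cvgM; [exact: cvg_cst|exact: continuous_snd]|exact: cvg_cst].
    have h4 : 1 * z.1 + - X @[z --> q] --> 1 * q.1 + - X.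
      by apply: cvgD; [apply: cvgM; [exact: cvg_cst|exact: continuous_fst]|exact: cvg_cst].
    exact: (cvg_pair h3 h4).
  by apply: cvgB; [exact: (withinP Ucont)|apply: cvg_within_filter; exact: ch].
- move=> q /bq[/andP[q1 q1'] /andP[q2 q2']] Eq; have [h1 h2] := circ _ Eq.
  have Ub := Ubound Eq ltac:(rewrite gtr0_norm//) ltac:(rewrite gtr0_norm; lra).
  have -> : v q = (U q - m0) - (c0 + (J / 2 + J / (2 * Lam) * turned q)) by rewrite /v;
    move: (J / (2 * Lam) * turned q) => z; field.
  apply: (le_trans (ler_normB _ _)).
  have n1 := ler_normD c0 (J / 2 + J / (2 * Lam) * turned q).
  have n2 := ler_normD (J / 2) (J / (2 * Lam) * turned q).
  have n3 : `|J / (2 * Lam) * turned q| <= `|J| / 2.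
    have L2 : 0 < 2 * Lam by rewrite mulr_gt0.
    rewrite mulrAC normrM normfV (gtr0_norm L2) ler_pdivrMr// normrM.
    have -> : `|J| / 2 * (2 * Lam) = `|J| * Lam by field.
    by rewrite ler_wpM2l// ler_norml; exact: gap_model_bound.
  have n4 : `|J / 2| = `|J| / 2 by rewrite normrM (gtr0_norm (_ : 0 < 2^-1)) ?invr_gt0.
  by have := c0K; have := JK; lra.
- move=> q c _ Eq; rewrite !inE => /orP[]/eqP -> e; have [h1 h2] := circ _ Eq.
    have e' : sqd (1 * q.2 + - Y, 1 * q.1 + - X) (- Y, 0) = 1.
      by rewrite -[RHS]e /sqd /= !mul1r mul0r; field.
    by rewrite /v UR// /turned gap_model_left//; field; exact: lt0r_neq0.
  have e' : sqd (1 * q.2 + - Y, 1 * q.1 + - X) (Y, 0) = 1.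
    by rewrite -[RHS]e /sqd /= !mul1r; field.
  by rewrite /v UR1// /turned gap_model_right//; field; exact: lt0r_neq0.
- by lra.
Qed.

End VerticalGap.
End CellFunction.
End Patches.

(** * The difference of the boundary constants *)

Section Reflection.
Context {R : realType}.
Variables (eps delta : R).
Hypotheses (eps0 : 0 < eps) (delta0 : 0 < delta).
Local Notation E := (ext eps delta).
Implicit Types (p q c : R * R).

(* In the affine form required by [has_lap_refl] and [has_grad_refl]. *)
Definition flip p : R * R := (1 * p.1 + 0, -1 * p.2 + 0).

Lemma flipE p : flip p = (p.1, - p.2).
Proof. by rewrite /flip mul1r mulN1r !addr0. Qed.

Lemma sqd_flip p c : sqd (flip p) c = sqd p (flip c).
Proof. by rewrite !flipE /sqd /=; ring. Qed.

Lemma flip_cR n : flip (cR eps delta n) = cR eps delta (- n).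
Proof. by rewrite flipE /cR /= rmorphN /= mulNr. Qed.

Lemma flip_cL n : flip (cL eps delta n) = cL eps delta (- n).
Proof. by rewrite flipE /cL /= rmorphN /= mulNr. Qed.

Lemma disk_center_flip c : disk_center eps delta c -> disk_center eps delta (flip c).
Proof.
by move=> [n [->|->]]; exists (- n); [left; exact: flip_cL|right; exact: flip_cR].
Qed.

Lemma ext_flip p : E p -> E (flip p).
Proof.
move=> /(extP eps0 delta0) h; apply/(extP eps0 delta0) => c cc.
by rewrite sqd_flip; apply: h; exact: disk_center_flip.
Qed.

Lemma closure_ext_flip p : closure E p -> closure E (flip p).
Proof.
move=> /(closure_extP eps0 delta0) h; apply/(closure_extP eps0 delta0) => c cc.
by rewrite sqd_flip; apply: h; exact: disk_center_flip.
Qed.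

Lemma continuous_flip p : {for p, continuous flip}.
Proof.
have := @continuous_scale2 R 1 (-1) p.
rewrite (_ : (fun q : R * R => _) = flip)//.
by apply/funext => q; rewrite /flip !addr0.
Qed.

Lemma within_flip f p : closure E p -> {within closure E, continuous f} ->
  (fun q => f (flip q)) @ within (closure E) (nbhs p) --> (f (flip p) : R).
Proof.
move=> Ep cf; apply: within_comp; first exact: continuous_flip.
  exact: closure_ext_flip.
by apply: (withinP cf); exact: closure_ext_flip.
Qed.

End Reflection.

Section FluxBound.
Context {R : realType}.
Variables (eps delta : R) (H u : R * R -> R).
Hypotheses (eps0 : 0 < eps) (eps1 : eps <= 1 / 100) (delta0 : 0 < delta)
  (delta1 : delta <= 1 / 100).
Hypothesis harmH : harmonic_on setT H.
Hypothesis perH : forall p, grad H p = grad H (p.1, p.2 + (2 + delta)).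
Hypothesis sol : is_solution eps delta H u.
Variables kL kR : R.
Hypothesis uL : forall p, circle (cL eps delta 0) p -> u p = kL.
Hypothesis uR : forall p, circle (cR eps delta 0) p -> u p = kR.
Variable M : R.
Hypothesis M0 : 0 < M.
Hypothesis HM : forall p, Omega_m delta 4 p -> `|H p| <= M.
Local Notation L := (2 + delta).
Local Notation l := (1 + delta / 2).
Local Notation E := (ext eps delta).
Local Notation X := (1 + eps / 2).
Local Notation m0 := ((kL + kR) / 2).
Local Notation c0 := ((kR - kL) / 2).
Local Notation K := (`|c0| + 4 * M).
Local Notation mu := (@lebesgue_measure R).
Implicit Types p q : R * R.

Let eps_lt1 : eps < 1. Proof. by have e1 := eps1; lra. Qed.

Definition even_part q : R := 1 / 2 * (u q + u (flip q)).

Lemma even_part_has_lap q : E q -> has_lap even_part q 0.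
Proof.
move=> Eq; rewrite -(mulr0 (1 / 2)) -[X in has_lap _ _ (_ * X)](addr0 0).
apply: has_lapZ; apply: has_lapD; first exact: (u_has_lap sol).
apply: has_lap_refl; rewrite ?expr1n ?sqrrN ?expr1n//.
by apply: (u_has_lap sol); exact: ext_flip.
Qed.

Lemma even_part_within : {within closure E, continuous even_part}.
Proof.
apply: withinI => q Eq; apply: cvgM; first exact: cvg_cst.
by apply: cvgD; [exact: (withinP (u_within sol))|apply: within_flip => //; exact: u_within sol].
Qed.

Lemma even_part_le q : closure E q -> `|q.1| < 4 -> `|q.2| <= 3 * l ->
  `|even_part q - m0| <= K.
Proof.
move=> Eq q1 q2.
have h1 := u_le eps0 eps_lt1 delta0 harmH perH sol uL uR M0 HM Eq q1 q2.
have := u_le eps0 eps_lt1 delta0 harmH perH sol uL uR M0 HM (closure_ext_flip eps0 delta0 Eq).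
rewrite flipE /= normrN => /(_ q1 q2) h2.
have -> : even_part q - m0 = 1 / 2 * (u q - m0) + 1 / 2 * (u (q.1, - q.2) - m0).
  by rewrite /even_part flipE; field.
have hn (z : R) : `|1 / 2 * z| = 1 / 2 * `|z| by rewrite normrM ger0_norm//; lra.
by apply: (le_trans (ler_normD _ _)); rewrite !hn; lra.
Qed.

(** [flip] carries disk [n] to disk [- n], where the accumulated jump has the opposite sign. *)
Lemma even_partR n q : sqd q (cR eps delta n) = 1 -> even_part q = kR.
Proof.
move=> e; have e' : sqd (flip q) (cR eps delta (- n)) = 1.
  by rewrite sqd_flip flip_cR opprK.
rewrite /even_part (u_circleR eps0 eps_lt1 delta0 harmH perH sol uR e).
by rewrite (u_circleR eps0 eps_lt1 delta0 harmH perH sol uR e') rmorphN /=; field.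
Qed.

Lemma even_partL q : sqd q (cL eps delta 0) = 1 -> even_part q = kL.
Proof.
move=> e; have e' : sqd (flip q) (cL eps delta 0) = 1.
  by rewrite sqd_flip flip_cL oppr0.
rewrite /even_part (u_circleL eps0 eps_lt1 delta0 harmH perH sol uL e).
by rewrite (u_circleL eps0 eps_lt1 delta0 harmH perH sol uL e') mul0r; field.
Qed.

Variable G : R * R -> R * R.
Hypothesis Gcont : {within closure E, continuous G}.
Hypothesis Ggrad : forall p, E p -> G p = grad u p.
Hypothesis Gflux : flux G (cR eps delta 0) = 0%E.

(** Written with [G], the continuous extension of the gradient, so as to make sense on the circle
    itself. *)
Definition even_dx q : R := 1 / 2 * ((G q).1 + 1 * (G (flip q)).1).
Definition even_dy q : R := 1 / 2 * ((G q).2 + -1 * (G (flip q)).2).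

Lemma even_part_has_grad q : E q -> has_grad even_part q (even_dx q) (even_dy q).
Proof.
move=> Eq; have Ef := ext_flip eps0 delta0 Eq.
rewrite /even_dx /even_dy (Ggrad Eq) (Ggrad Ef) /grad /=.
apply: has_gradZ; apply: has_gradD; first exact: (u_has_grad sol).
by apply: has_grad_refl; exact: (u_has_grad sol).
Qed.

Lemma within_G1 : {within closure E, continuous (fun q => (G q).1)}.
Proof.
apply: withinI => q Eq.
have /subspace_continuousP/(_ q Eq) h := Gcont.
exact: (cvg_comp _ _ h (@continuous_fst R (G q))).
Qed.

Lemma within_G2 : {within closure E, continuous (fun q => (G q).2)}.
Proof.
apply: withinI => q Eq.
have /subspace_continuousP/(_ q Eq) h := Gcont.
exact: (cvg_comp _ _ h (@continuous_snd R (G q))).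
Qed.

Lemma even_dx_within q : closure E q ->
  even_dx @ within (closure E) (nbhs q) --> even_dx q.
Proof.
move=> Eq; apply: cvgM; first exact: cvg_cst.
apply: cvgD; first exact: (withinP within_G1).
by apply: cvgM; [exact: cvg_cst|apply: (within_flip eps0 delta0 Eq within_G1)].
Qed.

Lemma even_dy_within q : closure E q ->
  even_dy @ within (closure E) (nbhs q) --> even_dy q.
Proof.
move=> Eq; apply: cvgM; first exact: cvg_cst.
apply: cvgD; first exact: (withinP within_G2).
by apply: cvgM; [exact: cvg_cst|apply: (within_flip eps0 delta0 Eq within_G2)].
Qed.

Local Notation Lam := (gap_height eps).
Local Notation a := (pole eps).

Lemma osc_bound_gt0 : 0 < K.
Proof. by have h := M0; have := normr_ge0 c0; lra. Qed.

Lemma height_le_osc_bound : `|c0| <= K.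
Proof. by have h := M0; lra. Qed.

Lemma circle_bounds q : sqd q (cR eps delta 0) = 1 -> eps / 2 <= q.1 <= 2 + eps / 2 /\ `|q.2| <=
  1 /\
  (q.1 <= 1 / 2 -> `|q.2| <= 22 / 25).
Proof.
have e0 := eps0; rewrite cR0E /sqd /= subr0 => e.
have s1 := sqr_ge0 (q.1 - X); have s2 := sqr_ge0 q.2.
have n1 : `|q.1 - X| <= 1 by rewrite -ler_sqr ?nnegrE// real_normK ?num_real// expr1n; lra.
have n2 : `|q.2| <= 1 by rewrite -ler_sqr ?nnegrE// real_normK ?num_real// expr1n; lra.
move: n1; rewrite ler_norml => /andP[? ?].
split; first by apply/andP; split; lra.
split => // q1.
by rewrite -ler_sqr ?nnegrE// real_normK ?num_real//; nra.
Qed.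

(** The neck estimate holds in the open exterior near [q] and passes to the circle by continuity of
    [even_dx] and [even_dy]. *)
Lemma circle_neck q : sqd q (cR eps delta 0) = 1 -> q.1 <= 1 / 2 ->
  let F := a ^+ 2 + q.2 ^+ 2 - q.1 ^+ 2 in
  let D := F ^+ 2 + 4 * q.1 ^+ 2 * q.2 ^+ 2 in
  `|even_dx q - c0 / Lam * (4 * a * (F / D))| <= grad_const * (2 * K) /\
  `|even_dy q - c0 / Lam * (- 4 * a * (2 * q.1 * q.2 / D))| <= grad_const * (2 * K).
Proof.
move=> e q1; have [/andP[q0 _] [_ /(_ q1) q2]] := circle_bounds e.
have e0 := eps0; have e1 := eps1.
have Eq := circle_closure_ext eps0 delta0 (disk_centerR eps delta 0) e.
have [hR hL] := outside_circles eps0 delta0 Eq.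
pose F (z : R * R) := a ^+ 2 + z.2 * z.2 - z.1 * z.1.
pose D (z : R * R) := F z * F z + 4 * (z.1 * z.1) * (z.2 * z.2).
have c1 := @continuous_fst R q; have c2 := @continuous_snd R q.
have cF : {for q, continuous F}.
  by apply: cvgB; [apply: cvgD; [exact: cvg_cst|exact: cvgM]|exact: cvgM].
have cD : {for q, continuous D}.
  apply: cvgD; first exact: cvgM.
  by apply: cvgM; [apply: cvgM; [exact: cvg_cst|exact: cvgM]|exact: cvgM].
have D0 : D q != 0 by rewrite gt_eqF//; have := denominator_gt0 eps0 hR hL.
have cDV : {for q, continuous (fun z => (D z)^-1)} by exact: cvgV.
have near_neck : \forall z \near q, `|z.1| <= 11 / 20 /\ `|z.2| <= 9 / 10.
  have := @near_rect R q (- (11 / 20)) (11 / 20) (- (9 / 10)) (9 / 10).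
  move: q2; rewrite ler_norml => /andP[q2 q2'].
  have -> : - (11 / 20) < q.1 < 11 / 20 by apply/andP; split; lra.
  have -> : - (9 / 10) < q.2 < 9 / 10 by apply/andP; split; lra.
  move=> /(_ isT isT); apply: filterS => z [/andP[? ?] /andP[? ?]].
  by rewrite !ler_norml; split; apply/andP; split; apply: ltW.
have grads z : E z -> `|z.1| <= 11 / 20 -> `|z.2| <= 9 / 10 ->
    `|even_dx z - c0 / Lam * (4 * a * (F z / D z))| <= grad_const * (2 * K) /\
    `|even_dy z - c0 / Lam * (- 4 * a * (2 * z.1 * z.2 / D z))| <= grad_const * (2 * K).
  move=> Ez z1 z2.
  have := @neck_grad R eps delta eps0 eps1 delta0 even_part even_dx even_dy kL kR K
    even_part_has_lap even_part_has_grad even_part_within even_part_le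
    (@even_partR 0) osc_bound_gt0 height_le_osc_bound even_partL z Ez z1 z2.
  by rewrite /D /F /= -!expr2.
have FE : F q = a ^+ 2 + q.2 ^+ 2 - q.1 ^+ 2 by [].
split.
- apply: (@closure_le _ E (fun z => `|even_dx z - c0 / Lam * (4 * a * (F z / D z))|)) => //.
    apply: cvg_norm; apply: cvgB.
      by apply: (within_subset_cvg (@subset_closure _ _)); exact: even_dx_within.
    apply: cvg_within_filter; apply: cvgM; first exact: cvg_cst.
    by apply: cvgM; [exact: cvg_cst|exact: cvgM].
  by apply: filterS near_neck => z [z1 z2] Ez; have [] := grads z Ez z1 z2.
- apply: (@closure_le _ E (fun z => `|even_dy z - c0 / Lam * (- 4 * a * (2 * z.1 * z.2 / D z))|))
  => //.
    apply: cvg_norm; apply: cvgB.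
      by apply: (within_subset_cvg (@subset_closure _ _)); exact: even_dy_within.
    apply: cvg_within_filter; apply: cvgM; first exact: cvg_cst.
    apply: cvgM; first exact: cvg_cst.
    apply: cvgM; last exact: cDV.
    by apply: cvgM => //; apply: cvgM => //; exact: cvg_cst.
  by apply: filterS near_neck => z [z1 z2] Ez; have [] := grads z Ez z1 z2.
Qed.

Lemma circle_right q : sqd q (cR eps delta 0) = 1 -> 1 / 2 <= q.1 ->
  `|even_dx q| <= grad_const * (2 * K) /\ `|even_dy q| <= grad_const * (2 * K).
Proof.
move=> e q1; have [/andP[_ q1'] [q2 _]] := circle_bounds e.
have e0 := eps0; have e1 := eps1.
have Eq := circle_closure_ext eps0 delta0 (disk_centerR eps delta 0) e.
have near_right : \forall z \near q, (1 / 4 <= z.1 <= 3) /\ `|z.2| <= 3 / 2.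
  have := @near_rect R q (1 / 4) 3 (- (3 / 2)) (3 / 2).
  move: q2; rewrite ler_norml => /andP[q2 q2'].
  have -> : 1 / 4 < q.1 < 3 by apply/andP; split; lra.
  have -> : - (3 / 2) < q.2 < 3 / 2 by apply/andP; split; lra.
  move=> /(_ isT isT); apply: filterS => z [/andP[? ?] /andP[? ?]].
  by rewrite !ler_norml; split; apply/andP; split; apply: ltW.
have grads z : E z -> 1 / 4 <= z.1 <= 3 -> `|z.2| <= 3 / 2 ->
    `|even_dx z| <= grad_const * (2 * K) /\ `|even_dy z| <= grad_const * (2 * K).
  exact: (@right_grad R eps delta eps0 eps1 delta0 even_part even_dx even_dy kL kR K
    even_part_has_lap even_part_has_grad even_part_within even_part_le osc_bound_gt0
      height_le_osc_bound
    even_partR).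
split.
- apply: (@closure_le _ E (fun z => `|even_dx z|)) => //.
    apply: cvg_norm; apply: (within_subset_cvg (@subset_closure _ _)); exact: even_dx_within.
  by apply: filterS near_right => z [z1 z2] Ez; have [] := grads z Ez z1 z2.
- apply: (@closure_le _ E (fun z => `|even_dy z|)) => //.
    apply: cvg_norm; apply: (within_subset_cvg (@subset_closure _ _)); exact: even_dy_within.
  by apply: filterS near_right => z [z1 z2] Ez; have [] := grads z Ez z1 z2.
Qed.

Definition circle_point (t : R) : R * R :=
  ((cR eps delta 0).1 + cos t, (cR eps delta 0).2 + sin t).

Lemma circle_pointE t : circle_point t = (X + cos t, sin t).
Proof. by rewrite /circle_point cR0E add0r. Qed.

Lemma circle_pointP t : sqd (circle_point t) (cR eps delta 0) = 1.
Proof.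
rewrite circle_pointE cR0E /sqd /= subr0 -[RHS](cos2Dsin2 t); congr (_ ^+ 2 + _).
by ring.
Qed.

Lemma circle_point_reflect t : circle_point (2 * pi - t) = flip (circle_point t).
Proof.
rewrite !circle_pointE flipE /= (_ : 2 * pi - t = - t + pi *+ 2); last by ring.
by rewrite cosD2pi sinD2pi cosN sinN.
Qed.

Definition flux_density (t : R) : R :=
  (G (circle_point t)).1 * (- cos t) + (G (circle_point t)).2 * (- sin t).

(** The parameters [t] and [2 pi - t] are mirror images under [flip], so their sum is twice the
    normal derivative of the even part. *)
Lemma flux_density_even t : flux_density t + flux_density (2 * pi - t) =
  2 * (even_dx (circle_point t) * (X - (circle_point t).1)
       + even_dy (circle_point t) * (- (circle_point t).2)).
Proof.
rewrite /flux_density circle_point_reflect (_ : 2 * pi - t = - t + pi *+ 2); last by ring.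
rewrite cosD2pi sinD2pi cosN sinN /even_dx /even_dy.
rewrite (_ : X - (circle_point t).1 = - cos t); last by rewrite circle_pointE /=; ring.
rewrite (_ : (circle_point t).2 = sin t); last by rewrite circle_pointE.
by field.
Qed.

Lemma flux_density_continuous t : {for t, continuous flux_density}.
Proof.
have cp : {for t, continuous circle_point}.
  have h1 : (cR eps delta 0).1 + cos s @[s --> t] --> (cR eps delta 0).1 + cos t.
    by apply: cvgD; [exact: cvg_cst|exact: continuous_cos].
  have h2 : (cR eps delta 0).2 + sin s @[s --> t] --> (cR eps delta 0).2 + sin t.
    by apply: cvgD; [exact: cvg_cst|exact: continuous_sin].
  exact: (cvg_pair h1 h2).
have Ec s : closure E (circle_point s).
  exact: (circle_closure_ext eps0 delta0 (disk_centerR eps delta 0) (circle_pointP s)).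
have comp (g : R * R -> R) : {within closure E, continuous g} ->
    {for t, continuous (fun s => g (circle_point s))}.
  move=> /withinP cg U /(cg _ (Ec t)); rewrite /nbhs/= /within/= => nU.
  by have := cp _ nU; rewrite nbhs_simpl/=; apply: filterS => s /(_ (Ec s)).
apply: cvgD; apply: cvgM.
- exact: comp within_G1.
- by apply: cvgN; exact: continuous_cos.
- exact: comp within_G2.
- by apply: cvgN; exact: continuous_sin.
Qed.

Lemma normal_combination_le (x y x' y' n m B : R) : `|n| <= 1 -> `|m| <= 1 ->
  `|x - x'| <= B -> `|y - y'| <= B ->
  `|(x * n + y * m) - (x' * n + y' * m)| <= 2 * B.
Proof.
move=> n1 m1 hx hy.
have -> : (x * n + y * m) - (x' * n + y' * m) = (x - x') * n + (y - y') * m by ring.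
apply: (le_trans (ler_normD _ _)); rewrite !normrM.
have := ler_pM (normr_ge0 _) (normr_ge0 _) hx n1.
by have := ler_pM (normr_ge0 _) (normr_ge0 _) hy m1; lra.
Qed.

Lemma circle_point_normal t : `|X - (circle_point t).1| <= 1 /\ `|- (circle_point t).2| <= 1.
Proof.
rewrite circle_pointE /= normrN; split; last first.
  by rewrite ler_norml sin_geN1 sin_le1.
by rewrite (_ : X - _ = - cos t); [rewrite normrN ler_norml cos_geN1 cos_le1|ring].
Qed.

Lemma sgr_le (x : R) : `|Num.sg x| <= 1.
Proof. by rewrite normr_sg; case: (x != 0); rewrite ?mulr1n ?mulr0n. Qed.

(** The normal derivative of the model is [c0 / Lam * (2 a / q.1)] with [2 a / Lam >= 1], and the
    sign of [c0] makes it positive. The error is two components of size [2 grad_const K], doubled by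
    the pairing. *)
Lemma flux_density_neck t : (circle_point t).1 <= 1 / 2 ->
  2 * `|c0| / (circle_point t).1 - 8 * grad_const * K <=
    Num.sg c0 * (flux_density t + flux_density (2 * pi - t)).
Proof.
move=> q1; have e := circle_pointP t; have [n1 n2] := circle_point_normal t.
have [/andP[q0 _] _] := circle_bounds e.
have [h1 h2] := circle_neck e q1.
have e0 := eps0; have qp : 0 < (circle_point t).1 by lra.
have := normal_combination_le n1 n2 h1 h2.
rewrite flux_density_even; set q := circle_point t.
set S := even_dx q * _ + _.
have eR : sqd q (X, 0) = 1 by rewrite -(cR0E eps delta).
have := gap_model_normal eps0 eR qp; rewrite -/q /= => nrm_eq.
have Lp : 0 < Lam by exact: gap_height_gt0.
set T := c0 / Lam * _ * _ + _.
have -> : T = c0 / Lam * (2 * a / q.1) by rewrite -nrm_eq /T; ring.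
move=> hT; have := sgr_le c0; have := mulr_sg_norm c0; have := normrEsg c0.
set s := Num.sg c0 => e1 e2 s1.
have lower : `|c0| / q.1 <= s * (c0 / Lam * (2 * a / q.1)).
  have -> : s * (c0 / Lam * (2 * a / q.1)) = `|c0| / q.1 * (2 * a / Lam).
    by rewrite e1; field; rewrite !gt_eqF.
  rewrite ler_peMr//; first by rewrite divr_ge0// ltW.
  by rewrite ler_pdivlMr// mul1r; have /andP[] := gap_height_bounds eps0.
have err : `|s * (S - c0 / Lam * (2 * a / q.1))| <= 4 * grad_const * K.
  rewrite normrM; have := ler_pM (normr_ge0 _) (normr_ge0 _) s1 hT; lra.
move: err; rewrite ler_norml => /andP[err _].
have -> : s * (2 * S) = 2 * (s * (c0 / Lam * (2 * a / q.1))) +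
    2 * (s * (S - c0 / Lam * (2 * a / q.1))) by ring.
rewrite -mulrA; lra.
Qed.

Lemma flux_density_right t : 1 / 2 <= (circle_point t).1 ->
  - (8 * grad_const * K) <= Num.sg c0 * (flux_density t + flux_density (2 * pi - t)).
Proof.
move=> q1; have e := circle_pointP t; have [n1 n2] := circle_point_normal t.
have [h1 h2] := circle_right e q1.
have := @normal_combination_le (even_dx (circle_point t)) (even_dy (circle_point t)) 0 0
  _ _ (grad_const * (2 * K)) n1 n2.
rewrite flux_density_even; set q := circle_point t.
set S := even_dx q * _ + _.
rewrite !subr0 !mul0r addr0 subr0 => /(_ h1 h2) hS.
have := ler_pM (normr_ge0 _) (normr_ge0 _) (sgr_le c0) hS.
rewrite -normrM ler_norml => /andP[err _].
rewrite (_ : _ * (2 * S) = 2 * (Num.sg c0 * S)); last by ring.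
by have g0 := @grad_const_gt0 R; have k0 := osc_bound_gt0; nra.
Qed.

Lemma height_difference_le : `|c0| <= 16 * grad_const * Num.sqrt eps * K.
Proof.
have e0 := eps0; have e1 := eps1; have k0 := osc_bound_gt0.
have g0 := @grad_const_gt0 R; have /andP[p2 p4] := @pi_bounds R.
set r := Num.sqrt eps; have r0 : 0 < r by rewrite sqrtr_gt0.
have r2 : r ^+ 2 = eps by rewrite sqr_sqrtr// ltW.
have r1 : r <= 1 by nra.
have gk : 0 < grad_const * K by exact: mulr_gt0.
have bound t : - (8 * grad_const * K) <= Num.sg c0 * (flux_density t + flux_density (2 * pi - t)).
  have [q1|q1] := leP (circle_point t).1 (1 / 2); last by apply: flux_density_right; exact: ltW.
  have [/andP[q0 _] _] := circle_bounds (circle_pointP t).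
  have := flux_density_neck q1; apply: le_trans.
  rewrite -[leLHS]add0r lerD2r//; apply: divr_ge0; last by lra.
  exact: mulr_ge0.
have peak t : `|t - pi| <= r -> 2 * `|c0| / eps - 8 * grad_const * K <=
    Num.sg c0 * (flux_density t + flux_density (2 * pi - t)).
  move=> tr.
  have [/andP[q0 _] _] := circle_bounds (circle_pointP t).
  (* The abscissa is [1 + eps / 2 - cos (t - pi) <= eps / 2 + (t - pi)^2 / 2]; this is why the arc
     has half-length [sqrt eps]. *)
  have qe : (circle_point t).1 <= eps.
    rewrite circle_pointE /= -(subrK pi t) cosDpi.
    have := cos_ge_quadratic (t - pi).
    have : (t - pi) ^+ 2 <= r ^+ 2 by rewrite -(real_normK (num_real _)) ler_sqr ?nnegrE// ltW.
    by rewrite r2; lra.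
  have q1 : (circle_point t).1 <= 1 / 2 by lra.
  apply: le_trans (flux_density_neck q1); rewrite lerD2r; apply: ler_wpM2l; first exact: mulr_ge0.
  by rewrite lef_pV2 ?posrE//; lra.
pose f t := Num.sg c0 * flux_density t.
have cf : {within `[0, 2 * pi], continuous f}.
  apply: continuous_subspaceT => t; apply: cvgM; first exact: cvg_cst.
  exact: flux_density_continuous.
have cfd : {within `[0, 2 * pi], continuous flux_density}.
  by apply: continuous_subspaceT => t; exact: flux_density_continuous.
have f0 : (\int[mu]_(t in `[0%R, (2 * pi)%R]) (f t)%:E = 0)%E.
  transitivity ((Num.sg c0)%:E * \int[mu]_(t in `[0%R, (2 * pi)%R]) (flux_density t)%:E)%E.
    have i := continuous_compact_integrable (@segment_compact _ 0 (2 * pi)) cfd.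
    have mI : measurable (`[0, 2 * pi]%classic : set (measurableTypeR R)) by exact: measurable_itv.
    exact: (integralZl mI i (Num.sg c0)).
  have -> : (\int[mu]_(t in `[0%R, (2 * pi)%R]) (flux_density t)%:E = 0)%E by exact: Gflux.
  by rewrite mule0.
have := @peak_bound _ f r (2 * `|c0| / eps) (8 * grad_const * K) cf f0.
rewrite r0 r1 => /(_ isT); rewrite divr_ge0 ?mulr_ge0 ?(ltW e0)//.
rewrite /f => /(_ isT); have hf t : Num.sg c0 * flux_density t + Num.sg c0 * flux_density (2 * pi
  - t) =
  Num.sg c0 * (flux_density t + flux_density (2 * pi - t)) by rewrite -mulrDr.
move=> pb; have {pb} : 2 * r * (2 * `|c0| / eps) <= 2 * pi * (8 * grad_const * K).
  by apply: pb => t ?; rewrite hf; [exact: bound|exact: peak].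
(* With [r^2 = eps] the peak contributes [4 |c0| / r]; the right-hand side is at most
   [64 grad_const K], by [pi <= 4]. *)
have -> : 2 * r * (2 * `|c0| / eps) = 4 * (`|c0| / r).
  by rewrite -r2; field; rewrite gt_eqF.
move=> h; have {h} : `|c0| / r <= 16 * (grad_const * K) by nra.
by rewrite ler_pdivrMr//; lra.
Qed.

End FluxBound.

(** * The two expansions *)

Section Estimates.
Context {R : realType}.
Variables (eps delta : R) (H u : R * R -> R).
Hypotheses (eps0 : 0 < eps) (eps1 : eps <= 1 / 100) (delta0 : 0 < delta)
  (delta1 : delta <= 1 / 100) (eps_small : 32 * grad_const * Num.sqrt eps <= 1).
Hypothesis harmH : harmonic_on setT H.
Hypothesis perH : forall p, grad H p = grad H (p.1, p.2 + (2 + delta)).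
Hypothesis sol : is_solution eps delta H u.
Variables kL kR : R.
Hypothesis uL : forall p, circle (cL eps delta 0) p -> u p = kL.
Hypothesis uR : forall p, circle (cR eps delta 0) p -> u p = kR.
Local Notation L := (2 + delta).
Local Notation l := (1 + delta / 2).
Local Notation E := (ext eps delta).
Local Notation X := (1 + eps / 2).
Local Notation m0 := ((kL + kR) / 2).
Local Notation c0 := ((kR - kL) / 2).
Local Notation lam := (H (0, 1) - H (0, -1)).
Local Notation J := (jump delta H).
Local Notation gc := (@grad_const R).
Implicit Types p q P : R * R.

Let eps_lt1 : eps < 1. Proof. by have e1 := eps1; lra. Qed.

Lemma grad_const_ge1 : 1 <= gc.
Proof.
have h : 0 < (1 / 16 : R) by lra.
by rewrite /grad_const ler_pdivlMr ?exprn_gt0// expr2; lra.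
Qed.

Lemma Nh_shift P : P.2 - 1 - delta / 2 = P.2 - l /\ P.1 - 1 - eps / 2 = P.1 - X.
Proof. by split; ring. Qed.

Lemma Nv_ext P : Nv eps P -> [/\ E P, P.2 ^+ 2 < 3 / 4 & `|P.1| <= 2 / 3 * (eps + P.2 ^+ 2)].
Proof.
move=> [p1 p2]; have [y34 x23 hR hL] := gap_width eps0 p1 p2.
split => //; apply/(extP eps0 delta0) => c [n hc].
have [n0|n0] := eqVneq n 0.
  rewrite n0 in hc; case: hc => ->; first by rewrite cL0E; move: hL; rewrite /sqd /=.
  by rewrite cR0E; move: hR; rewrite /sqd /=.
have c2 : c.2 = n%:~R * L by case: hc => ->.
rewrite /sqd c2; have : 1 < (P.2 - n%:~R * L) ^+ 2.
  apply: (@other_row _ delta _ P.2 0 n) => //; first by rewrite eq_sym.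
  have d0 := delta0; rewrite mul0r subr0.
  suff : `|P.2| <= 1 by lra.
  by rewrite -ler_sqr ?nnegrE// real_normK ?num_real//; lra.
by have := sqr_ge0 (P.1 - c.1); lra.
Qed.

Lemma Nh_gap P : Nh eps delta P -> let x := P.1 - X in let y := P.2 - l in
  [/\ x ^+ 2 < 3 / 4, `|y| <= 2 / 3 * (delta + x ^+ 2),
      1 < sqd (y, x) (l, 0) & 1 < sqd (y, x) (- l, 0)].
Proof.
have [e1 e2] := Nh_shift P.
by rewrite /Nh /= e1 e2 => -[h1 h2]; exact: gap_width.
Qed.

Lemma Nh_range P : Nh eps delta P -> 1 / 8 <= P.1 <= 3 /\ 2 / 5 <= P.2 <= 8 / 5.
Proof.
move=> /Nh_gap[x34 y23 _ _].
have e0 := eps0; have e1 := eps1; have d0 := delta0; have d1 := delta1.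
have : `|P.1 - X| <= 7 / 8.
  by rewrite -ler_sqr ?nnegrE// real_normK ?num_real//; lra.
have : `|P.2 - l| <= 51 / 100 by lra.
rewrite !ler_norml => /andP[? ?] /andP[? ?].
by split; apply/andP; split; lra.
Qed.

Lemma Nh_ext P : Nh eps delta P -> E P.
Proof.
move=> hP; have [/andP[p1 p1'] /andP[p2 p2']] := Nh_range hP.
have [x34 _ h1 h2] := Nh_gap hP.
have e0 := eps0; have d0 := delta0; have d1 := delta1.
apply/(extP eps0 delta0) => c [n [->|hc]].
  by rewrite /sqd /=; have := sqr_ge0 (P.2 - n%:~R * L); nra.
have [n0|n0] := eqVneq n 0.
  by rewrite (_ : sqd P c = sqd (P.2 - l, P.1 - X) (- l, 0))// hc n0 cR0E /sqd /=; ring.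
have [n1|n1] := eqVneq n 1.
  by rewrite (_ : sqd P c = sqd (P.2 - l, P.1 - X) (l, 0))// hc n1 /sqd /= mul1r; field.
apply: (@outer_row_far _ eps delta delta0 delta1 P n c) => //.
- by exists n; right.
- by rewrite hc.
- by apply/andP; split; lra.
Qed.

(** In [Nh] the factor [y] cancels one power of [delta + x^2], and [2 sqrt delta |x| <= delta + x^2]
    cancels the other. *)
Lemma Sfun_le P : Nh eps delta P -> `|Sfun eps delta P| <= 2.
Proof.
move=> /Nh_gap[x34 y23 _ _]; have d0 := delta0; have d1 := delta1.
have [/andP[h0 _] _] := gap_h d0 d1 x34.
rewrite /Sfun; have [-> ->] := Nh_shift P; move: h0 x34 y23.
set x := P.1 - X; set y := P.2 - l => h0 x34 y23.
have ht := gap_model_tangential_le d0 d1 x34 y23.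
set r := Num.sqrt delta; have r0 : 0 <= r by exact: sqrtr_ge0.
have r2 : r ^+ 2 = delta by rewrite sqr_sqrtr// ltW.
have -> : - 2 * r * (x * y) / (x ^+ 2 + delta) ^+ 2 =
    - 2 * r * (y * x / (delta + x ^+ 2) ^+ 2).
  by rewrite [x ^+ 2 + _]addrC [x * y]mulrC -!mulrA.
have n2r : `|- 2 * r| = 2 * r by rewrite mulNr normrN ger0_norm// mulr_ge0.
rewrite normrM n2r.
apply: (@le_trans _ _ (2 * r * (`|x| / (delta + x ^+ 2)))).
  by apply: ler_wpM2l => //; lra.
rewrite mulrA ler_pdivrMr//.
have := sqr_ge0 (r - `|x|); rewrite sqrrB r2 real_normK ?num_real// -/x; lra.
Qed.

Lemma Sfun_center : Sfun eps delta (X, l) = 0.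
Proof. by rewrite /Sfun /= (_ : X - 1 - eps / 2 = 0); [rewrite !mul0r mulr0 mul0r|ring]. Qed.

(** The leading term [c0 / Lam * 4 a / h] of the model, rewritten as a multiple of
    [sqrt eps / h]. *)
Definition neck_coefficient : R := 4 * pole eps * c0 / (gap_height eps * Num.sqrt eps).

Section Background.
Variable M : R.
Hypothesis M0 : 0 < M.
Hypothesis HM : forall p, Omega_m delta 4 p -> `|H p| <= M.
Local Notation K := (`|c0| + 4 * M).

(** [eps_small] makes the coefficient of [|c0|] in the flux bound at most [1 / 2]; absorbing it
    doubles [16 * 4] to 128. *)
Lemma height_difference : `|c0| <= 128 * gc * Num.sqrt eps * M /\ K <= 8 * M.
Proof.
case: (sol) => _ [_ [_ [_ [[G [cG [gG [_ fG]]]] _]]]].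
have := height_difference_le eps0 eps1 delta0 harmH perH sol uL uR M0 HM cG gG fG.
have := eps_small; have m0 := M0; have := normr_ge0 c0; set r := Num.sqrt eps.
set c := `|c0|; set g := gc * r => c1; rewrite -![_ * gc * r]mulrA -/g => g1 h.
have g0 : 0 <= g by rewrite mulr_ge0 ?sqrtr_ge0// ltW// grad_const_gt0.
have : c <= 128 * g * M by nra.
by move=> h'; split => //; nra.
Qed.

Lemma height_ratio (t : R) : 0 < t -> t <= 1 / 100 ->
  1 <= 2 * pole t / gap_height t <= 1 + t / 2.
Proof.
move=> t0 t1; have /andP[b1 b2] := gap_height_bounds t0; have l0 := gap_height_gt0 t0.
by rewrite ler_pdivlMr// mul1r b1 ler_pdivrMr.
Qed.

Lemma neck_coefficient_le : `|neck_coefficient| <= 384 * gc * M.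
Proof.
have [h _] := height_difference; have /andP[b1 b2] := height_ratio eps0 eps1.
have e1 := eps1; have l0 := gap_height_gt0 eps0.
have r0 : 0 < Num.sqrt eps by rewrite sqrtr_gt0.
rewrite /neck_coefficient.
have -> : 4 * pole eps * c0 / (gap_height eps * Num.sqrt eps) =
   (2 * (2 * pole eps / gap_height eps)) * (c0 / Num.sqrt eps).
  by field; rewrite !gt_eqF.
rewrite normrM (ger0_norm (_ : 0 <= 2 * _)); last by lra.
rewrite normrM normfV (gtr0_norm r0).
have : `|c0| / Num.sqrt eps <= 128 * gc * M by rewrite ler_pdivrMr//; lra.
have : 0 <= `|c0| / Num.sqrt eps by rewrite divr_ge0// ltW.
by nra.
Qed.

Lemma neck_estimate P : Nv eps P ->
  `|dx u P - neck_coefficient * (Num.sqrt eps / (eps + P.2 ^+ 2))| <= 100 * gc * M /\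
  `|dy u P| <= 800 * gc * M.
Proof.
move=> hP; have [EP y34 x23] := Nv_ext hP.
have [hc hK] := height_difference; have /andP[b1 b2] := height_ratio eps0 eps1.
have e0 := eps0; have e1 := eps1; have m00 := M0.
have g1 := grad_const_ge1; have l0 := gap_height_gt0 e0.
have gM : M <= gc * M by rewrite ler_peMl// ltW.
have [/andP[h0 h1] [he hy]] := gap_h e0 e1 y34.
have P1 : `|P.1| <= 11 / 20 by lra.
have P2 : `|P.2| <= 9 / 10.
  by rewrite -ler_sqr ?nnegrE// real_normK ?num_real//; lra.
have [] := neck_grad eps0 eps1 delta0 (u_has_lap sol)
  (u_has_grad sol) (u_within sol)
  (u_le eps0 eps_lt1 delta0 harmH perH sol uL uR M0 HM) uR (osc_bound_gt0 kL kR M0)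
  (height_le_osc_bound kL kR M0) uL EP P1 P2.
have gm := gap_main e0 e1 y34 x23; have gt := gap_tangential_le e0 e1 y34 x23.
move: gm gt; set F := _ ^+ 2 + _ - _; set D := F ^+ 2 + _ => gm gt hx hy'.
have gK : gc * (2 * K) <= 16 * (gc * M).
  by rewrite [16 * _]mulrCA ler_pM2l ?grad_const_gt0//; lra.
set r := Num.sqrt eps in hc *; have r0 : 0 < r by rewrite sqrtr_gt0.
have r2 : r ^+ 2 = eps by rewrite sqr_sqrtr// ltW.
set k := 2 * pole eps / gap_height eps in b1 b2.
have r1 : r <= 1 by nra.
split.
(* Besides the distance to the model only [2 k c0 (F / D - 1 / h)] remains, with [k] close to 1 and
   the bracket bounded by [gap_main]. *)
- have -> : dx u P - neck_coefficient * (r / (eps + P.2 ^+ 2)) =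
    (dx u P - c0 / gap_height eps * (4 * pole eps * (F / D)))
    + 2 * k * c0 * (F / D - (eps + P.2 ^+ 2)^-1).
    by rewrite /neck_coefficient -/r /k mulrBr; move: (F / D) => z; field; rewrite !gt_eqF.
  apply: (le_trans (ler_normD _ _)).
  rewrite normrM [X in _ + X * _]normrM (ger0_norm (_ : 0 <= 2 * k)); last by lra.
  have c16 : `|c0| <= 4 * M by lra.
  have : 2 * k * `|c0| * `|F / D - (eps + P.2 ^+ 2)^-1| <= 3 * (4 * M) * 6.
    apply: ler_pM => //; first by apply: mulr_ge0 => //; lra.
    by apply: ler_pM => //; lra.
  by lra.
- have -> : dy u P = (dy u P - c0 / gap_height eps * (- 4 * pole eps * (2 * P.1 * P.2 / D)))
    - 4 * k * c0 * (P.1 * P.2 / D).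
    by rewrite /k; field; rewrite !gt_eqF//; have := gap_D_gt0 e0 e1 y34 x23.
  apply: (le_trans (ler_normB _ _)).
  rewrite normrM [X in _ + X * _]normrM (ger0_norm (_ : 0 <= 4 * k)); last by lra.
  (* By [eps + y^2 >= 2 sqrt eps |y|]. The resulting [1 / sqrt eps] meets the factor [sqrt eps] in
     the bound of [c0]. *)
  have yr : `|P.2| / (eps + P.2 ^+ 2) <= (2 * r)^-1.
    rewrite ler_pdivrMr// ler_pdivlMl; last by lra.
    by have := sqr_ge0 (r - `|P.2|); rewrite sqrrB r2 real_normK ?num_real//; lra.
  have : 4 * k * `|c0| * `|P.1 * P.2 / D| <= 5 * (128 * gc * r * M) * r^-1.
    apply: ler_pM => //; first by apply: mulr_ge0 => //; lra.
      by apply: ler_pM => //; lra.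
    apply: (le_trans gt); rewrite -mulrA.
    have -> : r^-1 = 2 * (2 * r)^-1 by field; rewrite gt_eqF.
    exact: ler_wpM2l.
  have -> : 5 * (128 * gc * r * M) / r = 640 * (gc * M) by field; rewrite gt_eqF.
  by lra.
Qed.

(** Across this gap the difference of boundary values is [J], which need not be small, so the
    tangential part of the model survives: to leading order it is [- 2 J x y / h^2], that is
    [J S / sqrt delta]. *)
Lemma gap_estimate P : Nh eps delta P ->
  `|dx u P - lam * ((Num.sqrt delta)^-1 * Sfun eps delta P)| <= 100 * gc * M /\
  `|dy u P - lam * (delta + (P.1 - 1 - eps / 2) ^+ 2)^-1| <= 100 * gc * M.
Proof.
move=> hP; have EP := Nh_ext hP; have [x34 y23 _ _] := Nh_gap hP.
have [P1 P2] := Nh_range hP.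
have [hc hK] := height_difference; have /andP[b1 b2] := height_ratio delta0 delta1.
have d0 := delta0; have d1 := delta1; have m00 := M0.
have g1 := grad_const_ge1; have l0 := gap_height_gt0 d0.
have gM : M <= gc * M by rewrite ler_peMl// ltW.
have [/andP[h0 h1] [he hy]] := gap_h d0 d1 x34.
have Jle := jump_le delta0 harmH HM.
have JK : `|J| <= K by have := normr_ge0 c0; lra.
have UR1 q : sqd q (cR eps delta 1) = 1 -> u q = kR + J.
  by move=> /(u_circleR eps0 eps_lt1 delta0 harmH perH sol uR) ->; rewrite mul1r.
have [] := vertical_gap_grad eps0 eps1 delta0 delta1 (u_has_lap sol)
  (u_has_grad sol) (u_within sol)
  (u_le eps0 eps_lt1 delta0 harmH perH sol uL uR M0 HM) uR (osc_bound_gt0 kL kR M0)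
  (height_le_osc_bound kL kR M0) JK UR1 EP P1 P2.
have gm := gap_main d0 d1 x34 y23; have gt := gap_tangential d0 d1 x34 y23.
have gl := gap_model_tangential_le d0 d1 x34 y23; have x1 := gap_y1 x34.
have D0 := gap_D_gt0 d0 d1 x34 y23.
rewrite /Sfun; have [-> ->] := Nh_shift P.
move: D0 gm gt gl x1 h0 he; set x := P.1 - X; set y := P.2 - l.
set h := delta + x ^+ 2; set F := _ ^+ 2 + _ - _; set D := F ^+ 2 + _.
move=> D0 gm gt gl x1 h0 he hy' hx.
have gK : gc * (3 * K) <= 24 * (gc * M).
  by rewrite [24 * _]mulrCA ler_pM2l ?grad_const_gt0//; lra.
set r := Num.sqrt delta; have r0 : 0 < r by rewrite sqrtr_gt0.
set k := 2 * pole delta / gap_height delta in b1 b2.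
have dh : delta / h <= 1 by rewrite ler_pdivrMr// mul1r.
(* Both [k - 1] and the passage from [J] to [lam] cost a factor [delta], and [delta <= h] then pays
   for the division by [h]. *)
have lamJ : `|k * J - lam| <= 10 * M * delta.
  have -> : k * J - lam = (J - lam) + (k - 1) * J by ring.
  apply: (le_trans (ler_normD _ _)).
  have j1 := jump_near delta0 harmH perH M0 HM (ltac:(lra) : delta <= 1).
  rewrite normrM (ger0_norm (_ : 0 <= k - 1)); last by lra.
  have : (k - 1) * `|J| <= delta / 2 * (2 * M) by apply: ler_pM => //; lra.
  by lra.
have kJ : `|k * J| <= 3 * M.
  rewrite normrM (ger0_norm (_ : 0 <= k)); last by lra.
  by have := normr_ge0 J; nra.
have hV : 0 < h^-1 by rewrite invr_gt0.
have lamh : `|k * J - lam| / h <= 10 * M.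
  have := ler_wpM2r (ltW hV) lamJ.
  by rewrite -[10 * M * delta / h]mulrA; nra.
split.
- have -> : dx u P - lam * (r^-1 * (- 2 * r * (x * y) / (x ^+ 2 + delta) ^+ 2)) =
    (dx u P - J / (2 * gap_height delta) * (- 4 * pole delta * (2 * y * x / D)))
    - 2 * (k * J) * (y * x / D - y * x / h ^+ 2)
    - 2 * (k * J - lam) * (y * x / h ^+ 2).
    have -> : x ^+ 2 + delta = h by rewrite addrC.
    by rewrite /k; field; rewrite !gt_eqF.
  have z0 := normr_ge0 (k * J - lam).
  have t1 : `|2 * (k * J) * (y * x / D - y * x / h ^+ 2)| <= 2 * (3 * M) * 5.
    rewrite normrM; apply: ler_pM => //.
    by rewrite normrM ger0_norm//; lra.
  have t2 : `|2 * (k * J - lam) * (y * x / h ^+ 2)| <= 20 * M.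
    rewrite normrM [X in X * _]normrM ger0_norm//.
    apply: (@le_trans _ _ (2 * `|k * J - lam| * h^-1)); last by lra.
    apply: ler_wpM2l; first by lra.
    by apply: (le_trans gl); rewrite ler_piMl// ltW.
  apply: (le_trans (ler_normB _ _)); have := ler_normB
    (dx u P - J / (2 * gap_height delta) * (- 4 * pole delta * (2 * y * x / D)))
    (2 * (k * J) * (y * x / D - y * x / h ^+ 2)).
  by lra.
- have -> : dy u P - lam / h =
    (dy u P - J / (2 * gap_height delta) * (4 * pole delta * (F / D)))
    + k * J * (F / D - h^-1) + (k * J - lam) / h.
    by rewrite /k; move: (F / D) => z; field; rewrite !gt_eqF.
  have t1 : `|k * J * (F / D - h^-1)| <= 3 * M * 6.
    by rewrite normrM; apply: ler_pM.
  have t2 : `|(k * J - lam) / h| <= 10 * M.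
    by rewrite normrM (gtr0_norm hV).
  apply: (le_trans (ler_normD _ _)); have := ler_normD
    (dy u P - J / (2 * gap_height delta) * (4 * pole delta * (F / D)))
    (k * J * (F / D - h^-1)).
  by lra.
Qed.

End Background.
End Estimates.

(** * From pointwise bounds to supremum norms *)

Section SupremumNorms.
Context {R : realType}.

(** The estimates need a positive [M]; letting [M] decrease to [s] admits a vanishing supremum. *)
Lemma le_scale_of_gt (x c s : R) : 0 < c ->
  (forall M, 0 < M -> s <= M -> x <= c * M) -> 0 <= s -> x <= c * s.
Proof.
move=> c0 h s0; rewrite leNgt; apply/negP => hx.
have d0 : 0 < (x - c * s) / (2 * c) by rewrite divr_gt0 ?subr_gt0// mulr_gt0.
have := h (s + (x - c * s) / (2 * c)) ltac:(lra) ltac:(lra).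
have -> : c * (s + (x - c * s) / (2 * c)) = c * s + (x - c * s) / 2.
  by field; rewrite gt_eqF.
by lra.
Qed.

Lemma supnorm2_le (A : set (R * R)) (F : R * R -> R * R) (a b : R) :
  (forall p, A p -> `|(F p).1| <= a /\ `|(F p).2| <= b) ->
  (supnorm2 A F <= (a + b)%:E)%E.
Proof.
move=> h; apply: ge_ereal_sup => _ [p Ap <-]; rewrite lee_fin.
have [h1 h2] := h p Ap.
apply: (@le_trans _ _ (`|(F p).1| + `|(F p).2|)); last exact: lerD.
rewrite -ler_sqr ?nnegrE ?sqrtr_ge0 ?addr_ge0// sqr_sqrtr ?addr_ge0 ?sqr_ge0//.
rewrite sqrrD !real_normK ?num_real//.
have := mulr_ge0 (normr_ge0 (F p).1) (normr_ge0 (F p).2); lra.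
Qed.

End SupremumNorms.

Theorem theorem1p1 (R : realType) :
  exists C eps0 delta0 : R, 0 < C /\ 0 < eps0 /\ 0 < delta0 /\
  forall eps delta : R, 0 < eps < eps0 -> 0 < delta < delta0 ->
  forall H u : R * R -> R,
    harmonic_on setT H ->
    (forall p, grad H p = grad H (p.1, p.2 + (2 + delta))) ->
    is_solution eps delta H u ->
    (supnorm (Nh eps delta) (Sfun eps delta) <= 2%:E)%E /\
    Sfun eps delta (1 + eps / 2, 1 + delta / 2) = 0 /\
    exists (lam mu : R) (R1 R2 : R * R -> R * R),
      (forall p, Nh eps delta p ->
         grad u p =
           (lam * ((Num.sqrt delta)^-1 * Sfun eps delta p) + (R1 p).1,
            lam * (delta + (p.1 - 1 - eps / 2) ^+ 2)^-1 + (R1 p).2)) /\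
      (forall p, Nv eps p ->
         grad u p = (mu * (Num.sqrt eps / (eps + p.2 ^+ 2)) + (R2 p).1, (R2 p).2)) /\
      lam = H (0, 1) - H (0, -1) /\
      (`|mu|%:E <= C%:E * supnorm (Omega_m delta 4) H)%E /\
      (supnorm2 (Nh eps delta) R1 + supnorm2 (Nv eps) R2
         <= C%:E * supnorm (Omega_m delta 4) H)%E.
Proof.
have g0 := @grad_const_gt0 R; pose g32 : R := 32 * grad_const.
have g320 : 0 < g32 by rewrite /g32; lra.
(* [1100 = 100 + 100 + 100 + 800] adds the component bounds of the two remainders. The second entry
   of the minimum is the condition [32 grad_const sqrt eps <= 1]. *)
exists (1100 * grad_const), (Num.min (1 / 100) (g32^-1 ^+ 2)), (1 / 100).
have C0 : 0 < 1100 * grad_const :> R by lra.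
split; first exact: C0.
split; first by rewrite lt_min exprn_gt0 ?invr_gt0// andbT; lra.
split; first by lra.
move=> eps delta /andP[eps0]; rewrite lt_min => /andP[/ltW eps1 eps2].
move=> /andP[delta0 /ltW delta1] H u harmH perH sol.
have eps_small : 32 * grad_const * Num.sqrt eps <= 1.
  rewrite -/g32 mulrC -ler_pdivlMr// div1r -ler_sqr ?nnegrE ?sqrtr_ge0 ?invr_ge0 ?(ltW g320)//.
  by rewrite sqr_sqrtr ltW.
split.
  by apply: ge_ereal_sup => _ [p hp <-]; rewrite lee_fin; exact: Sfun_le.
split; first exact: Sfun_center.
case: (sol) => _ [_ [[kL uL] [[kR uR] _]]].
pose lam := H (0, 1) - H (0, -1); pose mu := neck_coefficient eps kL kR.
pose R1 p := (dx u p - lam * ((Num.sqrt delta)^-1 * Sfun eps delta p),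
  dy u p - lam * (delta + (p.1 - 1 - eps / 2) ^+ 2)^-1).
pose R2 p := (dx u p - mu * (Num.sqrt eps / (eps + p.2 ^+ 2)), dy u p).
exists lam, mu, R1, R2; split; first by move=> p _; rewrite /R1 /= ![_ + (_ - _)]addrC !subrK.
split; first by move=> p _; rewrite /R2 /= [_ + (_ - _)]addrC subrK.
split => //.
have S0 : (0 <= supnorm (Omega_m delta 4) H)%E.
  apply: (@le_trans _ _ (`|H (0, 0)|%:E)); first by rewrite lee_fin.
  apply: ereal_sup_ubound; exists (0, 0) => //; split; last by rewrite /= normr0.
  by rewrite /Omega/=; apply/andP; split; lra.
have HS p : Omega_m delta 4 p -> (`|H p|%:E <= supnorm (Omega_m delta 4) H)%E.
  by move=> hp; apply: ereal_sup_ubound; exists p.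
(* If [H] is unbounded on the cell, the right-hand sides are infinite and the bounds are trivial. *)
case: (supnorm _ H) S0 HS => [s||] //; last first.
  by move=> _ _; rewrite gt0_muley ?lte_fin// !leey.
rewrite lee_fin => s0 HS.
have HM M : s <= M -> forall p, Omega_m delta 4 p -> `|H p| <= M.
  by move=> sM p hp; apply: le_trans sM; rewrite -lee_fin HS.
split.
  rewrite -EFinM lee_fin; apply: (le_scale_of_gt C0 _ s0) => M M0 sM.
  have := neck_coefficient_le eps0 eps1 delta0 eps_small harmH perH sol uL uR M0 (HM M sM).
  rewrite -/mu; have := mulr_gt0 g0 M0; lra.
have b1 : (supnorm2 (Nh eps delta) R1 <= (100 * grad_const * s + 100 * grad_const * s)%:E)%E.
  apply: supnorm2_le => p hp.
  have c0 : 0 < 100 * grad_const :> R by lra.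
  split; apply: (le_scale_of_gt c0 _ s0) => M M0 sM;
    by case: (gap_estimate eps0 eps1 delta0 delta1 eps_small harmH perH sol uL uR M0 (HM M sM) hp).
have b2 : (supnorm2 (Nv eps) R2 <= (100 * grad_const * s + 800 * grad_const * s)%:E)%E.
  apply: supnorm2_le => p hp.
  have c0 : 0 < 100 * grad_const :> R by lra.
  have c1 : 0 < 800 * grad_const :> R by lra.
  split.
    apply: (le_scale_of_gt c0 _ s0) => M M0 sM.
    by case: (neck_estimate eps0 eps1 delta0 eps_small harmH perH sol uL uR M0 (HM M sM) hp).
  apply: (le_scale_of_gt c1 _ s0) => M M0 sM.
  by case: (neck_estimate eps0 eps1 delta0 eps_small harmH perH sol uL uR M0 (HM M sM) hp).
apply: (le_trans (leeD b1 b2)); rewrite -EFinM -EFinD lee_fin; lra.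
Qed.
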